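(* Given two vectors $A=(A[i])_{i=0}^n$ and $B=(B[j])_{j=0}^n$ of non-negative integers, the vector $C=(C[k])_{k=0}^{2n}$ defined by \[C[k]=\max_{\substack{i+j=k\\0\le i,j\le n}}\min\{A[i],\,B[j]+k\}\] (the $(\max,\min)$-Skewed-Convolution of $A$ and $B$) can be computed in $\tilde{O}(n^{7/4})$ time.
   Context: $\tilde{O}(\cdot)$ suppresses polylogarithmic factors in $n$. *)

(* Defs.v *)
From Stdlib Require Import Arith List Bool.
Import ListNotations.

(* Vectors A = (A[i])_{i=0..n}, B = (B[j])_{j=0..n} are given as       *)
(* functions nat -> nat of which only indices 0..n are used.           *)
(* The index set is nonempty for k <= 2n and all candidates are >= 0,  *)
(* so folding max with base value 0 gives exactly this maximum.        *)
Definition skew_candidates (n : nat) (A B : nat -> nat) (k : nat) : list nat :=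
  map (fun i => Nat.min (A i) (B (k - i) + k))
      (filter (fun i => (i <=? k) && (k - i <=? n)) (seq 0 (S n))).

Definition skew_conv (n : nat) (A B : nat -> nat) (k : nat) : nat :=
  fold_left Nat.max (skew_candidates n A B k) 0.

(* Word RAM with word size w.  Registers r_0, r_1, ... (a program uses *)
(* finitely many, named by constants) and a memory indexed by nat.     *)
(* Every value is a w-bit word; arithmetic wraps modulo 2^w.           *)
(* Each executed instruction costs one time unit.                      *)
Inductive instr : Type :=
| IConst (d c : nat)
| IMov   (d a : nat)
| IAdd   (d a b : nat)
| ISub   (d a b : nat)
| IMul   (d a b : nat)
| IDiv   (d a b : nat)        (* r_d := r_a / r_b  (0 if r_b = 0)       *)
| IMod   (d a b : nat)
| IAnd   (d a b : nat)
| IOr    (d a b : nat)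
| IXor   (d a b : nat)
| IShl   (d a b : nat)
| IShr   (d a b : nat)
| ILt    (d a b : nat)
| ILoad  (d a : nat)
| IStore (a s : nat)
| IJz    (a l : nat)
| IJmp   (l : nat)
| IHalt.

Definition program := list instr.

Record config : Type := mkConfig {
  pc   : nat;
  regs : nat -> nat;
  mem  : nat -> nat
}.

Definition upd (f : nat -> nat) (x v : nat) : nat -> nat :=
  fun y => if y =? x then v else f y.

Definition halted (P : program) (s : config) : Prop :=
  match nth_error P (pc s) with
  | None => True
  | Some IHalt => True
  | Some _ => False
  end.

Definition step (w : nat) (P : program) (s : config) : config :=
  let W := 2 ^ w in
  let r := regs s in
  let m := mem s in
  let nx := S (pc s) in
  let setr d v := mkConfig nx (upd r d (v mod W)) m in
  match nth_error P (pc s) with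
  | None => s
  | Some IHalt => s
  | Some (IConst d c) => setr d c
  | Some (IMov d a) => setr d (r a)
  | Some (IAdd d a b) => setr d (r a + r b)
  | Some (ISub d a b) => setr d (r a + (W - r b mod W))
  | Some (IMul d a b) => setr d (r a * r b)
  | Some (IDiv d a b) => setr d (r a / r b)
  | Some (IMod d a b) => setr d (if r b =? 0 then r a else r a mod r b)
  | Some (IAnd d a b) => setr d (Nat.land (r a) (r b))
  | Some (IOr d a b) => setr d (Nat.lor (r a) (r b))
  | Some (IXor d a b) => setr d (Nat.lxor (r a) (r b))
  | Some (IShl d a b) => setr d (r a * 2 ^ r b)
  | Some (IShr d a b) => setr d (r a / 2 ^ r b)
  | Some (ILt d a b) => setr d (if r a <? r b then 1 else 0)
  | Some (ILoad d a) => setr d (m (r a))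
  | Some (IStore a s') => mkConfig nx r (upd m (r a) (r s'))
  | Some (IJz a l) => mkConfig (if r a =? 0 then l else nx) r m
  | Some (IJmp l) => mkConfig l r m
  end.

Fixpoint run (w : nat) (P : program) (t : nat) (s : config) : config :=
  match t with
  | O => s
  | S t' => run w P t' (step w P s)
  end.

Definition input_mem (n : nat) (A B : nat -> nat) : nat -> nat :=
  fun a =>
    if a =? 0 then n
    else if a <=? S n then A (a - 1)
    else if a <=? 2 * n + 2 then B (a - (n + 2))
    else 0.

Definition init_config (n : nat) (A B : nat -> nat) : config :=
  mkConfig 0 (fun _ => 0) (input_mem n A B).

Definition computes_within (w : nat) (P : program) (n : nat) (A B : nat -> nat)
    (T : nat) : Prop :=
  exists t, t <= T /\
    let s := run w P t (init_config n A B) in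
    halted P s /\
    forall k, k <= 2 * n -> mem s (2 * n + 3 + k) = skew_conv n A B k.

(* Main.v *)
Require Import Defs.
From Stdlib Require Import Arith List Lia ZArith Permutation.
Import ListNotations.

(** Sort A and B, and cut each sorted order into g ~ n^(1/4) blocks of s ~ n^(3/4) consecutive
    ranks.  For every pair (p, q) of blocks, a boolean convolution of the sets
    {rank in A >= p s} and {rank in B >= q s} tells for which k the value
    min(alpha_p, beta_q + k) is reached, alpha_p and beta_q being the least values of the blocks;
    let v0[k] be the best of these lower bounds of C[k].  If a pair (i, j) beats v0[k], with ranks
    in blocks p and q, then min(alpha_p, beta_q + k) <= v0[k]; say alpha_p <= v0[k] < A[i].  Then p
    is the last block with alpha_p <= v0[k], so scanning this single block of A, and symmetrically
    the last block of B with beta_q + k <= v0[k], yields C[k].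

    The convolutions use iterated Toom-Cook with 16 parts and 31 points: since 31 < 16^(5/4) they
    cost O~(n^(5/4)) each, hence O~(g^2 n^(5/4) + n s) = O~(n^(7/4)) overall.  Interpolation scaled by
    30! needs no division, and the scaled counts stay below 2^w, so arithmetic modulo 2^w decides
    whether a count vanishes. *)

(** * Compiling loop programs to the word RAM *)

(** The theorem asks for one instruction list, uniform in [n] and [w], together with a step count.
    The algorithm is therefore written in a small structured language with its own cost measure; a
    verified compiler transfers correctness and cost, and everything else is proved at the level of
    that language. The value of [g] is a balance: about [g^2] convolutions against [2n + 1] outputs
    that scan blocks of about [n/g] ranks. With [g ~ n^(1/4)] both sides cost [n^(7/4)] as soon as a
    convolution costs [O~(n^(5/4))]. This slack is why Toom-Cook suffices, which only needs small
    integer points and no roots of unity. Wrap-around plays two parts. In the convolutions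
    intermediate values may be negative or too large, and congruence is all that is tracked. In
    comparisons it would be fatal: the entries may fill a whole word, so [B[j] + k] can overflow,
    and this is detected explicitly. Fractional exponents are avoided throughout by comparing fourth
    powers. *)

Inductive bop := Add | Sub | Mul | Div | Mod | Lt.

Inductive expr :=
| Cst (c : nat)
| Var (x : nat)
| Mem (e : expr)
| Bin (o : bop) (a b : expr).

Inductive cmd :=
| Skip
| Asg (x : nat) (e : expr)
| Sto (a e : expr)
| Seq (c1 c2 : cmd)
| If (e : expr) (c1 c2 : cmd)
| For (x : nat) (e : expr) (c : cmd).

Record st := St { V : nat -> nat; M : nat -> nat }.

Definition setV (s : st) x v := St (upd (V s) x v) (M s).
Definition setM (s : st) a v := St (V s) (upd (M s) a v).

Definition bopev (W : nat) (o : bop) (a b : nat) : nat :=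
  match o with
  | Add => (a + b) mod W
  | Sub => (a + (W - b mod W)) mod W
  | Mul => (a * b) mod W
  | Div => (a / b) mod W
  | Mod => (if b =? 0 then a else a mod b) mod W
  | Lt => (if a <? b then 1 else 0) mod W
  end.

Fixpoint ev (W : nat) (e : expr) (s : st) : nat :=
  match e with
  | Cst c => c mod W
  | Var x => V s x
  | Mem e => M s (ev W e s)
  | Bin o a b => bopev W o (ev W a s) (ev W b s)
  end.

(** Iteration [n'] is the outermost application, so iterations run in increasing order and an
    invariant of the first [j] of them is proved by induction on [j]. *)
Fixpoint loop (f : nat -> st -> st) (n : nat) (s : st) : st :=
  match n with O => s | S n' => f n' (loop f n' s) end.

Fixpoint nsum (n : nat) (f : nat -> nat) : nat :=
  match n with O => 0 | S n' => nsum n' f + f n' end.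

Fixpoint exec (W : nat) (c : cmd) (s : st) : st :=
  match c with
  | Skip => s
  | Asg x e => setV s x (ev W e s)
  | Sto a e => setM s (ev W a s) (ev W e s)
  | Seq c1 c2 => exec W c2 (exec W c1 s)
  | If e c1 c2 => if ev W e s =? 0 then exec W c2 s else exec W c1 s
  | For x e c => loop (fun k s' => exec W c (setV s' x k)) (ev W e s) s
  end.

Fixpoint ecost (e : expr) : nat :=
  match e with
  | Cst _ | Var _ => 1
  | Mem e => ecost e + 1
  | Bin _ a b => ecost a + ecost b + 1
  end.

(** The constants count the glue emitted by the compiler. A conditional adds a branch and at most
    one jump. A loop adds 3 for resetting the counter and for the last, failing test; each iteration
    adds 6: comparison, branch, copy of the counter, and the three instructions that increment it
    and jump back. *)
Fixpoint cost (W : nat) (c : cmd) (s : st) : nat :=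
  match c with
  | Skip => 0
  | Asg _ e => ecost e + 1
  | Sto a e => ecost a + ecost e + 1
  | Seq c1 c2 => cost W c1 s + cost W c2 (exec W c1 s)
  | If e c1 c2 => ecost e + 2 + (if ev W e s =? 0 then cost W c2 s else cost W c1 s)
  | For x e c =>
      ecost e + 3 +
      nsum (ev W e s) (fun k =>
        cost W c (setV (loop (fun k s' => exec W c (setV s' x k)) k s) x k) + 6)
  end.

(** The machine reduces every register write modulo [2 ^ w], whereas [ev] returns variables and
    memory cells unreduced. The two agree on states that hold only words. *)
Definition wf (W : nat) (s : st) := (forall x, V s x < W) /\ (forall a, M s a < W).

Lemma bopev_lt W o a b : 0 < W -> bopev W o a b < W.
Proof. intros; destruct o; apply Nat.mod_upper_bound; lia. Qed.

Lemma ev_lt W e s : 0 < W -> wf W s -> ev W e s < W.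
Proof.
  intros HW [H1 H2]; destruct e; simpl; auto using bopev_lt.
  apply Nat.mod_upper_bound; lia.
Qed.

Lemma wf_setV W s x v : v < W -> wf W s -> wf W (setV s x v).
Proof.
  intros Hv [H1 H2]; split; simpl; auto.
  intros y; unfold upd; destruct (y =? x); auto.
Qed.

Lemma wf_setM W s a v : v < W -> wf W s -> wf W (setM s a v).
Proof.
  intros Hv [H1 H2]; split; simpl; auto.
  intros y; unfold upd; destruct (y =? a); auto.
Qed.

Lemma wf_exec W c : 0 < W -> forall s, wf W s -> wf W (exec W c s).
Proof.
  intros HW; induction c; intros s Hs; simpl; auto using wf_setV, wf_setM, ev_lt.
  - destruct (_ =? 0); auto.
  - pose proof (ev_lt W e s HW Hs) as Hn.
    assert (G : forall n, n <= ev W e s ->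
      wf W (loop (fun k s' => exec W c (setV s' x k)) n s)).
    { induction n; intros; simpl; auto.
      apply IHc, wf_setV; [lia|]. apply IHn; lia. }
    apply G; lia.
Qed.

(* Program variables live in the even registers, compiler temporaries in the odd ones. *)
Definition rv x := 2 * x.
Definition rt t := 2 * t + 1.

Definition bopins (o : bop) : nat -> nat -> nat -> instr :=
  match o with
  | Add => IAdd | Sub => ISub | Mul => IMul | Div => IDiv | Mod => IMod | Lt => ILt
  end.

(** Stack discipline: the value ends up in temporary [t], and only temporaries from [t] on are
    touched, so the lower ones may hold pending values. *)
Fixpoint cexpr (t : nat) (e : expr) : list instr :=
  match e with
  | Cst c => [IConst (rt t) c]
  | Var x => [IMov (rt t) (rv x)]
  | Mem e => cexpr t e ++ [ILoad (rt t) (rt t)]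
  | Bin o a b => cexpr t a ++ cexpr (S t) b ++ [bopins o (rt t) (rt t) (rt (S t))]
  end.

(** [o] is the address of the first instruction, needed because jumps are absolute. A loop keeps its
    bound in temporary [t] and its counter in [S t], and copies the counter to [x] in every
    iteration; the body works above both, so it may overwrite [x] or the variables of the bound. *)
Fixpoint ccmd (t o : nat) (c : cmd) : list instr :=
  match c with
  | Skip => []
  | Asg x e => cexpr t e ++ [IMov (rv x) (rt t)]
  | Sto a e => cexpr t a ++ cexpr (S t) e ++ [IStore (rt t) (rt (S t))]
  | Seq c1 c2 => let p := ccmd t o c1 in p ++ ccmd t (o + length p) c2
  | If e c1 c2 =>
      let pe := cexpr t e in
      let p1 := ccmd t (o + length pe + 1) c1 in
      let o2 := o + length pe + 1 + length p1 + 1 in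
      let p2 := ccmd t o2 c2 in
      pe ++ [IJz (rt t) o2] ++ p1 ++ [IJmp (o2 + length p2)] ++ p2
  | For x e c =>
      let pe := cexpr t e in
      let h := o + length pe + 1 in
      let p := ccmd (S (S t)) (h + 3) c in
      pe ++ [IConst (rt (S t)) 0] ++
      [ILt (rt (S (S t))) (rt (S t)) (rt t);
       IJz (rt (S (S t))) (h + 3 + length p + 3);
       IMov (rv x) (rt (S t))] ++ p ++
      [IConst (rt (S (S t))) 1; IAdd (rt (S t)) (rt (S t)) (rt (S (S t))); IJmp h]
  end.

Definition code_at (P : program) (o : nat) (c : list instr) :=
  forall i x, nth_error c i = Some x -> nth_error P (o + i) = Some x.

Lemma code_at_app P o a b :
  code_at P o (a ++ b) -> code_at P o a /\ code_at P (o + length a) b.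
Proof.
  intros H; split; intros i x Hi.
  - apply H. rewrite nth_error_app1; auto. apply nth_error_Some; congruence.
  - rewrite <- Nat.add_assoc. apply H.
    rewrite nth_error_app2 by lia. now replace (length a + i - length a) with i by lia.
Qed.

Lemma code_at_cons P o x b :
  code_at P o (x :: b) -> nth_error P o = Some x /\ code_at P (S o) b.
Proof.
  intros H; split.
  - rewrite <- (Nat.add_0_r o). now apply H.
  - intros i y Hi. replace (S o + i) with (o + S i) by lia. now apply H.
Qed.

Lemma run_add w P a b s : run w P (a + b) s = run w P b (run w P a s).
Proof. revert s; induction a; simpl; auto. Qed.

Record sim (cf : config) (s : st) : Prop := {
  sim_V : forall x, regs cf (rv x) = V s x;
  sim_M : forall a, mem cf a = M s a }.

(** Protects the operands and loop counters of the enclosing constructs, which sit in lower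
    temporaries. *)
Definition keep (t : nat) (cf cf' : config) :=
  forall y, y < t -> regs cf' (rt y) = regs cf (rt y).

Lemma upd_eq f x v : upd f x v x = v.
Proof. unfold upd; now rewrite Nat.eqb_refl. Qed.

Lemma upd_neq f x v y : y <> x -> upd f x v y = f y.
Proof. intros H; unfold upd; apply Nat.eqb_neq in H; now rewrite H. Qed.

Lemma sim_temp cf s t v p : sim cf s -> sim (mkConfig p (upd (regs cf) (rt t) v) (mem cf)) s.
Proof.
  intros [H1 H2]; split; simpl; auto.
  intros x; rewrite upd_neq; auto. unfold rv, rt; lia.
Qed.

Lemma keep_temp cf t t' v p m : t <= t' -> keep t cf (mkConfig p (upd (regs cf) (rt t') v) m).
Proof. intros Ht y Hy; simpl; apply upd_neq; unfold rt; lia. Qed.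

Lemma keep_trans t a b c : keep t a b -> keep t b c -> keep t a c.
Proof. intros H1 H2 y Hy; rewrite H2, H1; auto. Qed.

Lemma keep_le t t' a b : t <= t' -> keep t' a b -> keep t a b.
Proof. intros H1 H2 y Hy; apply H2; lia. Qed.

Lemma ecost_length e : forall t, length (cexpr t e) = ecost e.
Proof.
  induction e; intros; simpl; auto; rewrite ?length_app; simpl.
  - now rewrite IHe.
  - rewrite IHe1, IHe2; lia.
Qed.

Section Compile.
Variables (w : nat) (P : program).
Let W := 2 ^ w.
Hypothesis Hw : 1 < W.

Lemma run_bop cf o d a b :
  nth_error P (pc cf) = Some (bopins o d a b) ->
  run w P 1 cf =
  mkConfig (S (pc cf)) (upd (regs cf) d (bopev W o (regs cf a) (regs cf b))) (mem cf).
Proof.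
  intros H; simpl; unfold step; rewrite H; destruct o; simpl; auto.
Qed.

Lemma run_mov cf d a :
  nth_error P (pc cf) = Some (IMov d a) ->
  run w P 1 cf = mkConfig (S (pc cf)) (upd (regs cf) d (regs cf a mod W)) (mem cf).
Proof. intros H; simpl; unfold step; now rewrite H. Qed.

Lemma run_const cf d c :
  nth_error P (pc cf) = Some (IConst d c) ->
  run w P 1 cf = mkConfig (S (pc cf)) (upd (regs cf) d (c mod W)) (mem cf).
Proof. intros H; simpl; unfold step; now rewrite H. Qed.

Lemma run_load cf d a :
  nth_error P (pc cf) = Some (ILoad d a) ->
  run w P 1 cf = mkConfig (S (pc cf)) (upd (regs cf) d (mem cf (regs cf a) mod W)) (mem cf).
Proof. intros H; simpl; unfold step; now rewrite H. Qed.

Lemma run_store cf a b :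
  nth_error P (pc cf) = Some (IStore a b) ->
  run w P 1 cf = mkConfig (S (pc cf)) (regs cf) (upd (mem cf) (regs cf a) (regs cf b)).
Proof. intros H; simpl; unfold step; now rewrite H. Qed.

Lemma run_jz cf a l :
  nth_error P (pc cf) = Some (IJz a l) ->
  run w P 1 cf = mkConfig (if regs cf a =? 0 then l else S (pc cf)) (regs cf) (mem cf).
Proof. intros H; simpl; unfold step; now rewrite H. Qed.

Lemma run_jmp cf l :
  nth_error P (pc cf) = Some (IJmp l) ->
  run w P 1 cf = mkConfig l (regs cf) (mem cf).
Proof. intros H; simpl; unfold step; now rewrite H. Qed.

Lemma cexpr_correct e : forall t cf s,
  wf W s -> sim cf s -> code_at P (pc cf) (cexpr t e) ->
  let cf' := run w P (ecost e) cf in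
  pc cf' = pc cf + ecost e /\ regs cf' (rt t) = ev W e s /\ sim cf' s /\ keep t cf cf'.
Proof.
  induction e as [c|x|e IH|o a IHa b IHb]; intros t cf s Hs Hsim Hc; cbn [ecost cexpr] in *.
  - apply code_at_cons in Hc as [Hc _].
    rewrite (run_const _ _ _ Hc). simpl.
    split; [lia|]; split; [apply upd_eq|split; [now apply sim_temp | now apply keep_temp]].
  - apply code_at_cons in Hc as [Hc _].
    rewrite (run_mov _ _ _ Hc). simpl.
    split; [lia|]; split; [|split; [now apply sim_temp | now apply keep_temp]].
    rewrite upd_eq, (sim_V _ _ Hsim). apply Nat.mod_small, Hs.
  - apply code_at_app in Hc as [H1 H2].
    destruct (IH t cf s Hs Hsim H1) as (Q1 & Q2 & Q3 & Q4).
    rewrite run_add. set (cf1 := run w P (ecost e) cf) in *.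
    rewrite ecost_length, <- Q1 in H2. apply code_at_cons in H2 as [H2 _].
    rewrite (run_load _ _ _ H2). simpl.
    split; [lia|]; split; [|split; [now apply sim_temp|]].
    + rewrite upd_eq, (sim_M _ _ Q3), Q2. apply Nat.mod_small, Hs.
    + eapply keep_trans; [apply Q4 | now apply keep_temp].
  - apply code_at_app in Hc as [H1 H2]. apply code_at_app in H2 as [H2 H3].
    rewrite !ecost_length in *.
    destruct (IHa t cf s Hs Hsim H1) as (Q1 & Q2 & Q3 & Q4).
    rewrite !run_add. set (cf1 := run w P (ecost a) cf) in *.
    rewrite <- Q1 in *.
    destruct (IHb (S t) cf1 s Hs Q3 H2) as (R1 & R2 & R3 & R4).
    set (cf2 := run w P (ecost b) cf1) in *.
    rewrite <- R1 in *. apply code_at_cons in H3 as [H3 _].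
    rewrite (run_bop _ _ _ _ _ H3). cbn [pc regs mem].
    split; [lia|]; split; [|split; [now apply sim_temp|]].
    + rewrite upd_eq. rewrite (R4 t) by lia. now rewrite Q2, R2.
    + eapply keep_trans; [apply Q4|]. eapply keep_trans; [|now apply keep_temp].
      eapply keep_le; [|apply R4]; lia.
Qed.

(** Only [k <= cost] holds, because the jump over the second branch of a conditional is charged to
    both branches. [t] and [cf] stay general, since subcommands are compiled at other addresses and
    with higher temporaries. *)
Lemma ccmd_correct c : forall t cf s,
  wf W s -> sim cf s -> code_at P (pc cf) (ccmd t (pc cf) c) ->
  exists k, k <= cost W c s /\
  let cf' := run w P k cf in
  pc cf' = pc cf + length (ccmd t (pc cf) c) /\ sim cf' (exec W c s) /\ keep t cf cf'.
Proof.
  induction c as [|x e|a e|c1 IH1 c2 IH2|e c1 IH1 c2 IH2|x e c IH];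
    intros t cf s Hs Hsim Hc; cbn [cost ccmd exec] in *.
  - exists 0; simpl; repeat split; auto; try lia; try apply Hsim.
  - exists (ecost e + 1); split; [lia|].
    apply code_at_app in Hc as [H1 H2]. rewrite length_app, ecost_length in *.
    destruct (cexpr_correct e t cf s Hs Hsim H1) as (Q1 & Q2 & Q3 & Q4).
    rewrite run_add. set (cf1 := run w P (ecost e) cf) in *.
    rewrite <- Q1 in *. apply code_at_cons in H2 as [H2 _].
    rewrite (run_mov _ _ _ H2). simpl.
    split; [lia|]; split.
    + split; simpl; [|apply Q3]. intros y. rewrite Q2.
      rewrite Nat.mod_small by (apply ev_lt; auto; lia).
      unfold upd. replace (rv y =? rv x) with (y =? x).
      * destruct (y =? x); auto; apply Q3.
      * unfold rv. destruct (Nat.eqb_spec y x); symmetry; [apply Nat.eqb_eq|apply Nat.eqb_neq]; lia.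
    + intros y Hy; simpl. rewrite upd_neq by (unfold rv, rt; lia). now apply Q4.
  - exists (ecost a + ecost e + 1); split; [lia|].
    apply code_at_app in Hc as [H1 H2]. apply code_at_app in H2 as [H2 H3].
    rewrite !length_app, !ecost_length in *.
    destruct (cexpr_correct a t cf s Hs Hsim H1) as (Q1 & Q2 & Q3 & Q4).
    rewrite !run_add. set (cf1 := run w P (ecost a) cf) in *.
    rewrite <- Q1 in *.
    destruct (cexpr_correct e (S t) cf1 s Hs Q3 H2) as (R1 & R2 & R3 & R4).
    set (cf2 := run w P (ecost e) cf1) in *.
    rewrite <- R1 in *. apply code_at_cons in H3 as [H3 _].
    rewrite (run_store _ _ _ H3). simpl.
    split; [lia|]; split.
    + split; simpl; [apply R3|]. intros y.
      rewrite R2, (R4 t), Q2 by lia. unfold upd. destruct (y =? _); auto; apply R3.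
    + eapply keep_trans; [apply Q4|]. intros y Hy; simpl. apply R4; lia.
  - apply code_at_app in Hc as [H1 H2].
    destruct (IH1 t cf s Hs Hsim H1) as (k1 & Hk1 & Q1 & Q2 & Q3).
    set (cf1 := run w P k1 cf) in *. rewrite <- Q1 in *.
    destruct (IH2 t cf1 (exec W c1 s)) as (k2 & Hk2 & R1 & R2 & R3); auto.
    { apply wf_exec; auto; lia. }
    exists (k1 + k2); split; [lia|]. rewrite run_add. fold cf1.
    split; [|split; auto; eapply keep_trans; eauto].
    rewrite R1, length_app. lia.
  - apply code_at_app in Hc as [H1 H2]. apply code_at_app in H2 as [H2 H3].
    apply code_at_app in H3 as [H3 H4]. apply code_at_app in H4 as [H4 H5].
    rewrite !length_app, !ecost_length in *. cbn [length] in *.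
    destruct (cexpr_correct e t cf s Hs Hsim H1) as (Q1 & Q2 & Q3 & Q4).
    set (cf1 := run w P (ecost e) cf) in *.
    set (p1 := ccmd t (pc cf + ecost e + 1) c1) in *.
    set (o2 := pc cf + ecost e + 1 + length p1 + 1) in *.
    set (p2 := ccmd t o2 c2) in *.
    rewrite <- Q1 in H2. apply code_at_cons in H2 as [H2 _].
    pose proof (run_jz _ _ _ H2) as Hz. rewrite Q2 in Hz.
    destruct (ev W e s =? 0) eqn:E.
    + set (cf2 := run w P 1 cf1) in *.
      assert (Hs2 : sim cf2 s) by (rewrite Hz; split; apply Q3).
      assert (K2 : keep t cf cf2) by (rewrite Hz; exact Q4).
      assert (P2 : pc cf2 = o2) by now rewrite Hz.
      destruct (IH2 t cf2 s Hs Hs2) as (k & Hk & R1 & R2 & R3).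
      { rewrite P2. fold p2. unfold o2 in *. rewrite ?Nat.add_assoc in *. exact H5. }
      exists (ecost e + 1 + k); split; [lia|].
      rewrite !run_add. fold cf1. fold cf2. split; [|split; auto; eapply keep_trans; eauto].
      rewrite R1, P2. fold p2. unfold o2. lia.
    + set (cf2 := run w P 1 cf1) in *.
      assert (Hs2 : sim cf2 s) by (rewrite Hz; split; apply Q3).
      assert (K2 : keep t cf cf2) by (rewrite Hz; exact Q4).
      assert (P2 : pc cf2 = pc cf + ecost e + 1) by (rewrite Hz; simpl; lia).
      destruct (IH1 t cf2 s Hs Hs2) as (k & Hk & R1 & R2 & R3).
      { rewrite P2. exact H3. }
      set (cf3 := run w P k cf2) in *. rewrite P2 in R1. fold p1 in R1.
      rewrite <- R1 in H4. apply code_at_cons in H4 as [H4 _].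
      pose proof (run_jmp _ _ H4) as Hj.
      exists (ecost e + 1 + k + 1); split; [lia|].
      rewrite !run_add. fold cf1. fold cf2. fold cf3. rewrite Hj. simpl.
      split; [|split].
      * unfold o2. lia.
      * split; apply R2.
      * intros y Hy; simpl. rewrite R3, K2; auto.
  - apply code_at_app in Hc as [H1 H2]. apply code_at_app in H2 as [H2 H3].
    apply code_at_app in H3 as [H3 H4]. apply code_at_app in H4 as [H4 H5].
    rewrite !length_app, !ecost_length in *. cbn [length] in *.
    set (h := pc cf + ecost e + 1) in *.
    set (p := ccmd (S (S t)) (h + 3) c) in *.
    set (n := ev W e s) in *.
    assert (Hn : n < W) by (apply ev_lt; auto; lia).
    destruct (cexpr_correct e t cf s Hs Hsim H1) as (Q1 & Q2 & Q3 & Q4).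
    set (cf1 := run w P (ecost e) cf) in *.
    rewrite <- Q1 in H2. apply code_at_cons in H2 as [H2 _].
    pose proof (run_const _ _ _ H2) as Hz.
    set (cf2 := run w P 1 cf1) in *.
    apply code_at_cons in H3 as [L1 H3]. apply code_at_cons in H3 as [L2 H3].
    apply code_at_cons in H3 as [L3 _].
    apply code_at_cons in H5 as [L4 H5]. apply code_at_cons in H5 as [L5 H5].
    apply code_at_cons in H5 as [L6 _].
    set (body := fun k s' => exec W c (setV s' x k)) in *.
    assert (Hwf : forall j, j <= n -> wf W (loop body j s)).
    { induction j; intros; simpl; auto. apply wf_exec, wf_setV; auto; try lia.
      apply IHj; lia. }
    (* The configuration at the loop head [h] after [j] iterations, before the test: bound and
       counter are still in their temporaries. *)
    assert (LOOP : forall j, j <= n -> exists k,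
      k <= nsum j (fun k => cost W c (setV (loop body k s) x k) + 6) /\
      let cf' := run w P k cf2 in
      pc cf' = h /\ sim cf' (loop body j s) /\ keep t cf cf' /\
      regs cf' (rt t) = n /\ regs cf' (rt (S t)) = j).
    { induction j; intros Hj.
      - exists 0; split; [simpl; lia|]. cbn [run]. cbv zeta. rewrite Hz. cbn [pc regs mem].
        split; [unfold h; lia|]. split; [now apply sim_temp|]. split.
        { eapply keep_trans; [apply Q4 | apply keep_temp; lia]. }
        rewrite upd_eq, upd_neq by (unfold rt; lia). split; auto.
        apply Nat.mod_small; lia.
      - destruct (IHj ltac:(lia)) as (k & Hk & R1 & R2 & R3 & R4 & R5).
        set (cf3 := run w P k cf2) in *.
        rewrite <- R1 in L1.
        pose proof (run_bop _ Lt _ _ _ L1) as E1.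
        set (cf4 := run w P 1 cf3) in *. unfold bopev in E1. rewrite R4, R5 in E1.
        replace (j <? n) with true in E1 by (symmetry; apply Nat.ltb_lt; lia).
        rewrite Nat.mod_small in E1 by lia.
        assert (P4 : pc cf4 = S h) by (rewrite E1; simpl; lia).
        replace (pc cf + ecost e + 1) with h in L2, L3, H4, L4, L5, L6 by reflexivity.
        rewrite <- P4 in L2.
        pose proof (run_jz _ _ _ L2) as E2. set (cf5 := run w P 1 cf4) in *.
        replace (regs cf4 (rt (S (S t)))) with 1 in E2 by (rewrite E1; simpl; now rewrite upd_eq).
        simpl Nat.eqb in E2. cbv iota in E2.
        assert (P5 : pc cf5 = S (S h)) by (rewrite E2; simpl; lia).
        rewrite <- P5 in L3.
        pose proof (run_mov _ _ _ L3) as E3. set (cf6 := run w P 1 cf5) in *.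
        assert (T5 : forall y, y < S (S t) -> regs cf5 (rt y) = regs cf3 (rt y)).
        { intros y Hy. rewrite E2; simpl. rewrite E1; simpl. apply upd_neq. unfold rt; lia. }
        assert (V5 : forall y, regs cf5 (rv y) = V (loop body j s) y).
        { intros y. rewrite E2; simpl. rewrite E1; simpl. rewrite upd_neq by (unfold rt, rv; lia). apply R2. }
        assert (M5 : forall a, mem cf5 a = M (loop body j s) a).
        { intros y. rewrite E2; simpl. rewrite E1; simpl. apply R2. }
        assert (T6 : forall y, y < S (S t) -> regs cf6 (rt y) = regs cf3 (rt y)).
        { intros y Hy. rewrite E3; simpl. rewrite upd_neq by (unfold rv, rt; lia). auto. }
        assert (S6 : sim cf6 (setV (loop body j s) x j)).
        { rewrite E3. split; simpl; auto. intros y.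
          rewrite T5, R5, Nat.mod_small by lia. unfold upd.
          replace (rv y =? rv x) with (y =? x); [destruct (y =? x); auto|].
          unfold rv. destruct (Nat.eqb_spec y x); symmetry; [apply Nat.eqb_eq|apply Nat.eqb_neq]; lia. }
        assert (P6 : pc cf6 = h + 3) by (rewrite E3; simpl; lia).
        destruct (IH (S (S t)) cf6 (setV (loop body j s) x j)) as (k' & Hk' & U1 & U2 & U3); auto.
        { apply wf_setV; [lia|]. apply Hwf; lia. }
        { rewrite P6. fold p. exact H4. }
        set (cf7 := run w P k' cf6) in *. rewrite P6 in U1. fold p in U1.
        rewrite <- U1 in L4.
        pose proof (run_const _ _ _ L4) as E4. set (cf8 := run w P 1 cf7) in *.
        assert (P8 : pc cf8 = S (pc cf7)) by (rewrite E4; simpl; lia).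
        rewrite U1 in P8. rewrite <- P8 in L5.
        pose proof (run_bop _ Add _ _ _ L5) as E5. set (cf9 := run w P 1 cf8) in *.
        assert (P9 : pc cf9 = S (pc cf8)) by (rewrite E5; simpl; lia).
        rewrite P8 in P9. rewrite <- P9 in L6.
        pose proof (run_jmp _ _ L6) as E6.
        exists (k + 1 + 1 + 1 + k' + 1 + 1 + 1). split; [simpl; lia|].
        rewrite !run_add. fold cf3 cf4 cf5 cf6 cf7 cf8 cf9. cbv zeta. rewrite E6. cbn [pc regs mem].
        assert (T8 : forall y, y < S (S t) -> regs cf8 (rt y) = regs cf3 (rt y)).
        { intros y Hy. rewrite E4; simpl. rewrite upd_neq by (unfold rt; lia). rewrite U3; auto. }
        split; [auto|]. split; [|split; [|split]].
        + rewrite E5, E4. split; simpl; intros; [|apply U2].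
          rewrite !upd_neq by (unfold rt, rv; lia). apply U2.
        + intros y Hy. rewrite E5; simpl. rewrite upd_neq by (unfold rt; lia).
          rewrite T8 by lia. apply R3; auto.
        + rewrite E5; simpl. rewrite upd_neq by (unfold rt; lia). rewrite T8; auto.
        + rewrite E5; cbn [regs]. rewrite upd_eq. rewrite T8, R5 by lia.
          replace (regs cf8 (rt (S (S t)))) with 1.
          * unfold bopev. rewrite Nat.mod_small; lia.
          * rewrite E4; simpl. rewrite upd_eq. symmetry. apply Nat.mod_small; lia. }
    destruct (LOOP n (le_n _)) as (k & Hk & R1 & R2 & R3 & R4 & R5).
    set (cf3 := run w P k cf2) in *.
    rewrite <- R1 in L1.
    pose proof (run_bop _ Lt _ _ _ L1) as E1.
    set (cf4 := run w P 1 cf3) in *. unfold bopev in E1. rewrite R4, R5 in E1.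
    rewrite Nat.ltb_irrefl, Nat.mod_small in E1 by lia.
    assert (P4 : pc cf4 = S h) by (rewrite E1; simpl; lia).
    rewrite <- P4 in L2.
    pose proof (run_jz _ _ _ L2) as E2.
    replace (regs cf4 (rt (S (S t)))) with 0 in E2 by (rewrite E1; simpl; now rewrite upd_eq).
    simpl Nat.eqb in E2. cbv iota in E2.
    exists (ecost e + 1 + k + 1 + 1). split; [lia|].
    rewrite !run_add. fold cf1 cf2 cf3 cf4. cbv zeta. rewrite E2, E1. cbn [pc regs mem].
    split; [unfold h; lia|]. split; [now apply sim_temp|].
    eapply keep_trans; [apply R3 | apply keep_temp; lia].
Qed.

End Compile.

(** * Cost triples *)

Fixpoint writes (c : cmd) : list nat :=
  match c with
  | Skip | Sto _ _ => []
  | Asg x _ => [x]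
  | Seq c1 c2 | If _ c1 c2 => writes c1 ++ writes c2
  | For x _ c => x :: writes c
  end.

(** Boolean, so that for concrete programs the side condition of the frame rule is settled by
    computation. *)
Definition inb x (l : list nat) := existsb (Nat.eqb x) l.

Lemma inb_app x a b : inb x (a ++ b) = (inb x a || inb x b)%bool.
Proof. apply existsb_app. Qed.

Lemma exec_frame W c x : forall s, inb x (writes c) = false -> V (exec W c s) x = V s x.
Proof.
  induction c; intros s H; cbn [exec writes] in *; auto.
  - cbn in H. rewrite Bool.orb_false_r in H. simpl. unfold upd. now rewrite H.
  - rewrite inb_app in H. apply Bool.orb_false_iff in H as [H1 H2].
    now rewrite IHc2, IHc1.
  - rewrite inb_app in H. apply Bool.orb_false_iff in H as [H1 H2].
    destruct (_ =? 0); auto.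
  - cbn in H. apply Bool.orb_false_iff in H as [H1 H2].
    induction (ev W e s); simpl; auto. rewrite IHc by auto. simpl. unfold upd. now rewrite H1.
Qed.

(** The triple is about one start state instead of a precondition, so facts on [s] remain ordinary
    hypotheses. Well-formedness is an implicit premise, preserved by every command. *)
Definition ok W c s T (Q : st -> Prop) := wf W s -> Q (exec W c s) /\ cost W c s <= T.

Section Rules.
Variable W : nat.
Hypothesis HW : 1 < W.

Lemma ok_wf c s T Q : (wf W s -> ok W c s T Q) -> ok W c s T Q.
Proof. intros H Hs; now apply H. Qed.

(** Usually applied first with [T] left open: the rules then assemble the actual cost, and its
    comparison with the stated bound is postponed to the end. The new postcondition may also use
    that unwritten variables are unchanged. *)
Lemma ok_weaken c s T T' (Q Q' : st -> Prop) :
  ok W c s T Q -> T <= T' ->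
  (forall s', wf W s' -> (forall x, inb x (writes c) = false -> V s' x = V s x) -> Q s' -> Q' s') ->
  ok W c s T' Q'.
Proof.
  intros H HT HQ Hs; destruct (H Hs); split; [|lia].
  apply HQ; auto; [apply wf_exec; auto; lia|]. intros; now apply exec_frame.
Qed.

Lemma ok_skip s (Q : st -> Prop) : Q s -> ok W Skip s 0 Q.
Proof. intros H Hs; split; simpl; auto. Qed.

Lemma ok_asg x e s (Q : st -> Prop) :
  Q (setV s x (ev W e s)) -> ok W (Asg x e) s (ecost e + 1) Q.
Proof. intros H Hs; split; simpl; auto. Qed.

Lemma ok_sto a e s (Q : st -> Prop) :
  Q (setM s (ev W a s) (ev W e s)) -> ok W (Sto a e) s (ecost a + ecost e + 1) Q.
Proof. intros H Hs; split; simpl; auto. Qed.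

Lemma ok_seq c1 c2 s T1 T2 Q :
  ok W c1 s T1 (fun s' => ok W c2 s' T2 Q) -> ok W (Seq c1 c2) s (T1 + T2) Q.
Proof.
  intros H Hs; destruct (H Hs) as [H1 H2].
  destruct H1 as [H3 H4]; [apply wf_exec; auto; lia|]. split; simpl; auto. lia.
Qed.

Lemma ok_seq_asg x e c s T Q :
  (wf W s -> ok W c (setV s x (ev W e s)) T Q) -> ok W (Seq (Asg x e) c) s (ecost e + 1 + T) Q.
Proof. intros H. apply ok_wf; intros Hs. apply ok_seq, ok_asg; auto. Qed.

(** Adding the two branch costs instead of taking their maximum keeps the bounds linear. *)
Lemma ok_if e c1 c2 s T1 T2 Q :
  (ev W e s <> 0 -> ok W c1 s T1 Q) -> (ev W e s = 0 -> ok W c2 s T2 Q) ->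
  ok W (If e c1 c2) s (ecost e + 2 + T1 + T2) Q.
Proof.
  intros H1 H2 Hs; simpl. destruct (Nat.eqb_spec (ev W e s) 0) as [E|E].
  - destruct (H2 E Hs); split; auto; lia.
  - destruct (H1 E Hs); split; auto; lia.
Qed.

Lemma nsum_le n f T : (forall k, k < n -> f k <= T) -> nsum n f <= n * T.
Proof.
  induction n; intros H; simpl; auto.
  specialize (IHn ltac:(auto)). specialize (H n ltac:(auto)). lia.
Qed.

Lemma ok_for x e c s T (I : nat -> st -> Prop) (Q : st -> Prop) :
  I 0 s ->
  (forall k s1, k < ev W e s -> I k s1 -> wf W s1 ->
     (forall y, inb y (x :: writes c) = false -> V s1 y = V s y) ->
     ok W c (setV s1 x k) T (I (S k))) ->
  (forall s1, I (ev W e s) s1 -> wf W s1 ->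
     (forall y, inb y (x :: writes c) = false -> V s1 y = V s y) -> Q s1) ->
  ok W (For x e c) s (ecost e + 3 + ev W e s * (T + 6)) Q.
Proof.
  intros H0 H1 H2 Hs; cbn [exec cost].
  set (n := ev W e s) in *.
  assert (Hn : n < W) by (apply ev_lt; auto; lia).
  set (body := fun k s' => exec W c (setV s' x k)).
  assert (G : forall j, j <= n -> I j (loop body j s) /\ wf W (loop body j s) /\
     (forall y, inb y (x :: writes c) = false -> V (loop body j s) y = V s y)).
  { induction j; intros Hj; simpl; auto.
    destruct IHj as (G1 & G2 & G3); [lia|].
    assert (G4 : wf W (setV (loop body j s) x j)) by (apply wf_setV; auto; lia).
    destruct (H1 j (loop body j s) ltac:(lia) G1 G2 G3 G4) as [G5 G6].
    split; auto. split; [apply wf_exec; auto; lia|].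
    intros y Hy. unfold body at 1. cbn in Hy. pose proof Hy as Hy'.
    apply Bool.orb_false_iff in Hy as [Hy1 Hy2].
    rewrite exec_frame by auto. simpl. unfold upd. rewrite Hy1. now apply G3. }
  split.
  - destruct (G n (le_n _)) as (G1 & G2 & G3). now apply H2.
  - apply Nat.add_le_mono_l. apply nsum_le. intros k Hk.
    destruct (G k ltac:(lia)) as (G1 & G2 & G3).
    destruct (H1 k _ Hk G1 G2 G3) as [G5 G6]; [apply wf_setV; auto; lia|].
    fold body. lia.
Qed.

Lemma ok_for_n n x e c s T (I : nat -> st -> Prop) (Q : st -> Prop) :
  ev W e s = n ->
  I 0 s ->
  (forall k s1, k < n -> I k s1 -> wf W s1 ->
     (forall y, inb y (x :: writes c) = false -> V s1 y = V s y) ->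
     ok W c (setV s1 x k) T (I (S k))) ->
  (forall s1, I n s1 -> wf W s1 ->
     (forall y, inb y (x :: writes c) = false -> V s1 y = V s y) -> Q s1) ->
  ok W (For x e c) s (ecost e + 3 + n * (T + 6)) Q.
Proof. intros <-; apply ok_for. Qed.

Lemma add_eq a b : a + b < W -> bopev W Add a b = a + b.
Proof. intros; simpl; now apply Nat.mod_small. Qed.

Lemma mul_eq a b : a * b < W -> bopev W Mul a b = a * b.
Proof. intros; simpl; now apply Nat.mod_small. Qed.

Lemma sub_eq a b : b <= a -> a < W -> bopev W Sub a b = a - b.
Proof.
  intros; simpl. rewrite (Nat.mod_small b) by lia.
  replace (a + (W - b)) with (a - b + 1 * W) by lia.
  rewrite Nat.Div0.mod_add. apply Nat.mod_small; lia.
Qed.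

Lemma div_eq a b : a < W -> bopev W Div a b = a / b.
Proof.
  intros; simpl. apply Nat.mod_small. destruct b; [simpl; lia|].
  eapply Nat.le_lt_trans; [apply Nat.Div0.div_le_upper_bound with (q := a)|auto]. nia.
Qed.

Lemma mod_eq a b : a < W -> bopev W Mod a b = a mod b.
Proof.
  intros; simpl. destruct b; simpl (_ =? _); cbv iota.
  - now apply Nat.mod_small.
  - apply Nat.mod_small. pose proof (Nat.Div0.mod_le a (S b)). lia.
Qed.

Lemma lt_eq a b : bopev W Lt a b = if a <? b then 1 else 0.
Proof. simpl. apply Nat.mod_small. destruct (a <? b); lia. Qed.

End Rules.

(** * Toom-Cook convolution as iterated matrix application *)

Section Toom.
Open Scope Z_scope.

Fixpoint zsum (n : nat) (f : nat -> Z) : Z :=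
  match n with O => 0 | S n' => zsum n' f + f n' end.

Lemma zsum_ext n f g : (forall i, (i < n)%nat -> f i = g i) -> zsum n f = zsum n g.
Proof.
  induction n; intros H; simpl; auto. rewrite IHn, H; auto.
Qed.

Lemma zsum_0 n f : (forall i, (i < n)%nat -> f i = 0) -> zsum n f = 0.
Proof. induction n; intros H; simpl; auto. rewrite IHn, H; auto. Qed.

Lemma zsum_add n f g : zsum n (fun i => f i + g i) = zsum n f + zsum n g.
Proof. induction n; simpl; auto. rewrite IHn; ring. Qed.

Lemma zsum_mull n c f : zsum n (fun i => c * f i) = c * zsum n f.
Proof. induction n; simpl; [ring|]. rewrite IHn; ring. Qed.

Lemma zsum_mulr n c f : zsum n (fun i => f i * c) = zsum n f * c.
Proof. induction n; simpl; [ring|]. rewrite IHn; ring. Qed.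

Lemma zsum_swap n m f :
  zsum n (fun i => zsum m (fun j => f i j)) = zsum m (fun j => zsum n (fun i => f i j)).
Proof.
  induction n; simpl.
  - symmetry; apply zsum_0; auto.
  - rewrite IHn, <- zsum_add. reflexivity.
Qed.

Lemma zsum_plus n m f : zsum (n + m) f = zsum n f + zsum m (fun i => f (n + i)%nat).
Proof.
  induction m; simpl; [rewrite Nat.add_0_r; ring|].
  rewrite Nat.add_succ_r; simpl. rewrite IHm; ring.
Qed.

Lemma zsum_prod a b f :
  zsum (a * b) f = zsum a (fun t => zsum b (fun u => f (t * b + u)%nat)).
Proof.
  induction a; simpl; auto.
  rewrite Nat.add_comm, zsum_plus, IHa. reflexivity.
Qed.

Lemma zsum_mul n m f g : zsum n f * zsum m g = zsum n (fun i => zsum m (fun j => f i * g j)).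
Proof. rewrite <- zsum_mulr. apply zsum_ext; intros. now rewrite zsum_mull. Qed.

Definition ind (b : bool) : Z := if b then 1 else 0.

(* One matrix application along an axis of length [C] and stride [N], turning it into an axis of
   length [R]. *)
Definition axis (N R C : nat) (G : nat -> nat -> Z) (X : nat -> Z) (i : nat) : Z :=
  zsum C (fun t => G ((i / N) mod R)%nat t * X ((i / N / R * C + t) * N + i mod N)%nat).

(** The Vandermonde matrix of the evaluation points; [0 ^ 0 = 1] makes the point 0 read off the
    constant term. *)
Definition evm (q t : nat) : Z := Z.of_nat q ^ Z.of_nat t.

Variables (F : nat -> nat -> Z) (D : Z).
Hypothesis FD : forall k s, (k < 31)%nat -> (s < 31)%nat ->
  zsum 31 (fun tau => F k tau * evm tau s) = if (s =? k)%nat then D else 0.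

(* Interpolation followed by overlap-add: the half blocks [2 tau] and [2 tau + 1] of the product
   at the point [tau] contribute to the coefficients [q] and [q + 1] respectively. *)
Definition itm (q t : nat) : Z :=
  let k := (q - t mod 2)%nat in
  if (t mod 2 <=? q)%nat then if (k <? 31)%nat then F k (t / 2) else 0 else 0.

(** The leading base-16 digit goes first: a block of length [16 ^ S l'] becomes 31 blocks of length
    [16 ^ l'], its values at the 31 points. After all levels [16 ^ l] entries have become [31 ^ l]
    scalars. *)
Fixpoint fwds (l : nat) (X : nat -> Z) : nat -> Z :=
  match l with O => X | S l' => fwds l' (axis (16 ^ l') 31 16 evm X) end.

(** Innermost level first. A level reads 31 products of length [2 * 16 ^ l'] as 62 half blocks and
    turns them into 32 blocks of length [16 ^ l'], that is, one product of length
    [2 * 16 ^ S l']. *)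
Fixpoint invs (l : nat) (X : nat -> Z) : nat -> Z :=
  match l with O => X | S l' => axis (16 ^ l') 32 62 itm (invs l' X) end.

Lemma fwds_S l X : fwds (S l) X = fwds l (axis (16 ^ l) 31 16 evm X).
Proof. reflexivity. Qed.

Lemma invs_S l X : invs (S l) X = axis (16 ^ l) 32 62 itm (invs l X).
Proof. reflexivity. Qed.

(** A product of two blocks of length [N] occupies [2 * N] cells; for scalars, [N = 1], the second
    cell is 0. *)
Definition spread (X Y : nat -> Z) (i : nat) : Z :=
  ind (i mod 2 <? 1)%nat * (X (i / 2)%nat * Y (i / 2)%nat).

Lemma axis_block N R C G X h q s : (q < R)%nat -> (s < N)%nat ->
  axis N R C G X ((h * R + q) * N + s)%nat =
  zsum C (fun t => G q t * X ((h * C + t) * N + s)%nat).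
Proof.
  intros Hq Hs. unfold axis.
  replace (((h * R + q) * N + s) / N)%nat with (h * R + q)%nat
    by (apply Nat.div_unique with s; lia).
  replace (((h * R + q) * N + s) mod N)%nat with s
    by (apply Nat.mod_unique with (h * R + q)%nat; lia).
  replace ((h * R + q) mod R)%nat with q by (apply Nat.mod_unique with h; lia).
  replace ((h * R + q) / R)%nat with h by (apply Nat.div_unique with q; lia).
  reflexivity.
Qed.

(** [e] tells the low from the high half of a block product. Half [e] of coefficient [s] belongs to
    output block [s + e], and [FD] filters out every other [s]; block 31 is reached only by the high
    half of coefficient 30. *)
Lemma itm_interp q e s : (q < 32)%nat -> (e < 2)%nat -> (s < 31)%nat ->
  zsum 31 (fun tau => itm q (tau * 2 + e) * evm tau s) = D * ind (s + e =? q)%nat.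
Proof.
  intros Hq He Hs.
  assert (A : forall tau, (itm q (tau * 2 + e) =
    if (e <=? q)%nat then if (q - e <? 31)%nat then F (q - e) tau else 0 else 0)).
  { intros tau. unfold itm.
    replace ((tau * 2 + e) mod 2)%nat with e by (apply Nat.mod_unique with tau; lia).
    now replace ((tau * 2 + e) / 2)%nat with tau by (apply Nat.div_unique with e; lia). }
  rewrite (zsum_ext _ _ (fun tau => (if (e <=? q)%nat then
     if (q - e <? 31)%nat then F (q - e) tau else 0 else 0) * evm tau s)) by (intros; now rewrite A).
  destruct (Nat.leb_spec e q); [destruct (Nat.ltb_spec (q - e) 31)|].
  - rewrite FD by lia. unfold ind. destruct (Nat.eqb_spec s (q - e)), (Nat.eqb_spec (s + e) q); lia.
  - rewrite zsum_0 by (intros; ring). unfold ind. destruct (Nat.eqb_spec (s + e) q); lia.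
  - rewrite zsum_0 by (intros; ring). unfold ind. destruct (Nat.eqb_spec (s + e) q); lia.
Qed.

Definition conv (N : nat) (X Y : nat -> Z) (v : nat) : Z :=
  zsum N (fun i => zsum N (fun j => ind (i + j =? v)%nat * (X i * Y j))).

Lemma conv_ext N X Y X' Y' v :
  (forall i, (i < N)%nat -> X i = X' i) -> (forall i, (i < N)%nat -> Y i = Y' i) ->
  conv N X Y v = conv N X' Y' v.
Proof.
  intros H1 H2. apply zsum_ext; intros i Hi. apply zsum_ext; intros j Hj.
  now rewrite H1, H2.
Qed.

(* [e] is the carry of [u + u'] into the next block. *)
Lemma conv_split N X Y q s : (s < N)%nat -> 
  conv (16 * N) X Y (q * N + s)%nat =
  zsum 16 (fun t => zsum 16 (fun t' => zsum 2 (fun e => ind (t + t' + e =? q)%nat *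
    conv N (fun u => X (t * N + u)%nat) (fun u => Y (t' * N + u)%nat) (e * N + s)%nat))).
Proof.
  intros Hs. unfold conv. rewrite zsum_prod. apply zsum_ext; intros t Ht.
  rewrite (zsum_ext N _ (fun u => zsum 16 (fun t' => zsum N (fun u' =>
     ind (t * N + u + (t' * N + u') =? q * N + s)%nat * (X (t * N + u)%nat * Y (t' * N + u')%nat)))))
    by (intros; now rewrite zsum_prod).
  rewrite zsum_swap. apply zsum_ext; intros t' Ht'.
  cbn [zsum]. rewrite Z.add_0_l, <- !zsum_mull, <- zsum_add.
  apply zsum_ext; intros u Hu. rewrite <- !zsum_mull, <- zsum_add.
  apply zsum_ext; intros u' Hu'.
  rewrite !Z.mul_assoc, <- !Z.mul_add_distr_r. f_equal. f_equal.
  unfold ind.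
  destruct (Nat.eqb_spec (t * N + u + (t' * N + u')) (q * N + s)) as [E|E];
  destruct (Nat.eqb_spec (t + t' + 0) q) as [E1|E1];
  destruct (Nat.eqb_spec (u + u') (0 * N + s)) as [E2|E2];
  destruct (Nat.eqb_spec (t + t' + 1) q) as [E3|E3];
  destruct (Nat.eqb_spec (u + u') (1 * N + s)) as [E4|E4]; try lia; exfalso; subst; try nia.
  all: try (apply E; nia).
  all: assert (t + t' < q \/ t + t' = q \/ t + t' > q)%nat as [?|[?|?]] by lia; try nia.
  all: assert (t + t' + 1 = q \/ t + t' + 2 <= q)%nat as [?|?] by lia; nia.
Qed.

(** The levels act on all blocks of the array side by side, so the statement is about an arbitrary
    block number [h]; the induction hypothesis is used for the 31 blocks [h * 31 + tau]. Each level
    contributes one factor [D]. *)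
Theorem toom_conv l : forall X Y h v, (v < 2 * 16 ^ l)%nat ->
  invs l (spread (fwds l X) (fwds l Y)) (h * (2 * 16 ^ l) + v)%nat =
  D ^ Z.of_nat l *
  conv (16 ^ l) (fun i => X (h * 16 ^ l + i)%nat) (fun i => Y (h * 16 ^ l + i)%nat) v.
Proof.
  induction l; intros X Y h v Hv.
  - cbn [invs fwds]. unfold spread, conv. simpl in Hv.
    change (16 ^ 0)%nat with 1%nat. cbn [zsum]. rewrite Z.mul_1_l, !Z.add_0_l.
    replace ((h * (2 * 1) + v) mod 2)%nat with v by (apply Nat.mod_unique with h; lia).
    replace ((h * (2 * 1) + v) / 2)%nat with h by (apply Nat.div_unique with v; lia).
    rewrite !Nat.mul_1_r, !Nat.add_0_r. f_equal.
    destruct v as [|[|]]; reflexivity || lia.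
  - cbn [invs fwds]. rewrite Nat.pow_succ_r'. set (N := (16 ^ l)%nat) in *.
    assert (HN : (0 < N)%nat) by (apply Nat.neq_0_lt_0, Nat.pow_nonzero; lia).
    set (X' := axis N 31 16 evm X). set (Y' := axis N 31 16 evm Y).
    set (Z' := invs l _).
    rewrite Nat.pow_succ_r' in Hv. fold N in Hv.
    set (q := (v / N)%nat). set (s := (v mod N)%nat).
    assert (Hvq : v = (q * N + s)%nat) by (unfold q, s; rewrite Nat.mul_comm; apply Nat.div_mod; lia).
    assert (Hs : (s < N)%nat) by (apply Nat.mod_upper_bound; lia).
    assert (Hq : (q < 32)%nat) by (apply Nat.Div0.div_lt_upper_bound; lia).
    replace (h * (2 * (16 * N)) + v)%nat with ((h * 32 + q) * N + s)%nat by (rewrite Hvq; ring).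
    rewrite axis_block by auto.
    change 62%nat with (31 * 2)%nat. rewrite zsum_prod.
    rewrite Hvq, conv_split by auto.
    transitivity (D ^ Z.of_nat l * zsum 31 (fun tau => zsum 2 (fun e => itm q (tau * 2 + e) *
      conv N (fun i => X' ((h * 31 + tau) * N + i)%nat) (fun i => Y' ((h * 31 + tau) * N + i)%nat)
         (e * N + s)%nat))).
    { rewrite <- zsum_mull. apply zsum_ext; intros tau Ht. rewrite <- zsum_mull.
      apply zsum_ext; intros e He.
      replace ((h * (31 * 2) + (tau * 2 + e)) * N + s)%nat
        with ((h * 31 + tau) * (2 * N) + (e * N + s))%nat by ring.
      unfold Z'. rewrite IHl by nia. ring. }
    rewrite Nat2Z.inj_succ, Z.pow_succ_r by lia. rewrite (Z.mul_comm D), <- Z.mul_assoc. f_equal.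
    rewrite zsum_swap, <- zsum_mull.
    (* By bilinearity, the convolution of the two values at [tau] is the sum of [tau ^ (t + t')]
       times the convolutions of the original blocks [t] and [t']. *)
    transitivity (zsum 2 (fun e => zsum 31 (fun tau => itm q (tau * 2 + e) *
      zsum 16 (fun t => zsum 16 (fun t' => evm tau (t + t') *
        conv N (fun u => X ((h * 16 + t) * N + u)%nat) (fun u => Y ((h * 16 + t') * N + u)%nat)
         (e * N + s)%nat))))).
    { apply zsum_ext; intros e He. apply zsum_ext; intros tau Ht. f_equal.
      unfold conv at 1.
      transitivity (zsum N (fun i => zsum N (fun j => zsum 16 (fun t => zsum 16 (fun t' =>
        evm tau (t + t') * (ind (i + j =? e * N + s)%nat *
         (X ((h * 16 + t) * N + i)%nat * Y ((h * 16 + t') * N + j)%nat))))))).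
      { apply zsum_ext; intros i Hi. apply zsum_ext; intros j Hj.
        unfold X', Y'. rewrite !axis_block by auto. rewrite zsum_mul, <- zsum_mull.
        apply zsum_ext; intros t Ht16. rewrite <- zsum_mull. apply zsum_ext; intros t' Ht16'.
        unfold evm. rewrite Nat2Z.inj_add, Z.pow_add_r by lia. ring. }
      rewrite (zsum_ext N _ (fun i => zsum 16 (fun t => zsum 16 (fun t' => zsum N (fun j =>
        evm tau (t + t') * (ind (i + j =? e * N + s)%nat *
         (X ((h * 16 + t) * N + i)%nat * Y ((h * 16 + t') * N + j)%nat))))))).
      2:{ intros i Hi. rewrite zsum_swap. apply zsum_ext; intros t Ht16. now rewrite zsum_swap. }
      rewrite zsum_swap. apply zsum_ext; intros t Ht16. rewrite zsum_swap.
      apply zsum_ext; intros t' Ht16'. unfold conv. rewrite <- zsum_mull.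
      apply zsum_ext; intros i Hi. now rewrite <- zsum_mull. }
    (* Summation over [tau] interpolates: the pairs with [t + t' + e = q] survive, times [D], which
       is the decomposition by carries of [conv_split]. *)
    transitivity (zsum 2 (fun e => zsum 16 (fun t => zsum 16 (fun t' => D * ind (t + t' + e =? q)%nat *
        conv N (fun u => X ((h * 16 + t) * N + u)%nat) (fun u => Y ((h * 16 + t') * N + u)%nat)
         (e * N + s)%nat)))).
    { apply zsum_ext; intros e He.
      rewrite (zsum_ext 31 _ (fun tau => zsum 16 (fun t => zsum 16 (fun t' =>
         itm q (tau * 2 + e) * evm tau (t + t') * 
        conv N (fun u => X ((h * 16 + t) * N + u)%nat) (fun u => Y ((h * 16 + t') * N + u)%nat)
         (e * N + s)%nat)))).
      2:{ intros tau Ht. rewrite <- zsum_mull. apply zsum_ext; intros. rewrite <- zsum_mull.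
          apply zsum_ext; intros. ring. }
      rewrite zsum_swap. apply zsum_ext; intros t Ht. rewrite zsum_swap.
      apply zsum_ext; intros t' Ht'. rewrite zsum_mulr. f_equal. apply itm_interp; lia. }
    rewrite zsum_swap. apply zsum_ext; intros t Ht. rewrite zsum_swap, <- zsum_mull.
    apply zsum_ext; intros t' Ht'. rewrite <- zsum_mull. apply zsum_ext; intros e He.
    rewrite <- Z.mul_assoc. f_equal. f_equal. apply conv_ext; intros; f_equal; ring.
Qed.

End Toom.

(** * Scaled Lagrange interpolation at the points 0, ..., 30 *)

Section Interpolation.
Open Scope Z_scope.

(* Coefficients, constant term first, of the product of [x - r] over [r] in [rs]. *)
Fixpoint root_poly (rs : list Z) : list Z :=
  match rs with
  | [] => [1]
  | r :: rs' =>
      let p := root_poly rs' in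
      map (fun c => fst c - r * snd c) (combine (0 :: p) (p ++ [0]))
  end.

Definition points : list Z := map Z.of_nat (seq 0 31).

(* Lagrange basis polynomials at the points 0, ..., 30, scaled by 30! to clear denominators. *)
Definition lagrange_table : list (list Z) :=
  map (fun r =>
    let others := filter (fun x => negb (x =? r)) points in
    let den := fold_right Z.mul 1 (map (fun x => r - x) others) in
    map (fun c => fold_right Z.mul 1 (tl points) / den * c) (root_poly others)) points.

Definition lagrange (k tau : nat) : Z := nth k (nth tau lagrange_table []) 0.

Definition toom_den : Z := fold_right Z.mul 1 (tl points).

(** The division in the table is exact: the denominator at the point [r] is, up to sign,
    [r! (30 - r)!], a divisor of [30!]. That the table is a scaled inverse of the Vandermonde matrix
    is then checked entry by entry. *)
Lemma lagrange_evm k s : (k < 31)%nat -> (s < 31)%nat ->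
  zsum 31 (fun tau => lagrange k tau * evm tau s) = if (s =? k)%nat then toom_den else 0.
Proof.
  assert (H : let T := lagrange_table in let E := map (fun tau => map (evm tau) (seq 0 31)) (seq 0 31) in
    forallb (fun k => forallb (fun s =>
    zsum 31 (fun tau => nth k (nth tau T []) 0 * nth s (nth tau E []) 0)
      =? if (s =? k)%nat then toom_den else 0)
    (seq 0 31)) (seq 0 31) = true) by (vm_compute; reflexivity).
  cbv zeta in H.
  intros Hk Hs. rewrite forallb_forall in H.
  specialize (H k ltac:(apply in_seq; lia)). rewrite forallb_forall in H.
  specialize (H s ltac:(apply in_seq; lia)). apply Z.eqb_eq in H. rewrite <- H.
  apply zsum_ext; intros tau Ht. unfold lagrange. f_equal.
  rewrite (nth_indep _ [] (map (evm 0) (seq 0 31))) by now rewrite length_map, length_seq.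
  rewrite (map_nth (fun tau => map (evm tau) (seq 0 31))).
  rewrite (nth_indep _ 0 (evm (nth tau (seq 0 31) 0%nat) 0%nat)) by now rewrite length_map, length_seq.
  rewrite (map_nth (evm _)), !seq_nth by auto. reflexivity.
Qed.

(** [30!] has 108 bits, so 27 is the least possible exponent; it enters the required word size. *)
Lemma toom_den_bounds : 0 < toom_den <= 16 ^ 27.
Proof. split; [|apply Z.leb_le]; vm_compute; reflexivity. Qed.

End Interpolation.

(** * Evaluation of expressions, exactly and modulo the word size *)

Section Eval.
Set Default Proof Using "All".
Variable W : nat.
Hypothesis HW : 100 < W.

Lemma ev_cst c s : c < W -> ev W (Cst c) s = c.
Proof. intros; now apply Nat.mod_small. Qed.

Lemma ev_var x s v : V s x = v -> ev W (Var x) s = v.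
Proof. auto. Qed.

Lemma ev_load e s a v : ev W e s = a -> M s a = v -> ev W (Mem e) s = v.
Proof. simpl; intros ->; auto. Qed.

Lemma ev_add a b s x y : ev W a s = x -> ev W b s = y -> x + y < W -> ev W (Bin Add a b) s = x + y.
Proof. intros <- <- H; now apply add_eq. Qed.

Lemma ev_mul a b s x y : ev W a s = x -> ev W b s = y -> x * y < W -> ev W (Bin Mul a b) s = x * y.
Proof. intros <- <- H; now apply mul_eq. Qed.

Lemma ev_sub a b s x y :
  ev W a s = x -> ev W b s = y -> y <= x /\ x < W -> ev W (Bin Sub a b) s = x - y.
Proof. intros <- <- H; apply sub_eq; lia. Qed.

Lemma ev_div a b s x y : ev W a s = x -> ev W b s = y -> x < W -> ev W (Bin Div a b) s = x / y.
Proof. intros <- <- H; apply div_eq; lia. Qed.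

Lemma ev_mod a b s x y : ev W a s = x -> ev W b s = y -> x < W -> ev W (Bin Mod a b) s = x mod y.
Proof. intros <- <- H; apply mod_eq; lia. Qed.

Lemma ev_lt_op a b s x y :
  ev W a s = x -> ev W b s = y -> ev W (Bin Lt a b) s = if x <? y then 1 else 0.
Proof. intros <- <-; apply lt_eq; lia. Qed.

Definition eqexp a b := Bin Lt (Bin Add (Bin Lt a b) (Bin Lt b a)) (Cst 1).

Lemma ev_eqexp a b s x y :
  ev W a s = x -> ev W b s = y -> ev W (eqexp a b) s = if x =? y then 1 else 0.
Proof.
  intros Ha Hb. unfold eqexp.
  rewrite (ev_lt_op _ _ s ((if x <? y then 1 else 0) + (if y <? x then 1 else 0)) 1).
  - destruct (Nat.ltb_spec x y), (Nat.ltb_spec y x), (Nat.eqb_spec x y); simpl; lia.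
  - apply ev_add; try (now apply ev_lt_op).
    destruct (x <? y), (y <? x); simpl; lia.
  - apply ev_cst; lia.
Qed.

Section ModW.
Open Scope Z_scope.

(** Some interpolation coefficients are negative, so the arrays represent integers only up to
    congruence. *)
Definition eqm (a b : Z) := a mod Z.of_nat W = b mod Z.of_nat W.

Lemma eqm_add a b a' b' : eqm a a' -> eqm b b' -> eqm (a + b) (a' + b').
Proof. unfold eqm; intros H1 H2. rewrite Zplus_mod, H1, H2, <- Zplus_mod; auto. Qed.

Lemma eqm_sub a b a' b' : eqm a a' -> eqm b b' -> eqm (a - b) (a' - b').
Proof. unfold eqm; intros H1 H2. rewrite Zminus_mod, H1, H2, <- Zminus_mod; auto. Qed.

Lemma eqm_mul a b a' b' : eqm a a' -> eqm b b' -> eqm (a * b) (a' * b').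
Proof. unfold eqm; intros H1 H2. rewrite Zmult_mod, H1, H2, <- Zmult_mod; auto. Qed.

Lemma eqm_trans a b c : eqm a b -> eqm b c -> eqm a c.
Proof. unfold eqm; congruence. Qed.

Lemma eqm_mod a : eqm (Z.of_nat (a mod W)) (Z.of_nat a).
Proof. unfold eqm. rewrite Nat2Z.inj_mod. apply Zmod_mod. Qed.

Lemma eqm_ev_add a b s x y : eqm (Z.of_nat (ev W a s)) x -> eqm (Z.of_nat (ev W b s)) y ->
  eqm (Z.of_nat (ev W (Bin Add a b) s)) (x + y).
Proof.
  intros H1 H2. simpl. eapply eqm_trans; [apply eqm_mod|].
  rewrite Nat2Z.inj_add. now apply eqm_add.
Qed.

Lemma eqm_ev_mul a b s x y : eqm (Z.of_nat (ev W a s)) x -> eqm (Z.of_nat (ev W b s)) y ->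
  eqm (Z.of_nat (ev W (Bin Mul a b) s)) (x * y).
Proof.
  intros H1 H2. simpl. eapply eqm_trans; [apply eqm_mod|].
  rewrite Nat2Z.inj_mul. now apply eqm_mul.
Qed.

Lemma eqm_ev_sub a b s x y : eqm (Z.of_nat (ev W a s)) x -> eqm (Z.of_nat (ev W b s)) y ->
  eqm (Z.of_nat (ev W (Bin Sub a b) s)) (x - y).
Proof.
  intros H1 H2. simpl. eapply eqm_trans; [apply eqm_mod|].
  assert (Hb : (ev W b s mod W < W)%nat) by (apply Nat.mod_upper_bound; lia).
  rewrite Nat2Z.inj_add, Nat2Z.inj_sub by lia.
  eapply eqm_trans with (Z.of_nat (ev W a s) - Z.of_nat (ev W b s mod W)).
  - unfold eqm. rewrite <- (Z_mod_plus_full (_ - _) 1). f_equal. ring.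
  - apply eqm_sub; auto. eapply eqm_trans; [apply eqm_mod|auto].
Qed.

(* Truncation to nat makes one of the two terms zero. *)
Definition zexp (z : Z) := Bin Sub (Cst (Z.to_nat z)) (Cst (Z.to_nat (- z))).

Lemma eqm_zexp z s : eqm (Z.of_nat (ev W (zexp z) s)) z.
Proof.
  replace z with (Z.of_nat (Z.to_nat z) - Z.of_nat (Z.to_nat (- z))) at 2 by lia.
  apply eqm_ev_sub; apply eqm_mod.
Qed.

Fixpoint linexp (C : nat) (g : nat -> Z) (x : nat -> expr) : expr :=
  match C with
  | O => Cst 0
  | S t => Bin Add (linexp t g x) (Bin Mul (zexp (g t)) (x t))
  end.

Lemma eqm_linexp C g x s f :
  (forall t, (t < C)%nat -> eqm (Z.of_nat (ev W (x t) s)) (f t)) ->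
  eqm (Z.of_nat (ev W (linexp C g x) s)) (zsum C (fun t => g t * f t)).
Proof.
  induction C; intros H; cbn [linexp zsum].
  - rewrite ev_cst by lia. reflexivity.
  - apply eqm_ev_add; auto. apply eqm_ev_mul; auto using eqm_zexp.
Qed.

(** A branch-free choice of a matrix row by a run-time index: all [R] rows are evaluated and masked.
    As the matrices have fixed size, this costs a constant factor. *)
Fixpoint selexp (R : nat) (qe : expr) (f : nat -> expr) : expr :=
  match R with
  | O => Cst 0
  | S q => Bin Add (selexp q qe f) (Bin Mul (eqexp qe (Cst q)) (f q))
  end.

Lemma eqm_selexp R qe f s q z : (R <= W)%nat -> ev W qe s = q -> (q < R)%nat ->
  eqm (Z.of_nat (ev W (f q) s)) z -> eqm (Z.of_nat (ev W (selexp R qe f) s)) z.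
Proof.
  intros HR Hq Hlt Hf.
  assert (G : forall R', (R' <= R)%nat -> eqm (Z.of_nat (ev W (selexp R' qe f) s))
                          (if (q <? R')%nat then z else 0)).
  { induction R'; intros HR'; cbn [selexp].
    - rewrite ev_cst by lia. reflexivity.
    - assert (E : ev W (eqexp qe (Cst R')) s = (if q =? R' then 1 else 0)%nat).
      { apply ev_eqexp; auto. apply ev_cst; lia. }
      (* A row that is not selected contributes its unspecified value times 0. *)
      replace (if (q <? S R')%nat then z else 0)
        with ((if (q <? R')%nat then z else 0) + (if (q =? R')%nat then 1 else 0) * (if (q =? R')%nat then z else Z.of_nat (ev W (f R') s))).
      + apply eqm_ev_add; [apply IHR'; lia|]. apply eqm_ev_mul.
        * rewrite E. destruct (q =? R')%nat; reflexivity.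
        * destruct (Nat.eqb_spec q R'); [now subst|reflexivity].
      + destruct (Nat.ltb_spec q R'), (Nat.ltb_spec q (S R')), (Nat.eqb_spec q R'); try lia. }
  specialize (G R (le_n _)). apply Nat.ltb_lt in Hlt. now rewrite Hlt in G.
Qed.

End ModW.
Unset Default Proof Using.
End Eval.

Ltac stsimp := cbn [V M setV setM]; unfold upd; cbn [Nat.eqb].

Ltac evt :=
  lazymatch goal with
  | |- ev _ (Cst _) _ = _ => apply ev_cst; [lia|lia]
  | |- ev _ (Var _) _ = _ => apply ev_var; [lia|]; stsimp; first [eassumption | reflexivity]
  | |- ev _ (Mem _) _ = _ => eapply ev_load; [lia|evt | stsimp; first [eassumption | reflexivity]]
  | |- ev _ (Bin Add _ _) _ = _ => eapply ev_add; [lia | evt | evt | try lia]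
  | |- ev _ (Bin Mul _ _) _ = _ => eapply ev_mul; [lia | evt | evt | try lia]
  | |- ev _ (Bin Sub _ _) _ = _ => eapply ev_sub; [lia | evt | evt | try lia]
  | |- ev _ (Bin Div _ _) _ = _ => eapply ev_div; [lia | evt | evt | try lia]
  | |- ev _ (Bin Mod _ _) _ = _ => eapply ev_mod; [lia | evt | evt | try lia]
  | |- ev _ (Bin Lt _ _) _ = _ => eapply ev_lt_op; [lia | evt | evt]
  | |- _ => try eassumption
  end.

(* Registers 0 to 9 hold n, m = n + 1, U, d, 16^d, 31^d, g, s, l and 2^l.  Memory region [k] is
   [k U, (k + 1) U): 0 holds input and output, 1 and 2 the sorted orders of A and B, 3 and 4 the
   tournament trees, 5 to 7 the convolution buffers. *)
Definition region k := Bin Mul (Cst k) (Var 2).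
Definition cell k e := Bin Add (region k) e.

(** * Toom-Cook on arrays in memory *)

Definition tab k e := For 28 (Var 27) (Sto (cell k (Var 28)) e).
(** An output entry depends on old entries spread over its block, so the new array is first built in
    the scratch region 7 and then copied back. *)
Definition transform k e := Seq (tab 7 e) (tab k (Mem (cell 7 (Var 28)))).

Definition axis_expr k R C (G : nat -> nat -> Z) :=
  let q := Bin Div (Var 28) (Var 24) in
  let b := Bin Add (Bin Mul (Bin Mul (Bin Div q (Cst R)) (Cst C)) (Var 24))
             (Bin Mod (Var 28) (Var 24)) in
  selexp R (Bin Mod q (Cst R))
    (fun r => linexp C (G r) (fun t => Mem (cell k (Bin Add b (Bin Mul (Cst t) (Var 24)))))).

(* Sealing keeps the kernel from unfolding these large expressions when it compares costs. *)
Definition seal (e : expr) : {e' | e' = e}.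
Proof. now exists e. Qed.

Definition axexp k R C G := proj1_sig (seal (axis_expr k R C G)).

Definition outside (U : nat) (ks : list nat) (a : nat) :=
  forall k, In k ks -> ~ (k * U <= a < k * U + U).
Definition same (U : nat) (ks : list nat) (s s' : st) :=
  forall a, outside U ks a -> M s' a = M s a.

Ltac out := let k := fresh in let H := fresh in
  intros k H; simpl in H;
  repeat (destruct H as [H|H]); try contradiction; subst k; lia.

Lemma same_refl U ks s : same U ks s s.
Proof. intros a _; auto. Qed.

Lemma same_trans U ks a b c : same U ks a b -> same U ks b c -> same U ks a c.
Proof. intros H1 H2 x Hx; rewrite H2, H1; auto. Qed.

Lemma same_incl U ks ks' a b : incl ks ks' -> same U ks a b -> same U ks' a b.
Proof. intros H1 H2 x Hx; apply H2. intros k Hk; apply Hx; auto. Qed.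

(** [31 ^ l * 16 ^ (d - l)] is the array length after [l] of [d] levels, so every intermediate array
    fits where the longest one does. *)
Lemma pow_mix l d : l <= d -> 31 ^ l * 16 ^ (d - l) <= 31 ^ d.
Proof.
  intros H. replace d with (l + (d - l)) at 2 by lia. rewrite Nat.pow_add_r.
  apply Nat.mul_le_mono_l, Nat.pow_le_mono_l; lia.
Qed.

Lemma pow_pos b l : 0 < b -> 0 < b ^ l.
Proof. intros; apply Nat.neq_0_lt_0, Nat.pow_nonzero; lia. Qed.

Section Transform.
Variables (W U : nat).
Hypothesis HW : 100 < W.
Hypothesis HU : 16 * U <= W.

Lemma ev_region k s : V s 2 = U -> k < 16 -> 0 < U -> ev W (region k) s = k * U.
Proof.
  intros H Hk HU0. unfold region. eapply ev_mul; [lia|apply ev_cst; lia|exact H|nia].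
Qed.

Lemma ev_cell k e s x : V s 2 = U -> k < 15 -> ev W e s = x -> x < U ->
  ev W (cell k e) s = k * U + x.
Proof.
  intros H Hk He Hx. unfold cell. apply ev_add; auto; [apply ev_region; auto; lia|nia].
Qed.

Lemma tab_ok k e s len (Q : nat -> nat -> Prop) :
  V s 2 = U -> V s 27 = len -> len <= U -> k < 15 ->
  (forall i s1, i < len -> V s1 28 = i -> (forall y, (y =? 28) = false -> V s1 y = V s y) ->
     (forall a, ~ (k * U <= a < k * U + i) -> M s1 a = M s a) -> wf W s1 -> Q i (ev W e s1)) ->
  ok W (tab k e) s (len * (ecost e + 20) + 4) (fun s' =>
    (forall i, i < len -> Q i (M s' (k * U + i))) /\
    (forall a, ~ (k * U <= a < k * U + len) -> M s' a = M s a)).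
Proof.
  intros HVU Hlen HlU Hk H.
  eapply ok_weaken; [lia| |shelve|intros s' _ _ Hq; exact Hq]. unfold tab.
  apply ok_for with (T := ecost e + 6) (I := fun j s1 =>
    (forall i, i < j -> Q i (M s1 (k * U + i))) /\
    (forall a, ~ (k * U <= a < k * U + j) -> M s1 a = M s a)).
  - lia.
  - split; [lia|auto].
  - cbn [ev]. rewrite Hlen. intros j s1 Hj [I1 I2] Hwf1 Hfr.
    apply ok_wf; intros Hwf2.
    set (s2 := setV s1 28 j) in *.
    assert (HU2 : V s2 2 = U).
    { unfold s2. stsimp. rewrite Hfr by reflexivity. auto. }
    assert (Ea : ev W (cell k (Var 28)) s2 = k * U + j).
    { apply ev_cell; [auto|lia|reflexivity|lia]. }
    eapply ok_weaken; [lia|apply ok_sto with (Q := fun s' =>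
      (forall i, i < S j -> Q i (M s' (k * U + i))) /\
      (forall a, ~ (k * U <= a < k * U + S j) -> M s' a = M s a))| cbn; lia | auto].
    rewrite Ea. unfold setM; cbn [M]. split.
    + intros i Hi. unfold upd. destruct (Nat.eqb_spec (k * U + i) (k * U + j)).
      * replace i with j by lia. apply H; auto.
        intros y Hy. unfold s2; cbn [V setV]. unfold upd; rewrite Hy. apply Hfr.
        cbn. now rewrite Hy.
      * apply I1; lia.
    + intros a Ha. rewrite upd_neq by lia. apply I2; lia.
  - cbn [ev]. rewrite Hlen. auto.
  Unshelve.
  cbn [ev ecost]. rewrite Hlen. nia.
Qed.

Lemma transform_ok k e s len (Q : nat -> nat -> Prop) :
  V s 2 = U -> V s 27 = len -> len <= U -> k < 7 ->
  (forall i s1, i < len -> V s1 28 = i -> (forall y, (y =? 28) = false -> V s1 y = V s y) ->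
     same U [7] s s1 -> wf W s1 -> Q i (ev W e s1)) ->
  ok W (transform k e) s (len * (ecost e + 60) + 20) (fun s' =>
    (forall i, i < len -> Q i (M s' (k * U + i))) /\ same U [k; 7] s s').
Proof.
  intros HVU Hlen HlU Hk H.
  eapply ok_weaken; [lia| |shelve|intros s' _ _ Hq; exact Hq]. unfold transform.
  apply ok_seq; [lia|].
  eapply ok_weaken; [lia|apply tab_ok with (Q := Q)|apply le_n|]; eauto; [lia| |].
  { intros i s1 Hi H28 Hfr HM Hwf. apply H; auto.
    intros a Ha. apply HM. specialize (Ha 7 (or_introl eq_refl)). lia. }
  intros s1 Hwf Hfr (Q1 & Q2).
  eapply ok_weaken; [lia|apply tab_ok with (len := len) (Q := fun i x => x = M s1 (7 * U + i))|apply le_n|].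
  - rewrite Hfr; auto.
  - rewrite Hfr; auto.
  - auto.
  - lia.
  - intros i s2 Hi H28 Hfr2 HM2 Hwf2. cbn [ev].
    change (M s2 (ev W (cell 7 (Var 28)) s2) = M s1 (7 * U + i)).
    rewrite (ev_cell 7 _ _ i); auto; try lia; [|rewrite Hfr2, Hfr; auto].
    apply HM2. nia.
  - intros s2 Hwf2 Hfr2 (R1 & R2). split.
    + intros i Hi. rewrite R1 by auto. auto.
    + intros a Ha. pose proof (Ha k (or_introl eq_refl)).
      pose proof (Ha 7 (or_intror (or_introl eq_refl))).
      rewrite R2, Q2 by lia. auto.
  Unshelve. cbn [ecost cell region]. lia.
Qed.

Definition arr (s : st) k len (f : nat -> Z) :=
  forall i, i < len -> eqm W (Z.of_nat (M s (k * U + i))) (f i).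

Lemma arr_same ks k s s' len f : same U ks s s' -> ~ In k ks -> len <= U -> 
  arr s k len f -> arr s' k len f.
Proof.
  intros H1 H2 H3 H4 i Hi. rewrite H1; auto. intros k' Hk' [H5 H6].
  destruct (Nat.lt_trichotomy k k') as [?|[->|?]]; auto; nia.
Qed.

Lemma axis_ok k R C G X s H N :
  V s 2 = U -> V s 24 = N -> 0 < N -> V s 27 = H * R * N -> H * R * N <= U -> H * C * N <= U ->
  0 < R <= 100 -> C <= 100 -> k < 7 ->
  arr s k (H * C * N) X ->
  ok W (transform k (axexp k R C G)) s (H * R * N * (ecost (axexp k R C G) + 60) + 20) (fun s' =>
    arr s' k (H * R * N) (axis N R C G X) /\ same U [k; 7] s s').
Proof.
  intros HVU HVN HN Hlen HR HC HR100 HC100 Hk HX.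
  apply transform_ok with (Q := fun i x => eqm W (Z.of_nat x) (axis N R C G X i)); auto.
  intros i s1 Hi H28 Hfr HM Hwf.
  assert (HVU1 : V s1 2 = U) by (rewrite Hfr; auto).
  assert (HVN1 : V s1 24 = N) by (rewrite Hfr; auto).
  assert (Hq : i / N < H * R) by (apply Nat.Div0.div_lt_upper_bound; lia).
  assert (Hh : i / N / R < H) by (apply Nat.Div0.div_lt_upper_bound; lia).
  assert (Hs : i mod N < N) by (apply Nat.mod_upper_bound; lia).
  assert (HiW : i < W) by lia.
  assert (HqW : i / N < W).
  { eapply Nat.le_lt_trans; [|apply HiW]. apply Nat.Div0.div_le_upper_bound; nia. }
  assert (Eq : ev W (Bin Div (Var 28) (Var 24)) s1 = i / N) by evt.
  assert (EqR : ev W (Bin Mod (Bin Div (Var 28) (Var 24)) (Cst R)) s1 = (i / N) mod R).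
  { eapply ev_mod; [lia|exact Eq|apply ev_cst; lia|auto]. }
  unfold axexp. rewrite (proj2_sig (seal _)). unfold axis_expr. eapply eqm_selexp; [lia|lia|exact EqR|apply Nat.mod_upper_bound; lia|].
  unfold axis. apply eqm_linexp; auto. intros t Ht.
  set (h := i / N / R) in *.
  assert (B1 : (h * C + t) * N + i mod N < H * C * N) by nia.
  assert (B2 : h * C <= h * C * N) by nia.
  assert (Eh : ev W (Bin Div (Bin Div (Var 28) (Var 24)) (Cst R)) s1 = h).
  { apply ev_div; [lia|exact Eq|apply ev_cst; lia|auto]. }
  assert (EhC : ev W (Bin Mul (Bin Div (Bin Div (Var 28) (Var 24)) (Cst R)) (Cst C)) s1 = h * C).
  { apply ev_mul; [lia|exact Eh|apply ev_cst; lia|nia]. }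
  cbn [ev]. change (ev W (cell k ?e) s1) with (ev W (cell k e) s1).
  match goal with |- eqm _ (Z.of_nat (M s1 ?x)) _ =>
    replace x with (k * U + ((h * C + t) * N + i mod N)) end.
  2:{ symmetry. apply ev_cell; auto; [lia| |lia].
      replace ((h * C + t) * N + i mod N) with (h * C * N + i mod N + t * N) by ring.
      assert (B3 : h * C * N + i mod N + t * N < U).
      { replace (h * C * N + i mod N + t * N) with ((h * C + t) * N + i mod N) by ring. lia. }
      apply ev_add; [lia|apply ev_add; [lia| | |lia]| |lia].
      - apply ev_mul; [lia|exact EhC|exact HVN1|lia].
      - apply ev_mod; [lia|exact H28|exact HVN1|auto].
      - apply ev_mul; [lia|apply ev_cst; lia|exact HVN1|lia]. }
  rewrite HM by (intros k' [<-|[]]; destruct (Nat.le_exists_sub k 6) as (z & -> & _); lia).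
  apply HX; auto.
Qed.

(** Register 24 holds the stride and 25 the number of blocks. Each is updated by one multiplication
    or division per level, since the language has no powers. *)
Definition forward k :=
  Seq (Asg 24 (Var 4)) (Seq (Asg 25 (Cst 1))
  (For 26 (Var 3)
    (Seq (Asg 24 (Bin Div (Var 24) (Cst 16)))
    (Seq (Asg 27 (Bin Mul (Bin Mul (Var 25) (Cst 31)) (Var 24)))
    (Seq (transform k (axexp k 31 16 evm))
         (Asg 25 (Bin Mul (Var 25) (Cst 31)))))))).

Definition inverse k F :=
  Seq (Asg 24 (Cst 1)) (Seq (Asg 25 (Var 5))
  (For 26 (Var 3)
    (Seq (Asg 25 (Bin Div (Var 25) (Cst 31)))
    (Seq (Asg 27 (Bin Mul (Bin Mul (Var 25) (Cst 32)) (Var 24)))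
    (Seq (transform k (axexp k 32 62 (itm F)))
         (Asg 24 (Bin Mul (Var 24) (Cst 16)))))))).

Lemma forward_ok k X s d :
  V s 2 = U -> V s 3 = d -> V s 4 = 16 ^ d -> 31 ^ d <= U -> k < 7 ->
  arr s k (16 ^ d) X ->
  ok W (forward k) s (d * (31 ^ d * (ecost (axexp k 31 16 evm) + 60) + 100) + 100) (fun s' =>
    arr s' k (31 ^ d) (fwds d X) /\ same U [k; 7] s s').
Proof.
  intros HVU HVd HV4 HdU Hk HX.
  set (K := ecost (axexp k 31 16 evm)).
  eapply ok_weaken; [lia| |shelve|intros s' _ _ Hq; exact Hq]. unfold forward.
  apply ok_seq_asg; [lia|]; intros Hwf.
  apply ok_seq_asg; [lia|]; intros Hwf1.
  set (s0 := setV (setV s 24 (ev W (Var 4) s)) 25 _).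
  assert (Hd0 : ev W (Var 3) s0 = d) by (unfold s0; cbn [ev]; now stsimp).
  (* [fwds] transforms its argument before recursing, so the invariant asks for a partly transformed
     array [f] from which the remaining [d - l] levels lead to [fwds d X]. The inverse direction has
     the closed form [invs F l X] instead. *)
  apply ok_for with (T := 31 ^ d * (K + 60) + 60) (I := fun l s1 =>
    V s1 25 = 31 ^ l /\ V s1 24 = 16 ^ (d - l) /\
    (exists f, fwds (d - l) f = fwds d X /\ arr s1 k (31 ^ l * 16 ^ (d - l)) f) /\
    same U [k; 7] s s1).
  - lia.
  - unfold s0; stsimp. split; [apply (ev_cst W HW 1); lia|]. split; [rewrite Nat.sub_0_r; auto|].
    split; [|now intros a _]. exists X. rewrite Nat.sub_0_r. split; auto.
    rewrite Nat.mul_1_l. exact HX.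
  - rewrite Hd0. intros l s1 Hl (I1 & I2 & (f & I3 & I4) & I5) Hwf2 Hfr.
    assert (HVU1 : V s1 2 = U) by (rewrite Hfr by reflexivity; exact HVU).
    pose proof (pow_mix l d ltac:(lia)) as B1.
    pose proof (pow_mix (S l) d ltac:(lia)) as B2.
    replace (d - l) with (S (d - S l)) in * by lia. remember (d - S l) as e.
    rewrite Nat.pow_succ_r' in *.
    pose proof (pow_pos 31 l ltac:(lia)). pose proof (pow_pos 16 e ltac:(lia)).
    eapply ok_weaken; [lia| |shelve|intros s' _ _ Hq; exact Hq].
    assert (Hdiv : 16 * 16 ^ e / 16 = 16 ^ e) by (rewrite Nat.mul_comm; apply Nat.div_mul; lia).
    apply ok_seq_asg; [lia|]; intros Hwf3. set (s2 := setV s1 26 l).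
    assert (E1 : ev W (Bin Div (Var 24) (Cst 16)) s2 = 16 ^ e).
    { rewrite <- Hdiv. unfold s2. evt. nia. }
    rewrite E1.
    apply ok_seq_asg; [lia|]; intros Hwf4.
    set (s3 := setV s2 24 _).
    assert (E2 : ev W (Bin Mul (Bin Mul (Var 25) (Cst 31)) (Var 24)) s3 = 31 ^ l * 31 * 16 ^ e).
    { unfold s3, s2. evt; nia. }
    rewrite E2.
    apply ok_seq; [lia|].
    set (s4 := setV s3 27 _).
    eapply ok_weaken; [lia|apply axis_ok with (H := 31 ^ l) (N := 16 ^ e) (X := f)|apply le_n|];
      auto; try lia; try nia.
    { intros i Hi. apply I4. nia. }
    intros s5 Hwf5 Hfr5 (A1 & A2).
    apply ok_asg.
    assert (E3 : ev W (Bin Mul (Var 25) (Cst 31)) s5 = 31 ^ l * 31).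
    { apply ev_mul; [lia| |apply ev_cst; lia|nia]. cbn [ev]. rewrite Hfr5 by reflexivity. exact I1. }
    rewrite E3. stsimp. split; [lia|]. split; [|split].
    + rewrite Hfr5 by reflexivity. unfold s4, s3; now stsimp.
    + exists (axis (16 ^ e) 31 16 evm f). rewrite fwds_S in I3. split; [exact I3|].
      intros i Hi. apply A1. lia.
    + eapply same_trans; [apply I5|exact A2].
  - rewrite Hd0. intros s1 (I1 & I2 & (f & I3 & I4) & I5) _ _.
    rewrite Nat.sub_diag in *. split; auto.
    cbn [fwds] in I3. rewrite <- I3. simpl in I4. rewrite Nat.mul_1_r in I4. auto.
  Unshelve.
  + cbn [ecost]. match goal with |- context [ev W (Var 3) ?x] => change (ev W (Var 3) x) with (V s 3) end. rewrite HVd. lia.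
  + cbn [ecost]. fold K. nia.
Qed.

Lemma inverse_ok k F X s d :
  V s 2 = U -> V s 3 = d -> V s 5 = 31 ^ d -> 2 * 31 ^ d <= U -> k < 7 ->
  arr s k (2 * 31 ^ d) X ->
  ok W (inverse k F) s (d * (2 * 31 ^ d * (ecost (axexp k 32 62 (itm F)) + 60) + 100) + 100) (fun s' =>
    arr s' k (2 * 16 ^ d) (invs F d X) /\ same U [k; 7] s s').
Proof.
  intros HVU HVd HV4 HdU Hk HX.
  set (K := ecost (axexp k 32 62 (itm F))).
  eapply ok_weaken; [lia| |shelve|intros s' _ _ Hq; exact Hq]. unfold inverse.
  apply ok_seq_asg; [lia|]; intros Hwf.
  apply ok_seq_asg; [lia|]; intros Hwf1.
  set (s0 := setV (setV s 24 _) 25 _).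
  assert (Hd0 : ev W (Var 3) s0 = d) by (unfold s0; cbn [ev]; now stsimp).
  apply ok_for with (T := 2 * 31 ^ d * (K + 60) + 60) (I := fun l s1 =>
    V s1 25 = 31 ^ (d - l) /\ V s1 24 = 16 ^ l /\
    arr s1 k (2 * (31 ^ (d - l) * 16 ^ l)) (invs F l X) /\
    same U [k; 7] s s1).
  - lia.
  - unfold s0; stsimp. rewrite Nat.sub_0_r. split; [exact HV4|]. split; [apply (ev_cst W HW 1); lia|].
    split; [|now intros a _]. cbn [invs]. simpl (16 ^ 0). rewrite Nat.mul_1_r. exact HX.
  - rewrite Hd0. intros l s1 Hl (I1 & I2 & I4 & I5) Hwf2 Hfr.
    assert (HVU1 : V s1 2 = U) by (rewrite Hfr by reflexivity; exact HVU).
    pose proof (pow_mix (d - l) d ltac:(lia)) as B1.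
    pose proof (pow_mix (d - S l) d ltac:(lia)) as B2.
    replace (d - (d - l)) with l in * by lia.
    replace (d - (d - S l)) with (S l) in * by lia.
    replace (d - l) with (S (d - S l)) in * by lia. remember (d - S l) as e.
    rewrite !Nat.pow_succ_r' in *.
    pose proof (pow_pos 16 l ltac:(lia)). pose proof (pow_pos 31 e ltac:(lia)).
    eapply ok_weaken; [lia| |shelve|intros s' _ _ Hq; exact Hq].
    assert (Hdiv : 31 * 31 ^ e / 31 = 31 ^ e) by (rewrite Nat.mul_comm; apply Nat.div_mul; lia).
    apply ok_seq_asg; [lia|]; intros Hwf3. set (s2 := setV s1 26 l).
    assert (E1 : ev W (Bin Div (Var 25) (Cst 31)) s2 = 31 ^ e).
    { rewrite <- Hdiv. unfold s2. evt. nia. }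
    rewrite E1.
    apply ok_seq_asg; [lia|]; intros Hwf4.
    set (s3 := setV s2 25 _).
    assert (E2 : ev W (Bin Mul (Bin Mul (Var 25) (Cst 32)) (Var 24)) s3 = 31 ^ e * 32 * 16 ^ l).
    { unfold s3, s2. evt; nia. }
    rewrite E2.
    apply ok_seq; [lia|].
    set (s4 := setV s3 27 _).
    eapply ok_weaken; [lia|apply axis_ok with (H := 31 ^ e) (N := 16 ^ l) (X := invs F l X)|apply le_n|];
      auto; try lia; try nia.
    { intros i Hi. apply I4. nia. }
    intros s5 Hwf5 Hfr5 (A1 & A2).
    apply ok_asg.
    assert (E3 : ev W (Bin Mul (Var 24) (Cst 16)) s5 = 16 ^ l * 16).
    { apply ev_mul; [lia| |apply ev_cst; lia|nia]. cbn [ev]. rewrite Hfr5 by reflexivity. exact I2. }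
    rewrite E3. stsimp. split; [|split; [lia|split]].
    + rewrite Hfr5 by reflexivity. unfold s4, s3; now stsimp.
    + rewrite invs_S. intros i Hi. apply A1. lia.
    + eapply same_trans; [apply I5|exact A2].
  - rewrite Hd0. intros s1 (I1 & I2 & I4 & I5) _ _.
    rewrite Nat.sub_diag in *. split; auto.
    simpl (31 ^ 0) in I4. rewrite Nat.mul_1_l in I4. auto.
  Unshelve.
  + cbn [ecost]. match goal with |- context [ev W (Var 3) ?x] => change (ev W (Var 3) x) with (V s 3) end. rewrite HVd. lia.
  + cbn [ecost]. fold K. nia.
Qed.

Definition spexp :=
  Bin Mul (Bin Lt (Bin Mod (Var 28) (Cst 2)) (Cst 1))
    (Bin Mul (Mem (cell 5 (Bin Div (Var 28) (Cst 2)))) (Mem (cell 6 (Bin Div (Var 28) (Cst 2))))).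

Definition convol F :=
  Seq (forward 5) (Seq (forward 6) (Seq (Asg 27 (Bin Mul (Cst 2) (Var 5)))
  (Seq (transform 5 spexp) (inverse 5 F)))).

(** A constant independent of [n], kept symbolic because the unrolled expressions are huge. *)
Definition convol_time F := ecost (axexp 5 31 16 evm) + ecost (axexp 6 31 16 evm) +
  2 * ecost (axexp 5 32 62 (itm F)) + 1000.

Lemma convol_ok F X Y s d :
  V s 2 = U -> V s 3 = d -> V s 4 = 16 ^ d -> V s 5 = 31 ^ d -> 2 * 31 ^ d <= U ->
  arr s 5 (16 ^ d) X -> arr s 6 (16 ^ d) Y ->
  ok W (convol F) s (convol_time F * ((d + 1) * 31 ^ d)) (fun s' =>
    arr s' 5 (2 * 16 ^ d) (invs F d (spread (fwds d X) (fwds d Y))) /\ same U [5; 6; 7] s s').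
Proof.
  intros HVU HVd HV4 HV5 HdU HX HY.
  pose proof (pow_pos 31 d ltac:(lia)) as H31.
  assert (H16 : 16 ^ d <= 31 ^ d) by (apply Nat.pow_le_mono_l; lia).
  eapply ok_weaken; [lia| |shelve|intros s' _ _ Hq; exact Hq]. unfold convol.
  apply ok_seq; [lia|].
  eapply ok_weaken; [lia|apply (forward_ok 5 X s d)|apply le_n|]; auto; try lia.
  intros s1 Hwf1 Hfr1 (A1 & A2). apply ok_seq; [lia|].
  eapply ok_weaken; [lia|apply (forward_ok 6 Y s1 d)|apply le_n|]; auto; try lia;
    try (rewrite Hfr1 by reflexivity; auto).
  { eapply arr_same; [exact A2| |lia|exact HY]. simpl; lia. }
  intros s2 Hwf2 Hfr2 (B1 & B2).
  assert (A1' : arr s2 5 (31 ^ d) (fwds d X)).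
  { eapply arr_same; [exact B2| |lia|exact A1]. simpl; lia. }
  assert (F2 : forall y, y < 20 -> V s2 y = V s y).
  { intros y Hy. rewrite Hfr2, Hfr1; auto; do 20 (destruct y; [reflexivity|]); lia. }
  apply ok_seq_asg; [lia|]; intros _.
  assert (E1 : ev W (Bin Mul (Cst 2) (Var 5)) s2 = 2 * 31 ^ d).
  { apply ev_mul; [lia|apply ev_cst; lia| |lia]. cbn [ev]. rewrite F2 by lia. auto. }
  rewrite E1. set (s3 := setV s2 27 _).
  apply ok_seq; [lia|].
  eapply ok_weaken; [lia|apply transform_ok with (len := 2 * 31 ^ d) (Q := fun i x =>
     eqm W (Z.of_nat x) (spread (fwds d X) (fwds d Y) i))|apply le_n|]; auto; try lia.
  { unfold s3; stsimp. rewrite F2 by lia; auto. }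
  { intros i s4 Hi H28 Hfr4 HM Hwf4.
    assert (HVU4 : V s4 2 = U).
    { rewrite Hfr4 by reflexivity. unfold s3; stsimp. rewrite F2 by lia; auto. }
    assert (Hi2 : i / 2 < 31 ^ d) by (apply Nat.Div0.div_lt_upper_bound; lia).
    assert (Ei : ev W (Bin Div (Var 28) (Cst 2)) s4 = i / 2) by evt.
    unfold spexp, spread. apply eqm_ev_mul; [lia| |apply eqm_ev_mul; [lia| |]].
    - match goal with |- eqm _ (Z.of_nat ?x) _ =>
        assert (Ex : x = if i mod 2 <? 1 then 1 else 0) by evt end.
      rewrite Ex. unfold ind. destruct (i mod 2 <? 1); reflexivity.
    - change (ev W (Mem ?e) s4) with (M s4 (ev W e s4)).
      rewrite (ev_cell 5 _ _ (i / 2)); auto; try lia.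
      rewrite HM by (intros k' [<-|[]]; lia). apply A1'; auto.
    - change (ev W (Mem ?e) s4) with (M s4 (ev W e s4)).
      rewrite (ev_cell 6 _ _ (i / 2)); auto; try lia.
      rewrite HM by (intros k' [<-|[]]; lia). apply B1; auto. }
  intros s4 Hwf4 Hfr4 (C1 & C2).
  assert (F4 : forall y, y < 20 -> V s4 y = V s y).
  { intros y Hy. rewrite Hfr4 by (do 20 (destruct y; [reflexivity|]); lia).
    unfold s3; cbn [V setV]. rewrite upd_neq by lia. auto. }
  eapply ok_weaken; [lia|apply (inverse_ok 5 F (spread (fwds d X) (fwds d Y)) s4 d)|apply le_n|];
    try (rewrite F4 by lia); auto; try lia.
  intros s5 Hwf5 Hfr5 (D1 & D2). split; auto.
  eapply same_trans; [eapply same_incl; [|exact A2]; intros ?; simpl; tauto|].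
  eapply same_trans; [eapply same_incl; [|exact B2]; intros ?; simpl; tauto|].
  eapply same_trans; [|eapply same_incl; [|exact D2]; intros ?; simpl; tauto].
  change (same U [5; 6; 7] s3 s4). eapply same_incl; [|exact C2]; intros ?; simpl; tauto.
  Unshelve.
  unfold convol_time. generalize (ecost (axexp 5 31 16 evm)), (ecost (axexp 6 31 16 evm)),
    (ecost (axexp 5 32 62 (itm F))). intros K1 K2 K3. cbn [ecost spexp cell region].
  set (e := 31 ^ d) in *. nia.
Qed.

End Transform.

(** * Sorting with a tournament tree *)

Section Tournament.
(* Tree nodes hold 0 (empty) or the successor of an index; [K] is the key of such an entry. *)
Variable K : nat -> nat.

(** The winner of a match: an empty slot loses to any entry, and ties go to the left child. [dom] is
    the matching preorder, with 0 as its worst element. *)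
Definition bet x y := if y =? 0 then x else if x =? 0 then y else if K y <? K x then y else x.
Definition dom x y := y = 0 \/ (x <> 0 /\ K x <= K y).

Lemma dom_refl x : dom x x.
Proof. unfold dom; lia. Qed.

Lemma dom_trans x y z : dom x y -> dom y z -> dom x z.
Proof. unfold dom; lia. Qed.

Lemma bet_dom x y : dom (bet x y) x /\ dom (bet x y) y.
Proof.
  unfold bet, dom. destruct (Nat.eqb_spec y 0), (Nat.eqb_spec x 0); try lia.
  destruct (Nat.ltb_spec (K y) (K x)); lia.
Qed.

Lemma bet_or x y : bet x y = x \/ bet x y = y.
Proof.
  unfold bet. destruct (y =? 0), (x =? 0), (K y <? K x); auto.
Qed.

Definition heap (Mt : nat) (t : nat -> nat) :=
  forall v, 1 <= v < Mt -> t v = bet (t (2 * v)) (t (2 * v + 1)).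

Lemma half_cases x : x = 2 * (x / 2) \/ x = 2 * (x / 2) + 1.
Proof.
  pose proof (Nat.div_mod x 2 ltac:(lia)). pose proof (Nat.mod_upper_bound x 2 ltac:(lia)). lia.
Qed.

(** [x / 2 ^ j = 1] says that the root is the [j]-th ancestor of [x]; each step upwards meets an
    entry at least as good. *)
Lemma root_dom Mt t : heap Mt t -> forall j x, x < 2 * Mt -> x / 2 ^ j = 1 -> dom (t 1) (t x).
Proof.
  intros Hh. induction j; intros x Hx H1.
  - rewrite Nat.pow_0_r, Nat.div_1_r in H1. subst; apply dom_refl.
  - rewrite Nat.pow_succ_r', <- Nat.Div0.div_div in H1.
    pose proof (half_cases x) as Hc.
    assert (Hp : 1 <= x / 2).
    { destruct (x / 2); [|lia]. rewrite Nat.Div0.div_0_l in H1. lia. }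
    apply dom_trans with (t (x / 2)).
    + apply IHj; auto; lia.
    + rewrite (Hh (x / 2)) by lia.
      destruct (bet_dom (t (2 * (x / 2))) (t (2 * (x / 2) + 1))) as [B1 B2].
      destruct Hc as [Hc|Hc]; rewrite Hc at 3; auto.
Qed.

(** Every match is won by one of its two players, so the root entry can be traced down to a leaf. *)
Lemma root_leaf l t : heap (2 ^ l) t -> exists i, i < 2 ^ l /\ t 1 = t (2 ^ l + i).
Proof.
  intros Hh.
  assert (G : forall j, j <= l -> exists v, 2 ^ j <= v < 2 * 2 ^ j /\ t v = t 1).
  { induction j; intros Hj.
    - exists 1; simpl; split; auto.
    - destruct IHj as (v & Hv & E); [lia|].
      assert (Hl : 2 ^ S j <= 2 ^ l) by (apply Nat.pow_le_mono_r; lia).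
      rewrite Nat.pow_succ_r' in *. pose proof (pow_pos 2 j ltac:(lia)).
      rewrite (Hh v) in E by lia.
      destruct (bet_or (t (2 * v)) (t (2 * v + 1))) as [B|B]; rewrite B in E.
      + exists (2 * v); split; [lia|auto].
      + exists (2 * v + 1); split; [lia|auto]. }
  destruct (G l (le_n _)) as (v & Hv & E). exists (v - 2 ^ l). split; [lia|].
  now replace (2 ^ l + (v - 2 ^ l)) with v by lia.
Qed.

End Tournament.

Definition better off :=
  let key x := Mem (Bin Add off (Var x)) in
  If (Var 21) (If (Var 20)
    (If (Bin Lt (key 21) (key 20)) (Asg 22 (Var 21)) (Asg 22 (Var 20)))
    (Asg 22 (Var 21))) (Asg 22 (Var 20)).

(** Only the [l] matches on the path from the changed leaf to the root are replayed. *)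
Definition set_leaf kT off :=
  Seq (Sto (cell kT (Var 18)) (Var 23))
  (For 19 (Var 8)
    (Seq (Asg 18 (Bin Div (Var 18) (Cst 2)))
    (Seq (Asg 20 (Mem (cell kT (Bin Mul (Cst 2) (Var 18)))))
    (Seq (Asg 21 (Mem (cell kT (Bin Add (Bin Mul (Cst 2) (Var 18)) (Cst 1)))))
    (Seq (better off)
         (Sto (cell kT (Var 18)) (Var 22))))))).

(** The tree region is initially 0, which is the empty tree. Storing [i + 1] serves twice: 0 can
    mean empty, and with [A[i]] at address [i + 1] and [B[j]] at [n + 1 + (j + 1)], an entry plus a
    fixed offset is the address of its key. *)
Definition tsort kT kP off :=
  Seq (For 16 (Var 1)
    (Seq (Asg 18 (Bin Add (Var 9) (Var 16)))
    (Seq (Asg 23 (Bin Add (Var 16) (Cst 1)))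
         (set_leaf kT off))))
  (For 16 (Var 1)
    (Seq (Asg 17 (Mem (cell kT (Cst 1))))
    (Seq (Sto (cell kP (Var 16)) (Bin Sub (Var 17) (Cst 1)))
    (Seq (Asg 18 (Bin Sub (Bin Add (Var 9) (Var 17)) (Cst 1)))
    (Seq (Asg 23 (Cst 0))
         (set_leaf kT off)))))).

Section Sort.
Variables (W U m l kT kP o : nat) (off : expr) (K : nat -> nat).
Hypothesis HW : 100 < W.
Hypothesis HU : 16 * U <= W.
Hypothesis HkT : 1 <= kT < 15.
Hypothesis Ho : o + m < U.
Hypothesis HmU : m < U.
Hypothesis HlU : 2 * 2 ^ l <= U.
Hypothesis Hoff : forall s, V s 1 = m -> ev W off s = o.

Let tr (s : st) (v : nat) := M s (kT * U + v).

Definition tree_ok (s : st) :=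
  heap K (2 ^ l) (tr s) /\ (forall v, 1 <= v < 2 * 2 ^ l -> tr s v <= m) /\
  (forall y, 1 <= y <= m -> M s (o + y) = K y).

Lemma better_ok s x y :
  V s 1 = m -> V s 20 = x -> V s 21 = y -> x <= m -> y <= m ->
  (forall y, 1 <= y <= m -> M s (o + y) = K y) ->
  ok W (better off) s (2 * ecost off + 40) (fun s' => V s' 22 = bet K x y /\ M s' = M s).
Proof.
  intros Hm Hx Hy Hxm Hym HK.
  assert (Key : forall v z, V s v = z -> 1 <= z <= m -> ev W (Mem (Bin Add off (Var v))) s = K z).
  { intros v z Hv Hz. eapply ev_load; [lia| |apply HK; exact Hz].
    apply ev_add; [lia|apply Hoff; auto|exact Hv|lia]. }
  eapply ok_weaken; [lia| |shelve|intros s' _ _ Hq; exact Hq]. unfold better.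
  apply ok_if; [lia| |]; cbn [ev]; rewrite Hy; intros Hy0.
  - apply ok_if; [lia| |]; cbn [ev]; rewrite Hx; intros Hx0.
    + assert (E := ev_lt_op W HW _ _ s _ _ (Key 21 y Hy ltac:(lia)) (Key 20 x Hx ltac:(lia))).
      apply ok_if; [lia| |]; rewrite E; intros H; apply ok_asg; stsimp; cbn [ev];
        (split; [|reflexivity]); unfold bet;
        destruct (Nat.eqb_spec y 0), (Nat.eqb_spec x 0); try lia;
        destruct (K y <? K x); lia.
    + apply ok_asg; stsimp; cbn [ev]. split; [|reflexivity]. unfold bet.
      destruct (Nat.eqb_spec y 0), (Nat.eqb_spec x 0); lia.
  - apply ok_asg; stsimp; cbn [ev]. split; [|reflexivity]. unfold bet.
    destruct (Nat.eqb_spec y 0); lia.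
  Unshelve. cbn [ecost]. lia.
Qed.

Lemma set_leaf_ok s x v :
  V s 1 = m -> V s 2 = U -> V s 8 = l -> V s 18 = x -> V s 23 = v ->
  2 ^ l <= x < 2 * 2 ^ l -> v <= m -> tree_ok s ->
  ok W (set_leaf kT off) s (l * (2 * ecost off + 120) + 30) (fun s' =>
    tree_ok s' /\ same U [kT] s s' /\
    (forall y, 2 ^ l <= y < 2 * 2 ^ l -> tr s' y = if y =? x then v else tr s y)).
Proof.
  intros Hm HVU Hl Hx Hv Hxr Hvm (T1 & T2 & T3).
  eapply ok_weaken; [lia| |shelve|intros s' _ _ Hq; exact Hq]. unfold set_leaf.
  apply ok_seq; [lia|]. apply ok_sto.
  assert (Ea : ev W (cell kT (Var 18)) s = kT * U + x) by (apply ev_cell; auto; lia).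
  rewrite Ea. change (ev W (Var 23) s) with (V s 23). rewrite Hv.
  set (s0 := setM s (kT * U + x) v).
  assert (kTU : U <= kT * U) by nia.
  (* [p] is the node reached so far. Every inner node satisfies the heap equation except possibly
     the proper ancestors of [p]; at the root there are none left. *)
  apply ok_for with (T := 2 * ecost off + 110) (I := fun j s1 =>
    exists p, V s1 18 = p /\ 2 ^ (l - j) <= p < 2 * 2 ^ (l - j) /\
    (forall v, 1 <= v < 2 ^ l -> tr s1 v = bet K (tr s1 (2 * v)) (tr s1 (2 * v + 1)) \/
        exists e, 1 <= e /\ v = p / 2 ^ e) /\
    (forall v, 1 <= v < 2 * 2 ^ l -> tr s1 v <= m) /\
    same U [kT] s s1 /\
    (forall y, 2 ^ l <= y < 2 * 2 ^ l -> tr s1 y = if y =? x then v else tr s y)).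
  - lia.
  - exists x. rewrite Nat.sub_0_r. split; [exact Hx|]. split; [exact Hxr|].
    unfold tr, s0; cbn [M setM]. unfold upd. split; [|split; [|split]].
    + intros u Hu. pose proof (T1 u Hu) as HT. unfold tr in HT.
      destruct (Nat.eqb_spec (kT * U + u) (kT * U + x)); [lia|].
      destruct (Nat.eqb_spec (kT * U + 2 * u) (kT * U + x)).
      { right. exists 1; split; auto. simpl (2 ^ 1). replace x with (2 * u) by lia.
        rewrite Nat.mul_comm, Nat.div_mul; lia. }
      destruct (Nat.eqb_spec (kT * U + (2 * u + 1)) (kT * U + x)).
      { right. exists 1; split; auto. simpl (2 ^ 1). apply Nat.div_unique with 1; lia. }
      left; auto.
    + intros u Hu. destruct (_ =? _); auto. apply T2; auto.
    + intros a Ha. specialize (Ha kT (or_introl eq_refl)).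
      cbn [M setM]. apply upd_neq. lia.
    + intros y Hy.
      destruct (Nat.eqb_spec (kT * U + y) (kT * U + x)), (Nat.eqb_spec y x); auto; lia.
  - change (ev W (Var 8) s0) with (V s 8). rewrite Hl.
    intros j s1 Hj (p & I1 & I2 & I3 & I4 & I5 & I6) Hwf1 Hfr.
    assert (HVU1 : V s1 2 = U) by (rewrite Hfr by reflexivity; exact HVU).
    assert (Hm1 : V s1 1 = m) by (rewrite Hfr by reflexivity; exact Hm).
    assert (Hlj : 2 ^ (l - j) <= 2 ^ l) by (apply Nat.pow_le_mono_r; lia).
    replace (l - j) with (S (l - S j)) in * by lia. remember (l - S j) as q.
    rewrite Nat.pow_succ_r' in *. pose proof (pow_pos 2 q ltac:(lia)) as Hq.
    pose proof (half_cases p) as Hp2. remember (p / 2) as p' eqn:Ep'.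
    assert (Hp' : 2 ^ q <= p' < 2 * 2 ^ q) by lia.
    eapply ok_weaken; [lia| |shelve|intros s' _ _ Hq'; exact Hq'].
    apply ok_seq_asg; [lia|]; intros _.
    set (s2 := setV s1 19 j).
    assert (E1 : ev W (Bin Div (Var 18) (Cst 2)) s2 = p').
    { rewrite Ep'. apply ev_div; [lia|exact I1|apply ev_cst; lia|lia]. }
    rewrite E1. set (s3 := setV s2 18 p').
    apply ok_seq_asg; [lia|]; intros _.
    assert (E2 : ev W (Mem (cell kT (Bin Mul (Cst 2) (Var 18)))) s3 = tr s1 (2 * p')).
    { eapply ev_load; [lia| |reflexivity].
      apply ev_cell; [auto|lia|exact HVU1|lia| |lia].
      apply ev_mul; [lia|apply ev_cst; lia|reflexivity|lia]. }
    rewrite E2. set (s4 := setV s3 20 _).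
    apply ok_seq_asg; [lia|]; intros _.
    assert (E3 : ev W (Mem (cell kT (Bin Add (Bin Mul (Cst 2) (Var 18)) (Cst 1)))) s4 = tr s1 (2 * p' + 1)).
    { eapply ev_load; [lia| |reflexivity].
      apply ev_cell; [auto|lia|exact HVU1|lia| |lia].
      apply ev_add; [lia| |apply ev_cst; lia|lia].
      apply ev_mul; [lia|apply ev_cst; lia|reflexivity|lia]. }
    rewrite E3. set (s5 := setV s4 21 _).
    apply ok_seq; [lia|].
    eapply ok_weaken; [lia|apply (better_ok s5 (tr s1 (2 * p')) (tr s1 (2 * p' + 1)))|apply le_n|];
      try reflexivity; auto.
    { apply I4; lia. }
    { apply I4; lia. }
    { intros y Hy. change (M s5) with (M s1). rewrite I5; auto.
      intros k [Hk|[]]; subst k; lia. }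
    intros s6 Hwf6 Hfr6 (B1 & B2). apply ok_sto.
    assert (V18 : V s6 18 = p') by (rewrite Hfr6 by reflexivity; reflexivity).
    assert (Ea6 : ev W (cell kT (Var 18)) s6 = kT * U + p').
    { apply ev_cell; auto; try lia. rewrite Hfr6 by reflexivity. exact HVU1. }
    rewrite Ea6. change (ev W (Var 22) s6) with (V s6 22). rewrite B1.
    change (M s5) with (M s1) in B2.
    exists p'. split; [exact V18|]. split; [lia|].
    unfold tr; cbn [M setM]; rewrite B2; fold (tr s1).
    assert (Ht : forall u, upd (M s1) (kT * U + p') (bet K (tr s1 (2 * p')) (tr s1 (2 * p' + 1))) (kT * U + u)
               = if u =? p' then bet K (tr s1 (2 * p')) (tr s1 (2 * p' + 1)) else tr s1 u).
    { intros u. unfold upd.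
      destruct (Nat.eqb_spec (kT * U + u) (kT * U + p')), (Nat.eqb_spec u p'); auto; lia. }
    split; [|split; [|split]].
    + intros u Hu. rewrite !Ht.
      destruct (Nat.eqb_spec u p').
      { left. subst u. destruct (Nat.eqb_spec (2 * p') p'), (Nat.eqb_spec (2 * p' + 1) p'); auto; lia. }
      destruct (Nat.eqb_spec (2 * u) p').
      { right. exists 1; split; auto. simpl (2 ^ 1). apply Nat.div_unique with 0; lia. }
      destruct (Nat.eqb_spec (2 * u + 1) p').
      { right. exists 1; split; auto. simpl (2 ^ 1). apply Nat.div_unique with 1; lia. }
      destruct (I3 u Hu) as [I3'|(e & He & Hue)]; [left; auto|right].
      destruct e as [|[|e]]; [lia|exfalso; simpl (2 ^ 1) in Hue; lia|].
      exists (S e); split; [lia|]. rewrite Hue, (Nat.pow_succ_r' 2 (S e)), <- Nat.Div0.div_div, <- Ep'. auto.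
    + intros u Hu. rewrite Ht. destruct (Nat.eqb_spec u p'); auto.
      destruct (bet_or K (tr s1 (2 * p')) (tr s1 (2 * p' + 1))) as [->| ->]; apply I4; lia.
    + eapply same_trans; [exact I5|]. intros a Ha. specialize (Ha kT (or_introl eq_refl)).
      cbn [M setM]. rewrite B2. apply upd_neq. lia.
    + intros y Hy. rewrite Ht. destruct (Nat.eqb_spec y p'); [lia|]. apply I6; auto.
  - change (ev W (Var 8) s0) with (V s 8). rewrite Hl.
    intros s1 (p & I1 & I2 & I3 & I4 & I5 & I6) _ _.
    rewrite Nat.sub_diag in I2. simpl (2 ^ 0) in I2. assert (Hp1 : p = 1) by lia. rewrite Hp1 in I3.
    split; [|split; auto]. split; [|split; auto].
    + intros u Hu. destruct (I3 u Hu) as [|(e & He & Hue)]; auto.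
      assert (2 ^ 1 <= 2 ^ e) by (apply Nat.pow_le_mono_r; lia).
      rewrite Nat.div_small in Hue; simpl in *; lia.
    + intros y Hy. rewrite I5; auto. intros k [Hk|[]]; subst k; lia.
  Unshelve.
  all: cbn [ecost cell region]; try lia.
  change (ev W (Var 8) _) with (V s 8). rewrite Hl. lia.
Qed.

Definition sorted_perm (K : nat -> nat) (m : nat) (sg : nat -> nat) :=
  (forall r, r < m -> sg r < m) /\
  (forall i, i < m -> exists r, r < m /\ sg r = i) /\
  (forall r r', r <= r' -> r' < m -> K (sg r + 1) <= K (sg r' + 1)).

Lemma sort_ok s :
  V s 1 = m -> V s 2 = U -> V s 8 = l -> V s 9 = 2 ^ l -> m <= 2 ^ l -> kP < 15 -> kP <> kT -> 1 <= kP ->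
  (forall v, v < 2 * 2 ^ l -> tr s v = 0) -> (forall y, 1 <= y <= m -> M s (o + y) = K y) ->
  ok W (tsort kT kP off) s ((ecost off + 1) * (1000 * (m * (l + 1)) + 100)) (fun s' =>
    sorted_perm K m (fun r => M s' (kP * U + r)) /\ same U [kT; kP] s s').
Proof.
  intros Hm HVU Hl HMt HmM HkP HkPT HkP1 HT HK.
  assert (HmW : m < W) by lia.
  eapply ok_weaken; [lia| |shelve|intros s' _ _ Hq; exact Hq]. unfold tsort.
  apply ok_seq; [lia|].
  assert (kTU : U <= kT * U) by nia.
  assert (kPU : U <= kP * U) by nia.
  assert (T0 : tree_ok s).
  { split; [|split; [|exact HK]].
    - intros v Hv. rewrite !HT by lia. reflexivity.
    - intros v Hv. rewrite HT by lia. lia. }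
  apply ok_for_n with (n := m) (T := l * (2 * ecost off + 120) + 40) (I := fun j s1 =>
    tree_ok s1 /\ same U [kT] s s1 /\
    forall i, i < 2 ^ l -> tr s1 (2 ^ l + i) = if i <? j then i + 1 else 0).
  - lia.
  - exact Hm.
  - split; auto. split; [apply same_refl|]. intros i Hi. simpl. apply HT; lia.
  - intros j s1 Hj (I1 & I2 & I3) Hwf1 Hfr.
    eapply ok_weaken; [lia| |shelve|intros s' _ _ Hq; exact Hq].
    apply ok_seq_asg; [lia|]; intros _. set (s2 := setV s1 16 j).
    assert (E1 : ev W (Bin Add (Var 9) (Var 16)) s2 = 2 ^ l + j).
    { apply ev_add; [lia| |reflexivity|lia]. unfold s2. cbn [ev]. stsimp.
      rewrite Hfr by reflexivity. exact HMt. }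
    rewrite E1. set (s3 := setV s2 18 _).
    apply ok_seq_asg; [lia|]; intros _.
    assert (E2 : ev W (Bin Add (Var 16) (Cst 1)) s3 = j + 1).
    { apply ev_add; [lia|reflexivity|apply ev_cst; lia|lia]. }
    rewrite E2. set (s4 := setV s3 23 _).
    eapply ok_weaken; [lia|apply (set_leaf_ok s4 (2 ^ l + j) (j + 1))|apply le_n|];
      try (unfold s4, s3, s2; stsimp; rewrite Hfr by reflexivity; assumption);
      try reflexivity; try lia; auto.
    intros s5 Hwf5 Hfr5 (B1 & B2 & B3). split; auto.
    split; [eapply same_trans; [exact I2|exact B2]|].
    intros i Hi. rewrite B3 by lia. change (tr s4 (2 ^ l + i)) with (tr s1 (2 ^ l + i)).
    rewrite I3 by auto.
    destruct (Nat.eqb_spec (2 ^ l + i) (2 ^ l + j)), (Nat.ltb_spec i j), (Nat.ltb_spec i (S j)); lia.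
  - intros s1 (I1 & I2 & I3) Hwf1 Hfr1.
    assert (F1 : forall y, y < 16 -> V s1 y = V s y).
    { intros y Hy. apply Hfr1. do 16 (destruct y; [reflexivity|]); lia. }
    (* [fin] lists the indices extracted so far, in order, and [rest] those still in the tree. No
       key in [fin] exceeds one in [rest], so appending the root keeps [fin] sorted. *)
    apply ok_for_n with (n := m) (T := l * (2 * ecost off + 120) + 80) (I := fun j s2 =>
      tree_ok s2 /\ same U [kT; kP] s s2 /\
      exists fin rest, length fin = j /\ Permutation (fin ++ rest) (seq 0 m) /\
       (forall r, r < j -> M s2 (kP * U + r) = nth r fin 0) /\
       (forall i, i < 2 ^ l -> (In i rest -> tr s2 (2 ^ l + i) = i + 1) /\
                             (~ In i rest -> tr s2 (2 ^ l + i) = 0)) /\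
       (forall r r', r <= r' -> r' < j -> K (nth r fin 0 + 1) <= K (nth r' fin 0 + 1)) /\
       (forall x y, In x fin -> In y rest -> K (x + 1) <= K (y + 1))).
    + lia.
    + cbn [ev]. rewrite F1 by lia. exact Hm.
    + split; auto. split; [eapply same_incl; [|exact I2]; intros ?; simpl; tauto|].
      exists [], (seq 0 m). split; auto. split; [apply Permutation_refl|].
      split; [lia|]. split; [|split; [lia|intros ? ? []]].
      intros i Hi. rewrite I3 by auto. rewrite in_seq.
      destruct (Nat.ltb_spec i m); split; intros; lia.
    + intros j s2 Hj (J1 & J2 & fin & rest & L1 & L2 & L3 & L4 & L5 & L6) Hwf2 Hfr2.
      assert (F2 : forall y, y < 16 -> V s2 y = V s y).
      { intros y Hy. rewrite Hfr2, F1; auto. do 16 (destruct y; [reflexivity|]); lia. }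
      destruct J1 as (J1 & Jb & JK).
      assert (ND : NoDup (fin ++ rest)).
      { eapply Permutation_NoDup; [apply Permutation_sym; exact L2|apply seq_NoDup]. }
      assert (Hrm : forall i, In i rest -> i < m).
      { intros i Hi. assert (In i (seq 0 m)) as Hin.
        { eapply Permutation_in; [exact L2|]. apply in_or_app; auto. }
        apply in_seq in Hin; lia. }
      assert (Hdom : forall i, In i rest -> dom K (tr s2 1) (i + 1)).
      { intros i Hi. pose proof (Hrm i Hi).
        destruct (L4 i ltac:(lia)) as [L4a _]. rewrite <- (L4a Hi).
        apply (root_dom K (2 ^ l) (tr s2) J1 l); [lia|].
        symmetry; apply Nat.div_unique with i; lia. }
      (* As [j < m], some index is left; it makes the root nonempty, and the leaf holding the root
         entry must then belong to [rest]. *)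
      assert (Hroot : exists i, In i rest /\ tr s2 1 = i + 1).
      { destruct rest as [|y rest'].
        - apply Permutation_length in L2. rewrite length_app, length_seq in L2. simpl in L2. lia.
        - destruct (Hdom y (or_introl eq_refl)) as [?|[Hnz _]]; [lia|].
          destruct (root_leaf K l (tr s2) J1) as (i & Hi & E). destruct (L4 i Hi) as [La Lb].
          exists i. destruct (in_dec Nat.eq_dec i (y :: rest')) as [Hin|Hin].
          + split; auto. rewrite E; auto.
          + rewrite Lb in E by auto. contradiction. }
      destruct Hroot as (i & Hi & Ei). pose proof (Hrm i Hi) as Him.
      eapply ok_weaken; [lia| |shelve|intros s' _ _ Hq; exact Hq].
      apply ok_seq_asg; [lia|]; intros _. set (s3 := setV s2 16 j).
      assert (E1 : ev W (Mem (cell kT (Cst 1))) s3 = i + 1).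
      { eapply ev_load; [lia| |exact Ei].
        apply ev_cell; [auto|lia| |lia|apply ev_cst; lia|lia].
        unfold s3; stsimp. rewrite F2 by lia; exact HVU. }
      rewrite E1. set (s4 := setV s3 17 _).
      apply ok_seq; [lia|]. apply ok_sto.
      assert (E2 : ev W (cell kP (Var 16)) s4 = kP * U + j).
      { apply ev_cell; [auto|lia| |lia|reflexivity|lia].
        unfold s4, s3; stsimp. rewrite F2 by lia; exact HVU. }
      assert (E3 : ev W (Bin Sub (Var 17) (Cst 1)) s4 = i).
      { transitivity (i + 1 - 1); [|lia].
        apply ev_sub; [lia|reflexivity|apply ev_cst; lia|lia]. }
      rewrite E2, E3. set (s5 := setM s4 _ _).
      apply ok_seq_asg; [lia|]; intros _.
      assert (E4 : ev W (Bin Sub (Bin Add (Var 9) (Var 17)) (Cst 1)) s5 = 2 ^ l + i).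
      { replace (2 ^ l + i) with (2 ^ l + (i + 1) - 1) by lia.
        apply ev_sub; [lia| |apply ev_cst; lia|lia].
        apply ev_add; [lia| |reflexivity|lia].
        unfold s5, s4, s3; cbn [ev]; stsimp. rewrite F2 by lia; exact HMt. }
      rewrite E4. set (s6 := setV s5 18 _).
      apply ok_seq_asg; [lia|]; intros _.
      replace (ev W (Cst 0) s6) with 0 by (symmetry; apply ev_cst; lia).
      set (s7 := setV s6 23 0).
      assert (Htr : forall v, v < U -> tr s7 v = tr s2 v).
      { intros v Hv. unfold tr, s7, s6, s5. cbn [M setM setV]. apply upd_neq.
        destruct (Nat.lt_trichotomy kT kP) as [?|[?|?]]; nia. }
      eapply ok_weaken; [lia|apply (set_leaf_ok s7 (2 ^ l + i) 0)|apply le_n|];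
        try (unfold s7, s6, s5, s4, s3; stsimp; rewrite F2 by lia; assumption);
        try reflexivity; try lia.
      { split; [|split].
        - intros v Hv. rewrite !Htr by lia. apply J1; auto.
        - intros v Hv. rewrite Htr by lia. apply Jb; auto.
        - intros y Hy. unfold s7, s6, s5; cbn [M setM setV]. rewrite upd_neq by lia. apply JK; auto. }
      intros s8 Hwf8 Hfr8 (B1 & B2 & B3). split; auto.
      assert (HkPs8 : forall r, r < U -> M s8 (kP * U + r) = if r =? j then i else M s2 (kP * U + r)).
      { intros r Hr. rewrite B2.
        - unfold s7, s6, s5; cbn [M setM setV]. unfold upd.
          destruct (Nat.eqb_spec (kP * U + r) (kP * U + j)), (Nat.eqb_spec r j); auto; lia.
        - intros k [<-|[]]. destruct (Nat.lt_trichotomy kT kP) as [?|[?|?]]; nia. }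
      split.
      { eapply same_trans; [exact J2|]. intros a Ha.
        rewrite B2 by (intros k [<-|[]]; apply Ha; simpl; auto).
        specialize (Ha kP (or_intror (or_introl eq_refl))).
        unfold s7, s6, s5; cbn [M setM setV]. apply upd_neq. lia. }
      destruct (in_split i rest Hi) as (l1 & l2 & Er).
      assert (Hni : ~ In i ((fin ++ l1) ++ l2)).
      { apply NoDup_remove_2. rewrite <- app_assoc, <- Er. exact ND. }
      rewrite !in_app_iff in Hni.
      assert (Hjl : forall r, r < j -> nth r (fin ++ [i]) 0 = nth r fin 0).
      { intros r Hr. apply app_nth1. lia. }
      assert (Hjj : nth j (fin ++ [i]) 0 = i).
      { rewrite app_nth2 by lia. now rewrite L1, Nat.sub_diag. }
      assert (Hir : forall y, In y rest -> K (i + 1) <= K (y + 1)).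
      { intros y Hy. destruct (Hdom y Hy) as [?|[_ Hle]]; [lia|]. now rewrite Ei in Hle. }
      exists (fin ++ [i]), (l1 ++ l2). rewrite length_app, L1. split; [simpl; lia|].
      split; [|split; [|split; [|split]]].
      * rewrite <- app_assoc. eapply Permutation_trans; [|exact L2].
        apply Permutation_app_head. rewrite Er. apply (Permutation_middle l1 l2 i).
      * intros r Hr. rewrite HkPs8 by lia. destruct (Nat.eqb_spec r j).
        { subst r. now rewrite Hjj. }
        rewrite Hjl by lia. apply L3. lia.
      * intros i' Hi'. rewrite B3, Htr by lia. destruct (L4 i' Hi') as [La Lb].
        rewrite Er in La, Lb. rewrite in_app_iff in *. cbn [In] in La, Lb.
        destruct (Nat.eqb_spec (2 ^ l + i') (2 ^ l + i)).
        { assert (i' = i) by lia. subst i'. split; intros; [tauto|auto]. }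
        split; intros Hn; [apply La; tauto|apply Lb].
        intros [?|[?|?]]; [tauto|lia|tauto].
      * intros r r' Hr Hr'. destruct (Nat.eq_dec r' j).
        { subst r'. rewrite Hjj. destruct (Nat.eq_dec r j); [subst r; now rewrite Hjj|].
          rewrite Hjl by lia. apply L6; auto. apply nth_In. lia. }
        rewrite !Hjl by lia. apply L5; lia.
      * intros x y Hx Hy. assert (Hy' : In y rest).
        { rewrite Er. rewrite in_app_iff in *. simpl. tauto. }
        rewrite in_app_iff in Hx. destruct Hx as [Hx|[<-|[]]]; auto.
    + intros s2 (J1 & J2 & fin & rest & L1 & L2 & L3 & L4 & L5 & L6) _ _.
      split; auto.
      assert (Hrest : rest = []).
      { apply Permutation_length in L2. rewrite length_app, length_seq in L2.
        apply length_zero_iff_nil. lia. }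
      subst rest. rewrite app_nil_r in L2.
      split; [|split].
      * intros r Hr. rewrite L3 by auto.
        assert (Hin : In (nth r fin 0) (seq 0 m)).
        { eapply Permutation_in; [exact L2|]. apply nth_In; lia. }
        apply in_seq in Hin. lia.
      * intros i Hi. assert (Hin : In i fin).
        { eapply Permutation_in; [apply Permutation_sym; exact L2|]. apply in_seq; lia. }
        destruct (In_nth _ _ 0 Hin) as (r & Hr & Er). exists r. rewrite L3 by lia. split; auto; lia.
      * intros r r' Hr Hr'. rewrite !L3 by lia. apply L5; auto.
  Unshelve.
  all: cbn [ecost cell region]; generalize (ecost off); intros k; try lia; nia.
Qed.
End Sort.

(** * Block pairs and block scans *)

Lemma fold_max_ge l : forall a, a <= fold_left Nat.max l a /\
  (forall x, In x l -> x <= fold_left Nat.max l a).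
Proof.
  induction l as [|y l IH]; intros a; simpl; [split; [lia|tauto]|].
  destruct (IH (Nat.max a y)) as [H1 H2]. split; [lia|].
  intros x [<-|Hx]; [lia|auto].
Qed.

Lemma fold_max_le l b : forall a, a <= b -> (forall x, In x l -> x <= b) -> fold_left Nat.max l a <= b.
Proof.
  induction l as [|y l IH]; intros a Ha H; simpl; auto.
  apply IH; [|intros; apply H; simpl; auto].
  specialize (H y (or_introl eq_refl)). lia.
Qed.

Lemma skew_conv_ge n A B k i j : i <= n -> j <= n -> i + j = k ->
  Nat.min (A i) (B j + k) <= skew_conv n A B k.
Proof.
  intros Hi Hj <-. apply fold_max_ge. unfold skew_candidates.
  apply in_map_iff. exists i. replace (i + j - i) with j by lia. split; auto.
  apply filter_In. split; [apply in_seq; lia|].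
  apply andb_true_intro. split; apply Nat.leb_le; lia.
Qed.

Lemma skew_conv_le n A B k x :
  (forall i j, i <= n -> j <= n -> i + j = k -> Nat.min (A i) (B j + k) <= x) ->
  skew_conv n A B k <= x.
Proof.
  intros H. apply fold_max_le; [lia|]. intros y Hy.
  apply in_map_iff in Hy as (i & <- & Hi). apply filter_In in Hi as [Hi1 Hi2].
  apply in_seq in Hi1. apply andb_prop in Hi2 as [H1 H2].
  apply Nat.leb_le in H1, H2. apply H; lia.
Qed.

(** * Boolean convolutions as counts of index pairs *)

Section ConvNonzero.
Open Scope Z_scope.

Lemma zsum_nonneg n f : (forall i, (i < n)%nat -> 0 <= f i) -> 0 <= zsum n f.
Proof.
  induction n; intros H; simpl; [lia|]. specialize (IHn ltac:(auto)). specialize (H n ltac:(lia)). lia.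
Qed.

Lemma zsum_upper n f b : (forall i, (i < n)%nat -> f i <= b) -> zsum n f <= Z.of_nat n * b.
Proof.
  induction n; intros H; cbn [zsum]; [lia|].
  specialize (IHn ltac:(auto)). specialize (H n ltac:(lia)). lia.
Qed.

Lemma zsum_pos n f i : (forall i, (i < n)%nat -> 0 <= f i) -> (i < n)%nat -> 0 < f i -> 0 < zsum n f.
Proof.
  induction n; intros H Hi Hf; [lia|]. simpl.
  pose proof (zsum_nonneg n f ltac:(auto)). pose proof (H n ltac:(lia)).
  destruct (Nat.eq_dec i n) as [->|]; [lia|]. specialize (IHn ltac:(auto) ltac:(lia) Hf). lia.
Qed.

Lemma zsum_nonzero n f : zsum n f <> 0 -> exists i, (i < n)%nat /\ f i <> 0.
Proof.
  induction n; simpl; intros H; [lia|].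
  destruct (Z.eq_dec (f n) 0) as [E|E]; [|exists n; split; auto].
  destruct IHn as (i & Hi & Hf); [lia|]. exists i; split; auto.
Qed.

Variables (N : nat) (X Y : nat -> bool).
Let c v := conv N (fun i => ind (X i)) (fun i => ind (Y i)) v.

Lemma conv_term_bounds v i j : 0 <= ind (i + j =? v)%nat * (ind (X i) * ind (Y j)) <= 1.
Proof. destruct (i + j =? v)%nat, (X i), (Y j); simpl; lia. Qed.

(** Bounding by the number of all index pairs is crude, but only affects the constant exponent in
    the word-size condition. *)
Lemma conv_bounds v : 0 <= c v <= Z.of_nat N * Z.of_nat N.
Proof.
  unfold c, conv; split.
  - apply zsum_nonneg; intros; apply zsum_nonneg; intros; apply conv_term_bounds.
  - apply zsum_upper; intros i Hi.
    rewrite <- (Z.mul_1_r (Z.of_nat N)). apply zsum_upper; intros; apply conv_term_bounds.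
Qed.

Lemma conv_nonzero v : c v <> 0 <->
  exists i j, (i < N)%nat /\ (j < N)%nat /\ (i + j = v)%nat /\ X i = true /\ Y j = true.
Proof.
  unfold c, conv; split.
  - intros H. apply zsum_nonzero in H as (i & Hi & H). apply zsum_nonzero in H as (j & Hj & H).
    exists i, j. destruct (Nat.eqb_spec (i + j) v), (X i), (Y j); simpl in H; auto; lia.
  - intros (i & j & Hi & Hj & E & HX & HY).
    assert (0 < zsum N (fun i => zsum N (fun j =>
       ind (i + j =? v)%nat * (ind (X i) * ind (Y j))))); [|lia].
    apply zsum_pos with i; auto.
    { intros; apply zsum_nonneg; intros; apply conv_term_bounds. }
    apply zsum_pos with j; auto.
    { intros; apply conv_term_bounds. }
    rewrite HX, HY, E, Nat.eqb_refl. simpl; lia.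
Qed.

End ConvNonzero.

(** * Programs for block pairs and scans *)

Definition outcell (e : expr) := Bin Add (Bin Add (Bin Add (Var 0) (Var 0)) (Cst 3)) e.

(** [B[j] + k] may exceed the largest word. A wrapped sum is recognised by being smaller than [k]
    and is replaced by the largest word, which does not change its minimum with [A[i]]. *)
Definition cand :=
  Seq (Asg 32 (Bin Add (Var 36) (Var 34)))
  (Seq (If (Bin Lt (Var 32) (Var 34)) (Asg 32 (Bin Sub (Cst 0) (Cst 1))) Skip)
  (Seq (If (Bin Lt (Var 35) (Var 32)) (Asg 33 (Var 35)) (Asg 33 (Var 32)))
       (If (Bin Lt (Mem (outcell (Var 34))) (Var 33)) (Sto (outcell (Var 34)) (Var 33)) Skip))).

Definition update :=
  For 34 (Bin Add (Bin Add (Var 0) (Var 0)) (Cst 1)) (If (Mem (cell 5 (Var 34))) cand Skip).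

(** Zeros are written first because the padding up to [16 ^ d] is met by no rank. The test that the
    rank is at least the threshold compares with rank plus one, as only [<] is available. *)
Definition fill kX kP thr :=
  Seq (Asg 27 (Var 4)) (Seq (tab kX (Cst 0))
  (For 20 (Var 1)
    (Sto (cell kX (Mem (cell kP (Var 20)))) (Bin Lt (Var thr) (Bin Add (Var 20) (Cst 1)))))).

Definition Aval e := Mem (Bin Add (Cst 1) e).
Definition Bval e := Mem (Bin Add (Bin Add (Var 0) (Cst 2)) e).

Definition block_pair F :=
  Seq (fill 5 1 39) (Seq (fill 6 2 40) (Seq (convol F)
  (Seq (Asg 35 (Aval (Mem (cell 1 (Var 39)))))
  (Seq (Asg 36 (Bval (Mem (cell 2 (Var 40)))))
       update)))).

(** [g] blocks of size [sz] may overshoot the number of ranks; a block that starts past the end of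
    the sorted order is empty and skipped. *)
Definition all_pairs F :=
  For 37 (Var 6) (For 38 (Var 6)
    (Seq (Asg 39 (Bin Mul (Var 37) (Var 7)))
    (Seq (Asg 40 (Bin Mul (Var 38) (Var 7)))
    (If (Bin Lt (Var 39) (Var 1)) (If (Bin Lt (Var 40) (Var 1)) (block_pair F) Skip) Skip)))).

(* [side] is [true] for A and [false] for B. *)
Definition find_block (side : bool) :=
  let kP := if side then 1 else 2 in
  let val := if side then Aval else Bval in
  let off := if side then Cst 0 else Var 34 in
  For 37 (Var 6)
    (Seq (Asg 39 (Bin Mul (Var 37) (Var 7)))
    (If (Bin Lt (Var 39) (Var 1))
      (Seq (Asg 32 (Bin Add (val (Mem (cell kP (Var 39)))) off))
        (If (Bin Lt (Var 32) off) Skip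
        (If (Bin Lt (Var 41) (Var 32)) Skip (Asg 43 (Var 39))))) Skip)).

(* Registers 44 and 45 hold the indices i and j of a candidate pair. *)
Definition scan_block (side : bool) :=
  let kP := if side then 1 else 2 in
  let own := if side then 44 else 45 in
  let oth := if side then 45 else 44 in
  For 38 (Var 7)
    (Seq (Asg 40 (Bin Add (Var 43) (Var 38)))
    (If (Bin Lt (Var 40) (Var 1))
      (Seq (Asg own (Mem (cell kP (Var 40))))
        (If (Bin Lt (Var 34) (Var own)) Skip
        (Seq (Asg oth (Bin Sub (Var 34) (Var own)))
        (If (Bin Lt (Var 0) (Var oth)) Skip
        (Seq (Asg 35 (Aval (Var 44)))
        (Seq (Asg 36 (Bval (Var 45))) cand)))))) Skip)).

(** If no block qualifies, register 43 keeps the default 0 and the first block is scanned. This is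
    harmless, as every candidate tried is a lower bound of the result. *)
Definition scan (side : bool) :=
  Seq (Asg 43 (Cst 0)) (Seq (find_block side) (scan_block side)).

(** The bound [v0] is saved in register 41 before the scan of A can raise the output cell, so that
    both scans search with the same [v0]. *)
Definition finish :=
  For 34 (Bin Add (Bin Add (Var 0) (Var 0)) (Cst 1))
    (Seq (Asg 41 (Mem (outcell (Var 34)))) (Seq (scan true) (scan false))).

(** Registers below 16 hold the parameters set at the start; all later commands write higher ones,
    which computation confirms. *)
Lemma low_regs c s1 s2 : (forallb (fun x => 16 <=? x) c) = true ->
  (forall y, inb y c = false -> V s2 y = V s1 y) -> forall y, y < 16 -> V s2 y = V s1 y.
Proof.
  intros H1 H2 y Hy. apply H2. unfold inb. destruct (existsb _ c) eqn:E; auto.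
  apply existsb_exists in E as (x & Hx & Ex). apply Nat.eqb_eq in Ex. subst x.
  rewrite forallb_forall in H1. specialize (H1 y Hx). apply Nat.leb_le in H1. lia.
Qed.

(** * Soundness and completeness of block pairs and scans *)

Section Main.
Variables (W n U d g sz l : nat) (A B sA sB : nat -> nat).
Let m := n + 1.
Hypothesis HW : 100 < W.
Hypothesis HU : 16 * U <= W.
Hypothesis HnU : 4 * n + 8 < U.
Hypothesis HdU : 2 * 31 ^ d <= U.
Hypothesis Hd : m <= 16 ^ d.
Hypothesis Hsz : 0 < sz.
Hypothesis Hgsz : m <= g * sz.
Hypothesis HgszU : g * sz + sz <= U.
Hypothesis HD : (toom_den ^ Z.of_nat d * (Z.of_nat (16 ^ d) * Z.of_nat (16 ^ d)) < Z.of_nat W)%Z.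
Hypothesis PA : sorted_perm (fun y => A (y - 1)) m sA.
Hypothesis PB : sorted_perm (fun y => B (y - 1)) m sB.

Record Env (s : st) : Prop := {
  E0 : V s 0 = n; E1 : V s 1 = m; E2 : V s 2 = U; E3 : V s 3 = d; E4 : V s 4 = 16 ^ d;
  E5 : V s 5 = 31 ^ d; E6 : V s 6 = g; E7 : V s 7 = sz }.

Record Data (s : st) : Prop := {
  DA : forall i, i < m -> M s (1 + i) = A i;
  DB : forall j, j < m -> M s (n + 2 + j) = B j;
  DsA : forall r, r < m -> M s (1 * U + r) = sA r;
  DsB : forall r, r < m -> M s (2 * U + r) = sB r }.

Definition out (s : st) k := M s (n + n + 3 + k).

Lemma Env_frame s s' : (forall y, y < 16 -> V s' y = V s y) -> Env s -> Env s'.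
Proof. intros H [? ? ? ? ? ? ? ?]; split; rewrite H by (now apply Nat.ltb_lt); auto. Qed.

Lemma Data_same ks s s' : (forall k, In k ks -> 3 <= k) -> same U ks s s' -> Data s -> Data s'.
Proof.
  intros Hk Hs [D1 D2 D3 D4]. split; intros; rewrite Hs; auto;
    intros k Hin; specialize (Hk k Hin); nia.
Qed.

Lemma Data_out s s' : (forall a, ~ (n + n + 3 <= a < U) -> M s' a = M s a) -> Data s -> Data s'.
Proof.
  intros H [D1 D2 D3 D4]. split; intros; rewrite H; auto; lia.
Qed.

Lemma sat_add a k : a < W -> k < W ->
  (if (a + k) mod W <? k then W - 1 else (a + k) mod W) = Nat.min (a + k) (W - 1).
Proof.
  intros Ha Hk. destruct (Nat.lt_ge_cases (a + k) W).
  - rewrite Nat.mod_small by auto. destruct (Nat.ltb_spec (a + k) k); lia.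
  - assert (E : (a + k) mod W = a + k - W).
    { symmetry. apply Nat.mod_unique with 1; lia. }
    rewrite E. destruct (Nat.ltb_spec (a + k - W) k); lia.
Qed.

Lemma ev_outcell e s k : V s 0 = n -> ev W e s = k -> k <= 2 * n -> ev W (outcell e) s = n + n + 3 + k.
Proof.
  intros H0 He Hk. unfold outcell. apply ev_add; [lia| |exact He|lia].
  apply ev_add; [lia| |apply ev_cst; lia|lia]. apply ev_add; [lia|exact H0|exact H0|lia].
Qed.

Lemma ev_neg1 s : ev W (Bin Sub (Cst 0) (Cst 1)) s = W - 1.
Proof.
  cbn [ev bopev]. rewrite (Nat.mod_small 1), (Nat.mod_small 1), (Nat.mod_small 0), Nat.mod_small; lia.
Qed.

Lemma saturate_ok s b k : V s 32 = (b + k) mod W -> V s 34 = k -> b < W -> k < W ->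
  ok W (If (Bin Lt (Var 32) (Var 34)) (Asg 32 (Bin Sub (Cst 0) (Cst 1))) Skip) s 20
    (fun s' => V s' 32 = Nat.min (b + k) (W - 1) /\ M s' = M s).
Proof.
  intros X1 Hk Hb HkW.
  assert (Ec : ev W (Bin Lt (Var 32) (Var 34)) s = if (b + k) mod W <? k then 1 else 0).
  { apply ev_lt_op; [lia|exact X1|exact Hk]. }
  rewrite <- sat_add by lia.
  eapply ok_weaken; [lia| |shelve|intros s' _ _ Hq; exact Hq].
  apply ok_if; [lia| |]; rewrite Ec; intros Hc.
  - apply ok_asg. rewrite ev_neg1. stsimp. split; [|reflexivity].
    destruct (_ <? k); auto; lia.
  - apply ok_skip. split; [|reflexivity]. rewrite X1. destruct (_ <? k); auto; lia.
  Unshelve. cbn [ecost]. lia.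
Qed.

Lemma min_ok s a b : V s 35 = a -> V s 32 = b ->
  ok W (If (Bin Lt (Var 35) (Var 32)) (Asg 33 (Var 35)) (Asg 33 (Var 32))) s 20
    (fun s' => V s' 33 = Nat.min a b /\ M s' = M s).
Proof.
  intros Ha Hb.
  assert (Ec : ev W (Bin Lt (Var 35) (Var 32)) s = if a <? b then 1 else 0).
  { apply ev_lt_op; [lia|exact Ha|exact Hb]. }
  eapply ok_weaken; [lia| |shelve|intros s' _ _ Hq; exact Hq].
  apply ok_if; [lia| |]; rewrite Ec; intros Hc; apply ok_asg; stsimp;
    (split; [|reflexivity]); cbn [ev]; rewrite ?Ha, ?Hb; destruct (Nat.ltb_spec a b); lia.
  Unshelve. cbn [ecost]. lia.
Qed.

Lemma cand_ok s k a b :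
  V s 0 = n -> V s 34 = k -> V s 35 = a -> V s 36 = b -> k <= 2 * n ->
  ok W cand s 100 (fun s' =>
    M s' (n + n + 3 + k) = Nat.max (M s (n + n + 3 + k)) (Nat.min a (b + k)) /\
    forall x, x <> n + n + 3 + k -> M s' x = M s x).
Proof.
  intros H0 Hk Ha Hb Hkn.
  eapply ok_weaken; [lia| |shelve|intros s' _ _ Hq; exact Hq]. unfold cand.
  apply ok_seq_asg; [lia|]; intros Hwf.
  assert (HaW : a < W) by (rewrite <- Ha; apply Hwf).
  assert (HbW : b < W) by (rewrite <- Hb; apply Hwf).
  set (s1 := setV s 32 _).
  assert (X1 : V s1 32 = (b + k) mod W).
  { unfold s1; stsimp. cbn [ev bopev]. now rewrite Hb, Hk. }
  apply ok_seq; [lia|].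
  eapply ok_weaken; [lia|apply (saturate_ok s1 b k); auto; lia|apply le_n|].
  intros s2 Hwf2 Hfr2 (X2 & M2).
  apply ok_seq; [lia|].
  eapply ok_weaken; [lia|apply (min_ok s2 a (Nat.min (b + k) (W - 1))); auto|apply le_n|].
  { rewrite Hfr2 by reflexivity. exact Ha. }
  intros s3 Hwf3 Hfr3 (X3' & M3').
  assert (M3 : M s3 = M s) by (rewrite M3', M2; reflexivity).
  (* Saturation at [W - 1] disappears in the minimum, since [a < W]. *)
  assert (X3 : V s3 33 = Nat.min a (b + k)) by lia.
  assert (O3 : ev W (outcell (Var 34)) s3 = n + n + 3 + k).
  { apply ev_outcell; auto.
    - rewrite Hfr3, Hfr2 by reflexivity. exact H0.
    - cbn [ev]. rewrite Hfr3, Hfr2 by reflexivity. exact Hk. }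
  assert (Ec : ev W (Bin Lt (Mem (outcell (Var 34))) (Var 33)) s3 =
     if M s (n + n + 3 + k) <? Nat.min a (b + k) then 1 else 0).
  { apply ev_lt_op; [lia| |exact X3]. eapply ev_load; [lia|exact O3|now rewrite M3]. }
  apply ok_if; [lia| |]; rewrite Ec; intros Hc;
    destruct (Nat.ltb_spec (M s (n + n + 3 + k)) (Nat.min a (b + k))); try lia.
  - apply ok_sto. rewrite O3. cbn [ev]. rewrite X3. unfold setM; cbn [M]. rewrite M3. split.
    + rewrite upd_eq. lia.
    + intros x Hx. now apply upd_neq.
  - apply ok_skip. rewrite M3. split; auto. lia.
  Unshelve. cbn [ecost outcell]. lia.
Qed.

Lemma update_ok s a b :
  Env s -> V s 35 = a -> V s 36 = b ->
  ok W update s ((2 * n + 1) * 150 + 20) (fun s' =>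
    (forall k, k <= 2 * n -> out s' k =
       if M s (5 * U + k) =? 0 then out s k else Nat.max (out s k) (Nat.min a (b + k))) /\
    (forall x, ~ (n + n + 3 <= x < U) -> M s' x = M s x)).
Proof.
  intros HE Ha Hb.
  eapply ok_weaken; [lia| |shelve|intros s' _ _ Hq; exact Hq]. unfold update.
  apply ok_for_n with (n := 2 * n + 1) (T := 130) (I := fun j s1 =>
    (forall k, k <= 2 * n -> out s1 k =
       if (j <=? k) then out s k else
       if M s (5 * U + k) =? 0 then out s k else Nat.max (out s k) (Nat.min a (b + k))) /\
    (forall x, ~ (n + n + 3 <= x < U) -> M s1 x = M s x)).
  - lia.
  - replace (2 * n + 1) with (n + n + 1) by lia.
    apply ev_add; [lia| |apply ev_cst; lia|lia]. apply ev_add; [lia|apply HE|apply HE|lia].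
  - split; auto.
  - intros j s1 Hj (I1 & I2) Hwf1 Hfr.
    set (s2 := setV s1 34 j).
    assert (Ex : ev W (Mem (cell 5 (Var 34))) s2 = M s (5 * U + j)).
    { eapply ev_load; [lia|apply (ev_cell W U HW HU 5 (Var 34) s2 j); [ |lia|reflexivity|lia]|].
      - unfold s2; stsimp. rewrite Hfr by reflexivity. apply HE.
      - change (M s2) with (M s1). apply I2. lia. }
    eapply ok_weaken; [lia| |shelve|intros s' _ _ Hq; exact Hq].
    apply ok_if; [lia| |]; rewrite Ex; intros Hc.
    + eapply ok_weaken; [lia|apply (cand_ok s2 j a b)|apply le_n|];
        try (unfold s2; stsimp; rewrite ?Hfr by reflexivity; auto; fail); try lia.
      { unfold s2; stsimp. rewrite Hfr by reflexivity. apply HE. }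
      intros s3 _ _ (C1 & C2). split.
      * intros k Hk. destruct (Nat.eq_dec k j) as [->|Hkj].
        { unfold out at 1. rewrite C1. change (M s2) with (M s1). fold (out s1 j). rewrite I1 by auto.
          rewrite (proj2 (Nat.leb_le j j)) by lia. rewrite (proj2 (Nat.leb_gt (S j) j)) by lia.
          now rewrite (proj2 (Nat.eqb_neq _ _) Hc). }
        unfold out at 1. rewrite C2 by lia. change (M s2) with (M s1). fold (out s1 k). rewrite I1 by auto.
        destruct (Nat.leb_spec j k), (Nat.leb_spec (S j) k); auto; lia.
      * intros x Hx. rewrite C2 by lia. apply I2; auto.
    + apply ok_skip. change (out s2) with (out s1). change (M s2) with (M s1). split; auto.
      intros k Hk. rewrite I1 by auto.
      destruct (Nat.leb_spec j k), (Nat.leb_spec (S j) k); auto; try lia.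
      replace k with j by lia. now rewrite Hc.
  - intros s1 (I1 & I2) _ _. split; auto. intros k Hk. rewrite I1 by auto.
    now rewrite (proj2 (Nat.leb_gt (2 * n + 1) k)) by lia.
  Unshelve. all: cbn [ecost cell region]; lia.
Qed.

Definition hit (sg : nat -> nat) t j i := existsb (fun r => (sg r =? i) && (t <=? r))%bool (seq 0 j).

Lemma hit_spec sg t j i : hit sg t j i = true <-> exists r, r < j /\ t <= r /\ sg r = i.
Proof.
  unfold hit. rewrite existsb_exists. split.
  - intros (r & Hr & E). apply in_seq in Hr. apply andb_prop in E as [E1 E2].
    apply Nat.eqb_eq in E1. apply Nat.leb_le in E2. exists r; repeat split; auto; lia.
  - intros (r & Hr & Ht & E). exists r. split; [apply in_seq; lia|].
    apply andb_true_intro; split; [apply Nat.eqb_eq|apply Nat.leb_le]; auto.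
Qed.

(** Overwriting the cell of [sg j] cannot erase a mark: an earlier rank at the same index that
    passes the threshold forces [t <= j]. *)
Lemma hit_S sg t j i : hit sg t (S j) i = if sg j =? i then t <=? j else hit sg t j i.
Proof.
  unfold hit. rewrite seq_S, existsb_app. simpl.
  destruct (sg j =? i) eqn:E; simpl; [|now rewrite Bool.orb_false_r].
  rewrite Bool.orb_false_r. destruct (Nat.leb_spec t j).
  - apply Bool.orb_true_r.
  - rewrite Bool.orb_false_r. apply Bool.not_true_iff_false. intros H1.
    fold (hit sg t j i) in H1. apply hit_spec in H1 as (r & Hr & Ht & _). lia.
Qed.

Lemma fill_ok s kX kP thr t sg :
  Env s -> V s thr = t -> t < m -> 5 <= kX <= 6 -> 1 <= kP <= 2 -> 30 <= thr ->
  (forall r, r < m -> M s (kP * U + r) = sg r /\ sg r < m) ->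
  ok W (fill kX kP thr) s (100 * 31 ^ d) (fun s' =>
    arr W U s' kX (16 ^ d) (fun i => ind (hit sg t m i)) /\ same U [kX] s s').
Proof.
  intros HE Ht Htm HkX HkP Hthr Hsg.
  assert (H16 : 16 ^ d <= 31 ^ d) by (apply Nat.pow_le_mono_l; lia).
  eapply ok_weaken; [lia| |shelve|intros s' _ _ Hq; exact Hq]. unfold fill.
  apply ok_seq_asg; [lia|]; intros Hwf. cbn [ev]. rewrite (E4 _ HE).
  set (s1 := setV s 27 (16 ^ d)).
  apply ok_seq; [lia|].
  eapply ok_weaken; [lia|apply (tab_ok W U HW HU kX (Cst 0) s1 (16 ^ d) (fun _ x => x = 0))|apply le_n|];
    try reflexivity; try lia.
  { apply HE. }
  { intros. apply ev_cst; lia. }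
  intros s2 Hwf2 Hfr2 (Z1 & Z2).
  apply ok_for_n with (n := m) (T := 40) (I := fun j s3 =>
    (forall i, i < 16 ^ d -> M s3 (kX * U + i) = if hit sg t j i then 1 else 0) /\
    (forall a, ~ (kX * U <= a < kX * U + 16 ^ d) -> M s3 a = M s a)).
  - lia.
  - cbn [ev]. rewrite Hfr2 by reflexivity. apply HE.
  - split; auto.
  - intros j s3 Hj (I1 & I2) Hwf3 Hfr3.
    set (s4 := setV s3 20 j).
    destruct (Hsg j Hj) as [Hs1 Hs2].
    assert (HU4 : V s4 2 = U).
    { unfold s4; stsimp. rewrite Hfr3, Hfr2 by reflexivity. apply HE. }
    assert (Ej : ev W (Mem (cell kP (Var 20))) s4 = sg j).
    { eapply ev_load; [lia|apply (ev_cell W U HW HU kP (Var 20) s4 j); [exact HU4|lia|reflexivity|lia]|].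
      change (M s4) with (M s3). rewrite I2; auto. nia. }
    assert (Ea : ev W (cell kX (Mem (cell kP (Var 20)))) s4 = kX * U + sg j).
    { apply (ev_cell W U HW HU); auto; lia. }
    assert (Ev : ev W (Bin Lt (Var thr) (Bin Add (Var 20) (Cst 1))) s4 = if t <=? j then 1 else 0).
    { rewrite (ev_lt_op W HW _ _ s4 t (j + 1)).
      - destruct (Nat.ltb_spec t (j + 1)), (Nat.leb_spec t j); auto; lia.
      - cbn [ev]. unfold s4. cbn [V setV]. rewrite upd_neq by lia.
        rewrite Hfr3, Hfr2; [unfold s1; cbn [V setV]; rewrite upd_neq by lia; exact Ht| |];
        unfold inb; cbn; apply Bool.orb_false_iff; split; auto; apply Nat.eqb_neq; lia.
      - apply ev_add; [lia|reflexivity|apply ev_cst; lia|lia]. }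
    eapply ok_weaken; [lia|apply ok_sto; rewrite Ea, Ev|shelve|intros s' _ _ Hq; exact Hq].
    unfold setM; cbn [M]. split.
    + intros i Hi. unfold upd. rewrite hit_S.
      destruct (Nat.eqb_spec (kX * U + i) (kX * U + sg j)), (Nat.eqb_spec (sg j) i); try lia; auto.
      apply (I1 i Hi).
    + intros a Ha. rewrite upd_neq by lia. apply I2; auto.
  - intros s3 (I1 & I2) _ _. split.
    + intros i Hi. rewrite I1 by auto. unfold ind. destruct (hit _ _ _ _); reflexivity.
    + intros a Ha. specialize (Ha kX (or_introl eq_refl)). apply I2. lia.
  Unshelve. all: cbn [ecost cell region]; try lia.
Qed.

(** The cell is congruent to a positive power of [toom_den] times the number of pairs. By [HD] this
    integer is below [W], so the congruence is an equality and the cell vanishes together with the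
    count. *)
Lemma conv_read s X Y v :
  wf W s -> arr W U s 5 (2 * 16 ^ d) (invs lagrange d (spread
    (fwds d (fun i => ind (X i))) (fwds d (fun i => ind (Y i))))) -> v < 2 * 16 ^ d ->
  M s (5 * U + v) <> 0 <->
  exists i j, i < 16 ^ d /\ j < 16 ^ d /\ i + j = v /\ X i = true /\ Y j = true.
Proof.
  intros Hwf Harr Hv. specialize (Harr v Hv).
  pose proof (toom_conv lagrange toom_den lagrange_evm d (fun i => ind (X i)) (fun i => ind (Y i)) 0 v Hv) as HT.
  cbn [Nat.mul Nat.add] in HT. rewrite HT in Harr. clear HT.
  rewrite <- (conv_nonzero (16 ^ d) X Y v).
  pose proof (conv_bounds (16 ^ d) X Y v) as Hb. cbv beta in Hb.
  set (c := conv _ _ _ v) in *.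
  assert (HP : (0 < toom_den ^ Z.of_nat d)%Z).
  { apply Z.pow_pos_nonneg; [apply toom_den_bounds|lia]. }
  set (P := (toom_den ^ Z.of_nat d)%Z) in *.
  unfold eqm in Harr.
  assert (HM : M s (5 * U + v) < W) by apply Hwf.
  rewrite !Z.mod_small in Harr by nia.
  split; intros H; intros Hc; apply H; [rewrite Hc in Harr; lia|].
  rewrite Hc in Harr. simpl in Harr. nia.
Qed.

(** The completeness half of the invariants, with [below] as the soundness half; between the two the
    output is free to grow. The ranks range over suffixes of the sorted orders, as in the convolved
    sets. *)
Definition cov (s : st) p q := forall r r', p * sz <= r < m -> q * sz <= r' < m ->
  Nat.min (A (sA (p * sz))) (B (sB (q * sz)) + (sA r + sB r')) <= out s (sA r + sB r').

Definition below (s : st) := forall k, k <= 2 * n -> out s k <= skew_conv n A B k.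

Definition block_time := 1000 + convol_time lagrange.

Lemma sA_lt r : r < m -> sA r < m.
Proof. apply PA. Qed.
Lemma sB_lt r : r < m -> sB r < m.
Proof. apply PB. Qed.

Lemma A_sorted r r' : r <= r' -> r' < m -> A (sA r) <= A (sA r').
Proof.
  intros H1 H2. destruct PA as (_ & _ & H). specialize (H r r' H1 H2). cbv beta in H.
  now rewrite !Nat.add_sub in H.
Qed.

Lemma B_sorted r r' : r <= r' -> r' < m -> B (sB r) <= B (sB r').
Proof.
  intros H1 H2. destruct PB as (_ & _ & H). specialize (H r r' H1 H2). cbv beta in H.
  now rewrite !Nat.add_sub in H.
Qed.

Lemma ev_Aval e s i : Data s -> ev W e s = i -> i < m -> ev W (Aval e) s = A i.
Proof.
  intros HD' He Hi. eapply ev_load; [lia| |apply (DA _ HD'); exact Hi].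
  apply ev_add; [lia|apply ev_cst; lia|exact He|lia].
Qed.

Lemma ev_Bval e s i : V s 0 = n -> Data s -> ev W e s = i -> i < m -> ev W (Bval e) s = B i.
Proof.
  intros H0 HD' He Hi. eapply ev_load; [lia| |apply (DB _ HD'); exact Hi].
  apply ev_add; [lia| |exact He|lia]. apply ev_add; [lia|exact H0|apply ev_cst; lia|lia].
Qed.

(** Soundness: a nonzero count at [k] comes from ranks at or beyond the two block starts, whose keys
    are at least the block minima by sortedness, so the value written is bounded by a true
    candidate. Coverage: each such pair of ranks makes the count at its index sum nonzero. *)
Lemma block_pair_ok s p q :
  Env s -> Data s -> V s 39 = p * sz -> V s 40 = q * sz -> p * sz < m -> q * sz < m -> below s ->
  ok W (block_pair lagrange) s (block_time * ((d + 1) * 31 ^ d)) (fun s' =>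
    Data s' /\ below s' /\ (forall k, k <= 2 * n -> out s k <= out s' k) /\ cov s' p q).
Proof.
  intros HE HDt H39 H40 Hp Hq Hbl.
  pose proof (pow_pos 31 d ltac:(lia)) as H31.
  assert (H16 : 16 ^ d <= 31 ^ d) by (apply Nat.pow_le_mono_l; lia).
  eapply ok_weaken; [lia| |shelve|intros s' _ _ Hq'; exact Hq']. unfold block_pair.
  apply ok_seq; [lia|].
  eapply ok_weaken; [lia|apply (fill_ok s 5 1 39 (p * sz) sA)|apply le_n|]; auto; try lia.
  { intros r Hr. split; [apply HDt; auto|apply sA_lt; auto]. }
  intros s1 Hwf1 Hfr1 (X1 & X2).
  assert (HE1 : Env s1) by (eapply Env_frame; [eapply low_regs; [|exact Hfr1]; reflexivity|exact HE]).
  assert (HD1 : Data s1).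
  { eapply Data_same; [|exact X2|exact HDt]. simpl; lia. }
  apply ok_seq; [lia|].
  eapply ok_weaken; [lia|apply (fill_ok s1 6 2 40 (q * sz) sB)|apply le_n|]; auto; try lia.
  { rewrite Hfr1 by reflexivity; auto. }
  { intros r Hr. split; [apply HD1; auto|apply sB_lt; auto]. }
  intros s2 Hwf2 Hfr2 (Y1 & Y2).
  assert (HE2 : Env s2) by (eapply Env_frame; [eapply low_regs; [|exact Hfr2]; reflexivity|exact HE1]).
  assert (HD2 : Data s2).
  { eapply Data_same; [|exact Y2|exact HD1]. simpl; lia. }
  apply ok_seq; [lia|].
  eapply ok_weaken; [lia|apply (convol_ok W U HW HU lagrange
     (fun i => ind (hit sA (p * sz) m i)) (fun i => ind (hit sB (q * sz) m i)) s2 d)|apply le_n|];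
    try apply HE2; auto; try lia.
  { eapply (arr_same W U HW HU); [exact Y2| |lia|exact X1]. simpl; lia. }
  intros s3 Hwf3 Hfr3 (C1 & C2).
  assert (L3 : forall y, y < 16 -> V s3 y = V s2 y).
  { eapply low_regs; [|exact Hfr3]. reflexivity. }
  assert (HE3 : Env s3) by (eapply Env_frame; eauto).
  assert (HD3 : Data s3).
  { eapply Data_same; [|exact C2|exact HD2]. simpl; lia. }
  assert (V39 : V s3 39 = p * sz) by (rewrite Hfr3, Hfr2, Hfr1 by reflexivity; auto).
  assert (V40 : V s3 40 = q * sz) by (rewrite Hfr3, Hfr2, Hfr1 by reflexivity; auto).
  apply ok_seq_asg; [lia|]; intros _.
  assert (Ea : ev W (Aval (Mem (cell 1 (Var 39)))) s3 = A (sA (p * sz))).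
  { apply ev_Aval; auto; [|apply sA_lt; auto].
    eapply ev_load; [lia| |apply HD3; exact Hp].
    apply (ev_cell W U HW HU); [apply HE3|lia|exact V39|lia]. }
  rewrite Ea. set (s4 := setV s3 35 _).
  apply ok_seq_asg; [lia|]; intros _.
  assert (Eb : ev W (Bval (Mem (cell 2 (Var 40)))) s4 = B (sB (q * sz))).
  { apply ev_Bval; [apply HE3|split; apply HD3| |apply sB_lt; auto].
    eapply ev_load; [lia| |apply HD3; exact Hq].
    apply (ev_cell W U HW HU); [apply HE3|lia|exact V40|lia]. }
  rewrite Eb. set (s5 := setV s4 36 _).
  eapply ok_weaken; [lia|apply (update_ok s5 (A (sA (p * sz))) (B (sB (q * sz))))|apply le_n|];
    try reflexivity.
  { split; apply HE3. }
  intros s6 _ _ (G1 & G2). change (M s5) with (M s3) in *. change (out s5) with (out s3) in *.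
  assert (Hout : forall k, k <= 2 * n -> out s3 k = out s k).
  { intros k Hk. unfold out. rewrite C2, Y2, X2; auto; intros kk Hkk; simpl in Hkk;
      repeat (destruct Hkk as [Hkk|Hkk]; [subst kk; lia|]); contradiction. }
  assert (Hread : forall k, k <= 2 * n -> M s3 (5 * U + k) <> 0 <->
     exists r r', p * sz <= r < m /\ q * sz <= r' < m /\ sA r + sB r' = k).
  { intros k Hk.
    rewrite (conv_read s3 (hit sA (p * sz) m) (hit sB (q * sz) m) k Hwf3 C1) by lia.
    split.
    - intros (i & j & Hi & Hj & E & Hh1 & Hh2).
      apply hit_spec in Hh1 as (r & ? & ? & ?). apply hit_spec in Hh2 as (r' & ? & ? & ?).
      exists r, r'. lia.
    - intros (r & r' & Hr & Hr' & E). exists (sA r), (sB r').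
      pose proof (sA_lt r ltac:(lia)). pose proof (sB_lt r' ltac:(lia)).
      split; [lia|]. split; [lia|]. split; [auto|].
      split; apply hit_spec; [exists r|exists r']; lia. }
  split; [|split; [|split]].
  - eapply Data_out; [exact G2|exact HD3].
  - intros k Hk. rewrite G1 by auto. rewrite Hout by auto.
    destruct (Nat.eqb_spec (M s3 (5 * U + k)) 0) as [E|E]; [apply Hbl; auto|].
    apply Nat.max_lub; [apply Hbl; auto|].
    apply Hread in E as (r & r' & Hr & Hr' & E); auto.
    pose proof (sA_lt r ltac:(lia)). pose proof (sB_lt r' ltac:(lia)).
    eapply Nat.le_trans; [|apply (skew_conv_ge n A B k (sA r) (sB r')); lia].
    pose proof (A_sorted (p * sz) r ltac:(lia) ltac:(lia)).
    pose proof (B_sorted (q * sz) r' ltac:(lia) ltac:(lia)). lia.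
  - intros k Hk. rewrite G1 by auto. rewrite Hout by auto.
    destruct (_ =? 0); lia.
  - intros r r' Hr Hr'.
    pose proof (sA_lt r ltac:(lia)). pose proof (sB_lt r' ltac:(lia)).
    rewrite G1 by lia.
    destruct (Nat.eqb_spec (M s3 (5 * U + (sA r + sB r'))) 0) as [E|E]; [|lia].
    exfalso. revert E. apply Hread; [lia|]. exists r, r'. auto.
  Unshelve.
  unfold block_time. generalize (convol_time lagrange). intros K.
  cbn [ecost Aval Bval cell region]. set (e := 31 ^ d) in *. nia.
Qed.

Lemma ev_outcount s : V s 0 = n -> ev W (Bin Add (Bin Add (Var 0) (Var 0)) (Cst 1)) s = 2 * n + 1.
Proof.
  intros H. replace (2 * n + 1) with (n + n + 1) by lia.
  apply ev_add; [lia| |apply ev_cst; lia|lia]. apply ev_add; [lia|exact H|exact H|lia].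
Qed.

Lemma cov_mono s s' p q : (forall k, k <= 2 * n -> out s k <= out s' k) -> cov s p q -> cov s' p q.
Proof.
  intros H1 H2 r r' Hr Hr'. pose proof (sA_lt r ltac:(lia)). pose proof (sB_lt r' ltac:(lia)).
  eapply Nat.le_trans; [apply H2; auto|apply H1; lia].
Qed.

Lemma all_pairs_ok s : Env s -> Data s -> below s ->
  ok W (all_pairs lagrange) s (g * (g * (block_time * ((d + 1) * 31 ^ d) + 60) + 20) + 20) (fun s' =>
    Data s' /\ below s' /\ forall p q, p < g -> q < g -> cov s' p q).
Proof.
  intros HE HDt Hbl.
  eapply ok_weaken; [lia| |shelve|intros s' _ _ Hq; exact Hq]. unfold all_pairs.
  apply ok_for_n with (n := g) (T := g * (block_time * ((d + 1) * 31 ^ d) + 60) + 10) (I := fun p s1 =>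
    Data s1 /\ below s1 /\ forall p' q, p' < p -> q < g -> cov s1 p' q).
  - lia.
  - apply HE.
  - split; [auto|split; [auto|lia]].
  - intros p s1 Hp (I1 & I2 & I3) Hwf1 Hfr1.
    assert (HE1 : Env s1) by (eapply Env_frame; [eapply low_regs; [|exact Hfr1]; reflexivity|exact HE]).
    eapply ok_weaken; [lia| |shelve|intros s' _ _ Hq; exact Hq].
    apply ok_for_n with (n := g) (T := block_time * ((d + 1) * 31 ^ d) + 50) (I := fun q s3 =>
      Data s3 /\ below s3 /\ (forall p' q', p' < p -> q' < g -> cov s3 p' q') /\
      forall q', q' < q -> cov s3 p q').
    + lia.
    + apply HE1.
    + split; [split; apply I1|]. split; [exact I2|]. split; [exact I3|lia].
    + intros q s3 Hq (J1 & J2 & J3 & J4) Hwf3 Hfr3.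
      assert (L3 : forall y, y < 16 -> V s3 y = V s1 y).
      { intros y Hy. etransitivity; [eapply low_regs; [|exact Hfr3|exact Hy]; reflexivity|].
        cbn [V setV]. apply upd_neq; lia. }
      assert (HE3 : Env s3) by (eapply Env_frame; eauto).
      assert (V37 : V s3 37 = p) by (rewrite Hfr3 by reflexivity; reflexivity).
      assert (Bp : p * sz <= g * sz) by (apply Nat.mul_le_mono_r; lia).
      assert (Bq : q * sz <= g * sz) by (apply Nat.mul_le_mono_r; lia).
      eapply ok_weaken; [lia| |shelve|intros s' _ _ Hq'; exact Hq'].
      apply ok_seq_asg; [lia|]; intros _.
      set (s4 := setV s3 38 q).
      assert (E1 : ev W (Bin Mul (Var 37) (Var 7)) s4 = p * sz).
      { apply ev_mul; [lia|exact V37|apply HE3|lia]. }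
      rewrite E1. set (s5 := setV s4 39 _).
      apply ok_seq_asg; [lia|]; intros _.
      assert (E2 : ev W (Bin Mul (Var 38) (Var 7)) s5 = q * sz).
      { apply ev_mul; [lia|reflexivity|apply HE3|lia]. }
      rewrite E2. set (s6 := setV s5 40 _).
      assert (HE6 : Env s6) by (split; apply HE3).
      assert (HD6 : Data s6) by (split; apply J1).
      assert (C1 : ev W (Bin Lt (Var 39) (Var 1)) s6 = if p * sz <? m then 1 else 0).
      { apply ev_lt_op; [lia|reflexivity|apply HE6]. }
      assert (C2 : ev W (Bin Lt (Var 40) (Var 1)) s6 = if q * sz <? m then 1 else 0).
      { apply ev_lt_op; [lia|reflexivity|apply HE6]. }
      assert (Hvac : (p * sz <? m) = false \/ (q * sz <? m) = false -> cov s6 p q).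
      { intros H r r' Hr Hr'. destruct H as [H|H]; apply Nat.ltb_ge in H; lia. }
      assert (Hskip : cov s6 p q -> Data s6 /\ below s6 /\
        (forall p' q', p' < p -> q' < g -> cov s6 p' q') /\ (forall q', q' < S q -> cov s6 p q')).
      { intros H. split; [auto|]. split; [exact J2|]. split; [exact J3|].
        intros q' Hq'. destruct (Nat.eq_dec q' q) as [->|]; auto. apply J4; lia. }
      apply ok_if; [lia| |]; rewrite C1; intros Hc.
      * apply ok_if; [lia| |]; rewrite C2; intros Hc2.
        -- destruct (Nat.ltb_spec (p * sz) m); [|lia]. destruct (Nat.ltb_spec (q * sz) m); [|lia].
           eapply ok_weaken; [lia|apply (block_pair_ok s6 p q); auto|apply le_n|].
           intros s7 _ _ (K1 & K2 & K3 & K4). split; [auto|]. split; [auto|].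
           split.
           ++ intros p' q' Hp' Hq'. eapply cov_mono; [exact K3|]. apply J3; auto.
           ++ intros q' Hq'. destruct (Nat.eq_dec q' q) as [->|]; auto.
              eapply cov_mono; [exact K3|]. apply J4; lia.
        -- apply ok_skip. apply Hskip, Hvac. right. destruct (q * sz <? m); [discriminate|auto].
      * apply ok_skip. apply Hskip, Hvac. left. destruct (p * sz <? m); [discriminate|auto].
    + intros s3 (J1 & J2 & J3 & J4) _ _. split; auto. split; auto.
      intros p' q Hp' Hq. destruct (Nat.eq_dec p' p) as [->|]; auto. apply J3; lia.
  - intros s1 H _ _. exact H.
  Unshelve. all: cbn [ecost]; lia.
Qed.

Definition sg (side : bool) := if side then sA else sB.
Definition ky (side : bool) := if side then A else B.
Definition ofs (side : bool) (k : nat) := if side then 0 else k.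
(** Describing a pair with sum [k] by its index on one side lets the two scans share one proof;
    [ofs] is the shift that only keys of B receive. *)
Definition valx (side : bool) k x :=
  if side then Nat.min (A x) (B (k - x) + k) else Nat.min (A (k - x)) (B x + k).

Lemma sg_lt side r : r < m -> sg side r < m.
Proof. destruct side; [apply sA_lt|apply sB_lt]. Qed.

Lemma ev_perm (side : bool) e s r : Env s -> Data s -> ev W e s = r -> r < m ->
  ev W (Mem (cell (if side then 1 else 2) e)) s = sg side r.
Proof.
  intros HE HDt He Hr. eapply ev_load; [lia| |].
  - apply (ev_cell W U HW HU); [apply HE|destruct side; lia|exact He|lia].
  - destruct side; apply HDt; auto.
Qed.

Lemma ev_key (side : bool) e s i : Env s -> Data s -> ev W e s = i -> i < m ->
  ev W ((if side then Aval else Bval) e) s = ky side i.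
Proof.
  intros HE HDt He Hi. destruct side; [apply ev_Aval; auto|apply ev_Bval; auto; apply HE].
Qed.

(** A wrapped sum has lost [W], which is more than [x], and so falls below [f]. *)
Lemma mod_overflow x f : x < W -> f < W ->
  ((x + f) mod W < f /\ W <= x + f) \/ (f <= (x + f) mod W /\ (x + f) mod W = x + f).
Proof.
  intros Hx Hf. destruct (Nat.lt_ge_cases (x + f) W).
  - right. rewrite Nat.mod_small by auto. lia.
  - left. assert (E : (x + f) mod W = x + f - W) by (symmetry; apply Nat.mod_unique with 1; lia).
    lia.
Qed.

(** The last block start passing the test wins. A wrapped sum stands for a shifted key of at least
    [W], hence above [v0], and is rightly rejected. *)
Lemma find_block_ok (side : bool) s k v0 :
  Env s -> Data s -> V s 34 = k -> V s 41 = v0 -> V s 43 = 0 -> k <= 2 * n ->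
  ok W (find_block side) s (g * 90 + 20) (fun s' => M s' = M s /\ V s' 43 < m /\
    forall p, p * sz < m -> ky side (sg side (p * sz)) + ofs side k <= v0 ->
      (forall p', p < p' -> p' * sz < m -> v0 < ky side (sg side (p' * sz)) + ofs side k) ->
      V s' 43 = p * sz).
Proof.
  intros HE HDt Hk Hv H43 Hkn.
  set (cond p := p * sz < m /\ ky side (sg side (p * sz)) + ofs side k <= v0).
  eapply ok_weaken; [lia| |shelve|intros s' _ _ Hq; exact Hq]. unfold find_block.
  apply ok_for_n with (n := g) (T := 80) (I := fun j s1 =>
    M s1 = M s /\ V s1 43 < m /\
    forall p, p < j -> cond p -> (forall p', p < p' < j -> ~ cond p') -> V s1 43 = p * sz).
  - lia.
  - apply HE.
  - split; auto. split; [unfold m; lia|lia].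
  - intros j s1 Hj (I1 & I2 & I3) Hwf1 Hfr1.
    assert (L1 : forall y, y < 16 -> V s1 y = V s y).
    { eapply low_regs; [|exact Hfr1]. destruct side; reflexivity. }
    assert (V34 : V s1 34 = k) by (rewrite Hfr1; [exact Hk|destruct side; reflexivity]).
    assert (V41 : V s1 41 = v0) by (rewrite Hfr1; [exact Hv|destruct side; reflexivity]).
    assert (HE1 : Env s1) by (eapply Env_frame; eauto).
    assert (Bj : j * sz <= g * sz) by (apply Nat.mul_le_mono_r; lia).
    assert (Hno : forall s', M s' = M s -> V s' 43 = V s1 43 -> ~ cond j ->
       M s' = M s /\ V s' 43 < m /\
       forall p, p < S j -> cond p -> (forall p', p < p' < S j -> ~ cond p') -> V s' 43 = p * sz).
    { intros s' HM HV Hc. rewrite HV. split; auto. split; auto. intros p Hp Hcp Hp'.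
      assert (p <> j) by (intros ->; auto). apply I3; auto; try lia. intros; apply Hp'; lia. }
    eapply ok_weaken; [lia| |shelve|intros s' _ _ Hq'; exact Hq'].
    apply ok_seq_asg; [lia|]; intros _.
    set (s2 := setV s1 37 j).
    assert (E1 : ev W (Bin Mul (Var 37) (Var 7)) s2 = j * sz).
    { apply ev_mul; [lia|reflexivity|apply HE1|lia]. }
    rewrite E1. set (s3 := setV s2 39 _).
    assert (HE3 : Env s3) by (split; apply HE1).
    assert (HD3 : Data s3).
    { split; change (M s3) with (M s1); rewrite I1; apply HDt. }
    assert (C1 : ev W (Bin Lt (Var 39) (Var 1)) s3 = if j * sz <? m then 1 else 0).
    { apply ev_lt_op; [lia|reflexivity|apply HE3]. }
    apply ok_if; [lia| |]; rewrite C1; intros Hc;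
      destruct (Nat.ltb_spec (j * sz) m) as [Hjm|Hjm]; try lia.
    2:{ apply ok_skip. apply Hno; auto. intros [? _]; lia. }
    apply ok_seq_asg; [lia|]; intros Hwf3.
    assert (Ek : ev W ((if side then Aval else Bval) (Mem (cell (if side then 1 else 2) (Var 39)))) s3
       = ky side (sg side (j * sz))).
    { apply ev_key; auto; [|apply sg_lt; auto]. apply ev_perm; auto. }
    assert (Eo : forall x, ev W (if side then Cst 0 else Var 34) (setV s3 32 x) = ofs side k).
    { intros x. destruct side; [apply (ev_cst W HW 0); lia|exact V34]. }
    assert (Eo3 : ev W (if side then Cst 0 else Var 34) s3 = ofs side k).
    { destruct side; [apply (ev_cst W HW 0); lia|exact V34]. }
    assert (HkW : ky side (sg side (j * sz)) < W) by (rewrite <- Ek; apply ev_lt; [lia|]; apply Hwf3).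
    assert (HoW : ofs side k < W) by (destruct side; unfold ofs; lia).
    set (x := ev W (Bin Add _ _) s3).
    assert (Ex : x = (ky side (sg side (j * sz)) + ofs side k) mod W).
    { unfold x. cbn [ev bopev]. now rewrite Eo3, Ek. }
    set (s4 := setV s3 32 x).
    assert (C2 : ev W (Bin Lt (Var 32) (if side then Cst 0 else Var 34)) s4 = if x <? ofs side k then 1 else 0).
    { apply ev_lt_op; [lia|reflexivity|apply Eo]. }
    assert (Hv0 : v0 < W) by (rewrite <- V41; apply Hwf1).
    destruct (mod_overflow _ _ HkW HoW) as [[O1 O2]|[O1 O2]]; rewrite <- Ex in O1; try rewrite <- Ex in O2.
    + apply ok_if; [lia| |]; rewrite C2; intros Hc2; destruct (Nat.ltb_spec x (ofs side k)); try lia.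
      apply ok_skip. apply Hno; auto. intros [_ ?]; lia.
    + apply ok_if; [lia| |]; rewrite C2; intros Hc2; destruct (Nat.ltb_spec x (ofs side k)); try lia.
      assert (C3 : ev W (Bin Lt (Var 41) (Var 32)) s4 = if v0 <? x then 1 else 0).
      { apply ev_lt_op; [lia|exact V41|reflexivity]. }
      apply ok_if; [lia| |]; rewrite C3; intros Hc3; destruct (Nat.ltb_spec v0 x); try lia.
      * apply ok_skip. apply Hno; auto. intros [_ ?]; lia.
      * apply ok_asg. split; [exact I1|]. change (ev W (Var 39) s4) with (j * sz).
        stsimp. split; [auto|].
        intros p Hp Hcp Hp'. destruct (Nat.eq_dec p j) as [->|]; auto.
        exfalso. apply (Hp' j); [lia|]. split; auto. lia.
  - intros s1 (I1 & I2 & I3) _ _. split; auto. split; auto.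
    intros p Hp Hc Hp'. apply I3.
    + apply (Nat.mul_lt_mono_pos_r sz); lia.
    + split; auto.
    + intros p' Hpp [? ?]. specialize (Hp' p' ltac:(lia) ltac:(auto)). lia.
  Unshelve. all: destruct side; cbn [ecost Aval Bval cell region]; lia.
Qed.

Lemma valx_le side k x : x <= k -> x < m -> k - x < m -> valx side k x <= skew_conv n A B k.
Proof.
  unfold m; intros H1 H2 H3. destruct side; cbn [valx]; apply skew_conv_ge; lia.
Qed.

Lemma pair_ok s k i j : Env s -> Data s -> V s 34 = k -> V s 44 = i -> V s 45 = j ->
  i < m -> j < m -> k <= 2 * n ->
  ok W (Seq (Asg 35 (Aval (Var 44))) (Seq (Asg 36 (Bval (Var 45))) cand)) s 130 (fun s' =>
    out s' k = Nat.max (out s k) (Nat.min (A i) (B j + k)) /\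
    forall x, x <> n + n + 3 + k -> M s' x = M s x).
Proof.
  intros HE HDt Hk Hi Hj Him Hjm Hkn.
  eapply ok_weaken; [lia| |shelve|intros s' _ _ Hq; exact Hq].
  apply ok_seq_asg; [lia|]; intros _. rewrite (ev_Aval _ _ i) by auto.
  set (s1 := setV s 35 (A i)).
  apply ok_seq_asg; [lia|]; intros _.
  rewrite (ev_Bval _ s1 j); [|apply HE|split; apply HDt|exact Hj|auto].
  apply (cand_ok (setV s1 36 (B j)) k (A i) (B j)); auto. apply HE.
  Unshelve. cbn [ecost Aval Bval]. lia.
Qed.

Lemma scan_block_ok (side : bool) s k b :
  Env s -> Data s -> below s -> V s 34 = k -> V s 43 = b -> b < m -> k <= 2 * n ->
  ok W (scan_block side) s (sz * 200 + 20) (fun s' =>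
    Data s' /\ below s' /\ out s k <= out s' k /\
    (forall x, x <> n + n + 3 + k -> M s' x = M s x) /\
    forall t, t < sz -> b + t < m -> sg side (b + t) <= k -> k - sg side (b + t) < m ->
      valx side k (sg side (b + t)) <= out s' k).
Proof.
  intros HE HDt Hbl Hk Hb Hbm Hkn.
  eapply ok_weaken; [lia| |shelve|intros s' _ _ Hq; exact Hq]. unfold scan_block.
  assert (szg : sz <= U) by lia.
  apply ok_for_n with (n := sz) (T := 190) (I := fun j s1 =>
    Data s1 /\ below s1 /\ out s k <= out s1 k /\
    (forall x, x <> n + n + 3 + k -> M s1 x = M s x) /\
    forall t, t < j -> b + t < m -> sg side (b + t) <= k -> k - sg side (b + t) < m ->
      valx side k (sg side (b + t)) <= out s1 k).
  - lia.
  - apply HE.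
  - split; [auto|]. split; [auto|]. split; [lia|]. split; [auto|lia].
  - intros j s1 Hj (I1 & I2 & I3 & I4 & I5) Hwf1 Hfr1.
    assert (L1 : forall y, y < 16 -> V s1 y = V s y).
    { eapply low_regs; [|exact Hfr1]. destruct side; reflexivity. }
    assert (V34 : V s1 34 = k) by (rewrite Hfr1; [exact Hk|destruct side; reflexivity]).
    assert (V43 : V s1 43 = b) by (rewrite Hfr1; [exact Hb|destruct side; reflexivity]).
    assert (HE1 : Env s1) by (eapply Env_frame; eauto).
    assert (Hno : forall s', M s' = M s1 ->
       (b + j < m -> sg side (b + j) <= k -> k - sg side (b + j) < m -> False) ->
       Data s' /\ below s' /\ out s k <= out s' k /\
       (forall x, x <> n + n + 3 + k -> M s' x = M s x) /\
       forall t, t < S j -> b + t < m -> sg side (b + t) <= k -> k - sg side (b + t) < m ->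
         valx side k (sg side (b + t)) <= out s' k).
    { intros s' HM Hf. unfold below, out. rewrite HM.
      split; [split; rewrite HM; apply I1|]. split; [exact I2|]. split; [exact I3|].
      split; [exact I4|]. intros t Ht H1 H2 H3.
      destruct (Nat.eq_dec t j) as [->|]; [exfalso; auto|]. apply I5; auto; lia. }
    eapply ok_weaken; [lia| |shelve|intros s' _ _ Hq'; exact Hq'].
    apply ok_seq_asg; [lia|]; intros _.
    set (s2 := setV s1 38 j).
    assert (E1 : ev W (Bin Add (Var 43) (Var 38)) s2 = b + j).
    { apply ev_add; [lia|exact V43|reflexivity|lia]. }
    rewrite E1. set (s3 := setV s2 40 _).
    assert (HE3 : Env s3) by (split; apply HE1).
    assert (HD3 : Data s3) by (split; apply I1).
    assert (C1 : ev W (Bin Lt (Var 40) (Var 1)) s3 = if b + j <? m then 1 else 0).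
    { apply ev_lt_op; [lia|reflexivity|apply HE3]. }
    apply ok_if; [lia| |]; rewrite C1; intros Hc;
      destruct (Nat.ltb_spec (b + j) m) as [Hjm|Hjm]; try lia.
    2:{ apply ok_skip. apply Hno; auto. lia. }
    apply ok_seq_asg; [lia|]; intros Hwf3.
    rewrite (ev_perm side _ s3 (b + j)) by auto.
    pose proof (sg_lt side (b + j) Hjm) as Hx. set (x := sg side (b + j)) in *.
    set (own := if side then 44 else 45). set (oth := if side then 45 else 44).
    assert (Hown : own <> oth /\ 40 < own /\ 40 < oth) by (destruct side; unfold own, oth; lia).
    set (s4 := setV s3 own x).
    assert (V4o : V s4 own = x) by (unfold s4; cbn [V setV]; apply upd_eq).
    assert (V4 : forall y, y <= 40 -> V s4 y = V s3 y).
    { intros y Hy. unfold s4; cbn [V setV]; apply upd_neq; lia. }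
    assert (C2 : ev W (Bin Lt (Var 34) (Var own)) s4 = if k <? x then 1 else 0).
    { apply ev_lt_op; [lia| |exact V4o]. cbn [ev]. rewrite V4 by lia. exact V34. }
    apply ok_if; [lia| |]; rewrite C2; intros Hc2; destruct (Nat.ltb_spec k x) as [Hkx|Hkx]; try lia.
    + apply ok_skip. apply Hno; auto. lia.
    + apply ok_seq_asg; [lia|]; intros _.
      assert (E2 : ev W (Bin Sub (Var 34) (Var own)) s4 = k - x).
      { apply ev_sub; [lia| |exact V4o|lia]. cbn [ev]. rewrite V4 by lia. exact V34. }
      rewrite E2. set (s5 := setV s4 oth _).
      assert (V5o : V s5 own = x) by (unfold s5; cbn [V setV]; rewrite upd_neq by lia; exact V4o).
      assert (V5t : V s5 oth = k - x) by (unfold s5; cbn [V setV]; apply upd_eq).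
      assert (V5 : forall y, y <= 40 -> V s5 y = V s3 y).
      { intros y Hy. unfold s5; cbn [V setV]; rewrite upd_neq by lia. auto. }
      assert (HE5 : Env s5) by (eapply Env_frame; [|exact HE3]; intros; apply V5; lia).
      assert (HD5 : Data s5) by (split; apply I1).
      assert (C3 : ev W (Bin Lt (Var 0) (Var oth)) s5 = if n <? k - x then 1 else 0).
      { apply ev_lt_op; [lia|apply HE5|exact V5t]. }
      apply ok_if; [lia| |]; rewrite C3; intros Hc3; destruct (Nat.ltb_spec n (k - x)) as [Hnk|Hnk]; try lia.
      * apply ok_skip. apply Hno; auto. unfold m. lia.
      * assert (G : ok W (Seq (Asg 35 (Aval (Var 44))) (Seq (Asg 36 (Bval (Var 45))) cand)) s5 130 (fun s' =>
          out s' k = Nat.max (out s5 k) (valx side k x) /\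
          forall x, x <> n + n + 3 + k -> M s' x = M s5 x)).
        { assert (V534 : V s5 34 = k) by (rewrite V5 by lia; exact V34).
          unfold own, oth in *. destruct side; cbn [valx]; apply pair_ok; auto; unfold m; lia. }
        eapply ok_weaken; [lia|exact G|apply le_n|]. clear G.
        intros s6 _ _ (G1 & G2). change (M s5) with (M s1) in *. change (out s5) with (out s1) in *.
        pose proof (valx_le side k x Hkx Hx ltac:(unfold m; lia)) as Hval.
        split; [eapply Data_out; [|exact I1]; intros a Ha; apply G2; lia|].
        split.
        { intros k' Hk'. destruct (Nat.eq_dec k' k) as [->|Hne].
          - rewrite G1. apply Nat.max_lub; auto.
          - unfold out. rewrite G2 by lia. apply I2; auto. }
        split; [lia|]. split.
        { intros y Hy. rewrite G2 by auto. auto. }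
        intros t Ht H1 H2 H3. destruct (Nat.eq_dec t j) as [->|].
        { fold x. lia. }
        rewrite G1. specialize (I5 t ltac:(lia) H1 H2 H3). lia.
  - intros s1 H _ _. exact H.
  Unshelve. all: destruct side; cbn [ecost cell region]; lia.
Qed.

Definition top_block side k v0 p :=
  p * sz < m /\ ky side (sg side (p * sz)) + ofs side k <= v0 /\
  forall p', p < p' -> p' * sz < m -> v0 < ky side (sg side (p' * sz)) + ofs side k.

Lemma scan_ok (side : bool) s k v0 :
  Env s -> Data s -> below s -> V s 34 = k -> V s 41 = v0 -> k <= 2 * n ->
  ok W (scan side) s ((g + sz) * 200 + 50) (fun s' =>
    Data s' /\ below s' /\ out s k <= out s' k /\
    (forall x, x <> n + n + 3 + k -> M s' x = M s x) /\
    forall p r, top_block side k v0 p -> p * sz <= r < p * sz + sz -> r < m ->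
      sg side r <= k -> k - sg side r < m -> valx side k (sg side r) <= out s' k).
Proof.
  intros HE HDt Hbl Hk Hv Hkn.
  eapply ok_weaken; [lia| |shelve|intros s' _ _ Hq; exact Hq]. unfold scan.
  apply ok_seq_asg; [lia|]; intros _. rewrite (ev_cst W HW 0) by lia.
  set (s1 := setV s 43 0).
  apply ok_seq; [lia|].
  eapply ok_weaken; [lia|apply (find_block_ok side s1 k v0); auto|apply le_n|].
  { split; apply HE. }
  { split; apply HDt. }
  intros s2 Hwf2 Hfr2 (F1 & F2 & F3). change (M s1) with (M s) in F1.
  assert (L2 : forall y, y < 16 -> V s2 y = V s1 y).
  { eapply low_regs; [|exact Hfr2]. destruct side; reflexivity. }
  eapply ok_weaken; [lia|apply (scan_block_ok side s2 k (V s2 43)); auto|apply le_n|].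
  { eapply Env_frame; [exact L2|]. split; apply HE. }
  { split; rewrite F1; apply HDt. }
  { intros k' Hk'. unfold out. rewrite F1. apply Hbl; auto. }
  { rewrite Hfr2; [exact Hk|destruct side; reflexivity]. }
  intros s3 _ _ (G1 & G2 & G3 & G4 & G5). unfold out in G3. rewrite F1 in *.
  split; auto. split; auto. split; auto. split; [auto|].
  intros p r (T1 & T2 & T3) Hr Hrm H1 H2.
  rewrite (F3 p T1 T2 T3) in G5. specialize (G5 (r - p * sz)).
  replace (p * sz + (r - p * sz)) with r in G5 by lia. apply G5; auto; lia.
  Unshelve. cbn [ecost]. lia.
Qed.

Lemma exists_rank side x : x < m -> exists r, r < m /\ sg side r = x.
Proof. intros Hx. destruct side; [apply PA|apply PB]; auto. Qed.

Lemma ky_sorted side r r' : r <= r' -> r' < m -> ky side (sg side r) <= ky side (sg side r').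
Proof. destruct side; [apply A_sorted|apply B_sorted]. Qed.

(* If the block-level bound [v0] misses the pair (i, j), then the block of one of the two ranks
   is the last one starting at most at [v0], and scanning that block finds the pair. *)
Lemma final_cover s v0 k x1 x2 :
  (forall p q, p < g -> q < g -> cov s p q) -> v0 = out s k -> k <= 2 * n ->
  (forall side p r, top_block side k v0 p -> p * sz <= r < p * sz + sz -> r < m ->
      sg side r <= k -> k - sg side r < m -> valx side k (sg side r) <= x2) ->
  v0 <= x1 -> x1 <= x2 -> skew_conv n A B k <= x2.
Proof.
  intros Hcov Hv0 Hkn Hscan H01 H12. apply skew_conv_le. intros i j Hi Hj Hij.
  destruct (Nat.le_gt_cases (Nat.min (A i) (B j + k)) v0) as [Hle|Hgt]; [lia|].
  destruct (exists_rank true i ltac:(unfold m; lia)) as (r & Hr & Er).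
  destruct (exists_rank false j ltac:(unfold m; lia)) as (r' & Hr' & Er').
  assert (Hblk : forall r, r < m -> r / sz < g /\ r / sz * sz <= r < r / sz * sz + sz).
  { intros y Hy. split; [apply Nat.Div0.div_lt_upper_bound; lia|].
    pose proof (Nat.div_mod y sz ltac:(lia)). pose proof (Nat.mod_upper_bound y sz ltac:(lia)). lia. }
  destruct (Hblk r Hr) as [Hp1 Hp2]. destruct (Hblk r' Hr') as [Hq1 Hq2].
  set (p := r / sz) in *. set (q := r' / sz) in *.
  (* The block minima give at most [v0] although the pair itself exceeds it, so on one side the keys
     cross [v0] inside the block. *)
  pose proof (Hcov p q Hp1 Hq1 r r' ltac:(lia) ltac:(lia)) as Hc.
  cbn [sg] in Er, Er'. rewrite Er, Er', Hij, <- Hv0 in Hc.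
  (* A later block starts at a rank beyond [r0], so by sortedness its first key is above [v0] as
     well. *)
  assert (Htop : forall side p r, r < m -> p * sz <= r < p * sz + sz ->
     ky side (sg side (p * sz)) + ofs side k <= v0 -> v0 < ky side (sg side r) + ofs side k ->
     top_block side k v0 p).
  { intros side p0 r0 Hr0 Hpr H1 H2. split; [lia|]. split; auto. intros p' Hp' Hpm.
    assert (r0 <= p' * sz) by (pose proof (Nat.mul_le_mono_r (S p0) p' sz ltac:(lia)); lia).
    pose proof (ky_sorted side r0 (p' * sz) ltac:(lia) Hpm). lia. }
  destruct (Nat.le_gt_cases (A (sA (p * sz))) v0) as [Ha|Ha].
  - assert (Hv : valx true k i <= x2).
    { rewrite <- Er. apply (Hscan true p r); cbn [sg]; rewrite ?Er; auto; try (unfold m; lia).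
      apply (Htop true p r); auto; cbn [ky sg ofs]; rewrite ?Er; lia. }
    cbn [valx] in Hv. replace (k - i) with j in Hv by lia. exact Hv.
  - assert (Hv : valx false k j <= x2).
    { rewrite <- Er'. apply (Hscan false q r'); cbn [sg]; rewrite ?Er'; auto; try (unfold m; lia).
      apply (Htop false q r'); auto; cbn [ky sg ofs]; rewrite ?Er'; lia. }
    cbn [valx] in Hv. replace (k - j) with i in Hv by lia. exact Hv.
Qed.

Lemma finish_ok s : Env s -> Data s -> below s -> (forall p q, p < g -> q < g -> cov s p q) ->
  ok W finish s ((2 * n + 1) * ((g + sz) * 400 + 200) + 20) (fun s' =>
    forall k, k <= 2 * n -> out s' k = skew_conv n A B k).
Proof.
  intros HE HDt Hbl Hcov.
  eapply ok_weaken; [lia| |shelve|intros s' _ _ Hq; exact Hq]. unfold finish.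
  apply ok_for_n with (n := 2 * n + 1) (T := (g + sz) * 400 + 190) (I := fun j s1 =>
    Data s1 /\ below s1 /\ (forall k, j <= k -> k <= 2 * n -> out s1 k = out s k) /\
    forall k, k < j -> out s1 k = skew_conv n A B k).
  - lia.
  - apply ev_outcount, HE.
  - split; [auto|]. split; [auto|]. split; [auto|lia].
  - intros k s1 Hk (I1 & I2 & I3 & I4) Hwf1 Hfr1.
    assert (L1 : forall y, y < 16 -> V s1 y = V s y).
    { eapply low_regs; [|exact Hfr1]. reflexivity. }
    assert (HE1 : Env s1) by (eapply Env_frame; eauto).
    eapply ok_weaken; [lia| |shelve|intros s' _ _ Hq'; exact Hq'].
    apply ok_seq_asg; [lia|]; intros _.
    set (s2 := setV s1 34 k).
    assert (E1 : ev W (Mem (outcell (Var 34))) s2 = out s k).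
    { rewrite <- (I3 k) by lia. eapply ev_load; [lia| |reflexivity].
      apply ev_outcell; [apply HE1|reflexivity|lia]. }
    rewrite E1. set (s3 := setV s2 41 _).
    apply ok_seq; [lia|].
    eapply ok_weaken; [lia|apply (scan_ok true s3 k (out s k)); auto; try lia|apply le_n|].
    { split; apply HE1. }
    { split; apply I1. }
    intros s4 Hwf4 Hfr4 (A1 & A2 & A3 & A4 & A5).
    assert (L4 : forall y, y < 16 -> V s4 y = V s3 y).
    { eapply low_regs; [|exact Hfr4]. reflexivity. }
    change (out s3) with (out s1) in *. change (M s3) with (M s1) in *.
    eapply ok_weaken; [lia|apply (scan_ok false s4 k (out s k)); auto; try lia|apply le_n|].
    { eapply Env_frame; [exact L4|]. split; apply HE1. }
    intros s5 _ _ (B1 & B2 & B3 & B4 & B5).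
    assert (Hother : forall k', k' <> k -> out s5 k' = out s1 k').
    { intros k' Hne. unfold out. rewrite B4, A4; auto; lia. }
    split; [auto|]. split; [auto|]. split.
    { intros k' H1 H2. rewrite Hother by lia. apply I3; lia. }
    intros k' Hk'. destruct (Nat.eq_dec k' k) as [->|]; [|rewrite Hother by lia; apply I4; lia].
    apply Nat.le_antisymm; [apply B2; lia|].
    (* The pairs found by the scan of A are recorded before the scan of B begins; since the output
       only grows, their values persist. *)
    apply (final_cover s (out s k) k (out s4 k)); auto; try lia.
    + intros [|] p r H1 H2 H3 H4 H5; [|eapply B5; eauto].
      eapply Nat.le_trans; [eapply A5; eauto|exact B3].
    + rewrite <- (I3 k) by lia. exact A3.
  - intros s1 (_ & _ & _ & I4) _ _. intros k Hk. apply I4; lia.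
  Unshelve. all: cbn [ecost outcell]; lia.
Qed.

End Main.

(** * Parameters and running time *)

(** The parameters are found by guarded loops of [m] rounds, as there are neither while loops nor
    powers. The region size in register 2 covers the longest convolution array, the trees with
    [2 * 2 ^ l <= 4 * m] nodes, and input plus output. *)
Definition init :=
  Seq (Asg 0 (Mem (Cst 0))) (Seq (Asg 1 (Bin Add (Var 0) (Cst 1)))
  (Seq (Asg 3 (Cst 0)) (Seq (Asg 4 (Cst 1)) (Seq (Asg 5 (Cst 1)) (Seq (Asg 6 (Cst 1))
  (Seq (Asg 8 (Cst 0)) (Seq (Asg 9 (Cst 1))
  (Seq (For 16 (Var 1) (If (Bin Lt (Var 4) (Var 1))
     (Seq (Asg 3 (Bin Add (Var 3) (Cst 1)))
     (Seq (Asg 4 (Bin Mul (Cst 16) (Var 4))) (Asg 5 (Bin Mul (Cst 31) (Var 5))))) Skip))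
  (Seq (For 16 (Var 1) (If (Bin Lt (Bin Mul (Bin Mul (Var 6) (Var 6)) (Bin Mul (Var 6) (Var 6))) (Var 1))
     (Asg 6 (Bin Add (Var 6) (Cst 1))) Skip))
  (Seq (For 16 (Var 1) (If (Bin Lt (Var 9) (Var 1))
     (Seq (Asg 8 (Bin Add (Var 8) (Cst 1))) (Asg 9 (Bin Mul (Cst 2) (Var 9)))) Skip))
  (Seq (Asg 7 (Bin Add (Bin Div (Var 1) (Var 6)) (Cst 1)))
       (Asg 2 (Bin Add (Bin Add (Bin Mul (Cst 2) (Var 5)) (Bin Mul (Cst 4) (Var 1))) (Cst 8)))
  ))))))))))).

Definition main_cmd :=
  Seq init (Seq (tsort 3 1 (Cst 0)) (Seq (tsort 4 2 (Var 1)) (Seq (all_pairs lagrange) finish))).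

Definition minimal_pow b e m := m <= b ^ e /\ (e = 0 \/ b ^ (e - 1) < m).

Lemma minimal_pow_le b e m : 0 < b -> 0 < m -> minimal_pow b e m -> b ^ e <= b * m.
Proof.
  intros Hb Hm [_ [->|H]]; [simpl; nia|].
  destruct e; [simpl; nia|]. rewrite Nat.pow_succ_r'.
  replace (S e - 1) with e in H by lia. nia.
Qed.

(** The numerical fact is [31 ^ 4 = 923521 <= 1048576 = 16 ^ 5]. *)
Lemma pow31_bound e x : 16 ^ e <= x -> (31 ^ e) ^ 4 <= x ^ 5.
Proof.
  intros H. apply Nat.le_trans with ((16 ^ e) ^ 5); [|now apply Nat.pow_le_mono_l].
  rewrite <- !Nat.pow_mul_r, (Nat.mul_comm e 4), (Nat.mul_comm e 5), !Nat.pow_mul_r.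
  apply Nat.pow_le_mono_l. apply Nat.leb_le. vm_compute. reflexivity.
Qed.

Lemma pow_ge_self x k : 0 < k -> x <= x ^ k.
Proof.
  intros Hk. destruct x; [lia|]. rewrite <- (Nat.pow_1_r (S x)) at 1. apply Nat.pow_le_mono_r; lia.
Qed.

(** * Computing the parameters without overflow *)

Section Init.
Variables (W n : nat).
Let m := n + 1.
Let N := n + 2.
Hypothesis HWN : N ^ 40 <= W.

Lemma N_pow a b : a <= b -> N ^ a <= N ^ b.
Proof. intros; apply Nat.pow_le_mono_r; lia. Qed.

(** As [N >= 2], numerical constants are absorbed into powers of [N], whatever [n] is; the explicit
    exponents of the word-size bounds arise this way. *)
Lemma two_pow_N k : 2 ^ k <= N ^ k.
Proof. apply Nat.pow_le_mono_l; lia. Qed.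

Lemma m16_N : 16 * m <= N ^ 5.
Proof.
  pose proof (two_pow_N 4). change (N ^ 5) with (N * N ^ 4). change (2 ^ 4) with 16 in *.
  unfold m, N in *. nia.
Qed.

Lemma W_large : 1000 < W.
Proof.
  apply Nat.lt_le_trans with (N ^ 10); [|eapply Nat.le_trans; [apply N_pow|exact HWN]; lia].
  eapply Nat.lt_le_trans; [|apply two_pow_N]. apply Nat.ltb_lt; reflexivity.
Qed.

Lemma e31_N e : 16 ^ e <= 16 * m -> 31 ^ e <= N ^ 25.
Proof.
  intros H. apply Nat.le_trans with ((31 ^ e) ^ 4); [apply pow_ge_self; lia|].
  apply pow31_bound in H. eapply Nat.le_trans; [exact H|].
  change 25 with (5 * 5). rewrite Nat.pow_mul_r. apply Nat.pow_le_mono_l, m16_N.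
Qed.

(** The factor 16 keeps the addresses of all memory regions below [W]. *)
Lemma U_W e : 16 ^ e <= 16 * m -> 16 * (2 * 31 ^ e + 4 * m + 8) <= W.
Proof.
  intros H. apply e31_N in H.
  apply Nat.le_trans with (N ^ 35); [|eapply Nat.le_trans; [apply N_pow|exact HWN]; lia].
  change 35 with (25 + 10). rewrite Nat.pow_add_r.
  pose proof (two_pow_N 9) as H9. change (2 ^ 9) with 512 in H9.
  assert (HmN : m <= N ^ 25).
  { apply Nat.le_trans with (N ^ 1); [rewrite Nat.pow_1_r; unfold m, N; lia|apply N_pow; lia]. }
  assert (1 <= N ^ 25) by (pose proof (N_pow 0 25); simpl in *; lia).
  change (N ^ 10) with (N * N ^ 9). assert (2 <= N) by (unfold N; lia).
  assert (H10 : 1024 <= N * N ^ 9) by nia.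
  apply (Nat.mul_le_mono_l _ _ (N ^ 25)) in H10. lia.
Qed.

Lemma init_ok s : M s 0 = n ->
  ok W init s (400 * m + 400) (fun s' => M s' = M s /\ exists d g l,
    V s' 0 = n /\ V s' 1 = m /\ V s' 2 = 2 * 31 ^ d + 4 * m + 8 /\ V s' 3 = d /\ V s' 4 = 16 ^ d /\
    V s' 5 = 31 ^ d /\ V s' 6 = g /\ V s' 7 = m / g + 1 /\ V s' 8 = l /\ V s' 9 = 2 ^ l /\
    minimal_pow 16 d m /\ minimal_pow 2 l m /\ 1 <= g /\ m <= g ^ 4 /\ (g - 1) ^ 4 < m).
Proof.
  intros HM0. pose proof W_large as HW. pose proof m16_N as H16.
  assert (Hm0 : 0 < m) by (unfold m; lia).
  assert (HmW : 16 * m < W).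
  { eapply Nat.le_lt_trans; [exact H16|]. eapply Nat.lt_le_trans; [|exact HWN].
    apply Nat.pow_lt_mono_r; unfold N; lia. }
  assert (Hm4 : m * m * (m * m) < W).
  { apply Nat.lt_le_trans with (N ^ 5); [|eapply Nat.le_trans; [apply N_pow|exact HWN]; lia].
    assert (HN : N ^ 4 < N ^ 5) by (apply Nat.pow_lt_mono_r; unfold N; lia).
    apply Nat.le_lt_trans with (N ^ 4); [|exact HN].
    replace (m * m * (m * m)) with (m ^ 4) by (simpl; lia).
    apply Nat.pow_le_mono_l. unfold m, N; lia. }
  eapply ok_weaken; [lia| |shelve|intros s' _ _ Hq; exact Hq]. unfold init.
  apply ok_seq_asg; [lia|]; intros _.
  assert (E0 : ev W (Mem (Cst 0)) s = n).
  { eapply ev_load; [lia|apply ev_cst; lia|exact HM0]. }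
  rewrite E0. set (s0 := setV s 0 n).
  apply ok_seq_asg; [lia|]; intros _.
  assert (E1 : ev W (Bin Add (Var 0) (Cst 1)) s0 = m).
  { apply ev_add; [lia|reflexivity|apply ev_cst; lia|unfold m in *; lia]. }
  rewrite E1. set (s1 := setV s0 1 m).
  do 6 (apply ok_seq_asg; [lia|]; intros _).
  rewrite !(ev_cst W) by lia.
  match goal with |- ok _ _ ?x _ _ => set (s2 := x) end.
  apply ok_seq; [lia|].
  (* The second disjunct measures progress: until [m] is reached, the power is at least [k + 1], so
     [m] rounds suffice. *)
  apply ok_for_n with (n := m) (T := 40) (I := fun k s3 => M s3 = M s /\
    exists d, V s3 3 = d /\ V s3 4 = 16 ^ d /\ V s3 5 = 31 ^ d /\ (m <= 16 ^ d \/ k + 1 <= 16 ^ d) /\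
      (d = 0 \/ 16 ^ (d - 1) < m)).
  - lia.
  - reflexivity.
  - split; auto. exists 0. repeat split; auto.
  - intros k s3 Hk (I0 & d & I1 & I2 & I3 & I4 & I5) Hwf3 Hfr3.
    assert (V1 : V s3 1 = m) by (rewrite Hfr3 by reflexivity; reflexivity).
    set (s4 := setV s3 16 k).
    assert (C1 : ev W (Bin Lt (Var 4) (Var 1)) s4 = if 16 ^ d <? m then 1 else 0).
    { apply ev_lt_op; [lia|exact I2|exact V1]. }
    eapply ok_weaken; [lia| |shelve|intros s' _ _ Hq; exact Hq].
    apply ok_if; [lia| |]; rewrite C1; intros Hc; destruct (Nat.ltb_spec (16 ^ d) m) as [Hdm|Hdm]; try lia.
    (* The guard [16 ^ d < m] bounds the next power by [16 * m], so even [31 ^ S d] fits into a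
       word. *)
    + assert (Hd31 : 16 * (2 * 31 ^ S d + 4 * m + 8) <= W).
      { apply U_W. rewrite Nat.pow_succ_r'. lia. }
      rewrite Nat.pow_succ_r' in Hd31. assert (HdW : d < 16 ^ d) by (apply Nat.pow_gt_lin_r; lia).
      apply ok_seq_asg; [lia|]; intros _.
      assert (X1 : ev W (Bin Add (Var 3) (Cst 1)) s4 = d + 1).
      { apply ev_add; [lia|exact I1|apply ev_cst; lia|lia]. }
      rewrite X1. set (s5 := setV s4 3 _).
      apply ok_seq_asg; [lia|]; intros _.
      assert (X2 : ev W (Bin Mul (Cst 16) (Var 4)) s5 = 16 * 16 ^ d).
      { apply ev_mul; [lia|apply ev_cst; lia|exact I2|lia]. }
      rewrite X2. set (s6 := setV s5 4 _).
      apply ok_asg.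
      assert (X3 : ev W (Bin Mul (Cst 31) (Var 5)) s6 = 31 * 31 ^ d).
      { apply ev_mul; [lia|apply ev_cst; lia|exact I3|lia]. }
      rewrite X3. split; [exact I0|]. exists (S d). rewrite !Nat.pow_succ_r'.
      split; [change (d + 1 = S d); lia|]. split; [reflexivity|]. split; [reflexivity|].
      split; [lia|]. right. now replace (S d - 1) with d by lia.
    + apply ok_skip. split; [exact I0|]. exists d. repeat split; auto.
  - intros s3 (I0 & d & I1 & I2 & I3 & I4 & I5) _ Hfr3.
    assert (V1 : V s3 1 = m) by (rewrite Hfr3 by reflexivity; reflexivity).
    assert (V0 : V s3 0 = n) by (rewrite Hfr3 by reflexivity; reflexivity).
    assert (Hmin : minimal_pow 16 d m) by (split; lia). clear I4 I5.
    apply ok_seq; [lia|].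
    (* [(g - 1) ^ 4 < m] yields [g <= m], so the fourth power in the guard does not wrap. *)
    apply ok_for_n with (n := m) (T := 40) (I := fun k s4 => M s4 = M s /\
      exists g, V s4 6 = g /\ 1 <= g /\ (m <= g ^ 4 \/ k + 1 <= g) /\ (g - 1) ^ 4 < m).
    + lia.
    + exact V1.
    + split; auto. exists 1. split; [rewrite Hfr3 by reflexivity; reflexivity|].
      split; [lia|]. split; [lia|]. simpl; lia.
    + intros k s4 Hk (J0 & g & J1 & J2 & J3 & J4) Hwf4 Hfr4.
      assert (W1 : V s4 1 = m) by (rewrite Hfr4 by reflexivity; exact V1).
      assert (Hgm : g <= m) by (pose proof (pow_ge_self (g - 1) 4 ltac:(lia)); lia).
      assert (Hgg : g * g <= m * m) by nia.
      assert (Hg4 : g * g * (g * g) <= m * m * (m * m)) by (apply Nat.mul_le_mono; auto).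
      assert (Hpow : g ^ 4 = g * g * (g * g)) by (simpl; lia).
      set (s5 := setV s4 16 k).
      assert (Y1 : ev W (Bin Mul (Var 6) (Var 6)) s5 = g * g).
      { apply ev_mul; [lia|exact J1|exact J1|nia]. }
      assert (C1 : ev W (Bin Lt (Bin Mul (Bin Mul (Var 6) (Var 6)) (Bin Mul (Var 6) (Var 6))) (Var 1)) s5 =
         if g ^ 4 <? m then 1 else 0).
      { apply ev_lt_op; [lia| |exact W1]. rewrite Hpow. apply ev_mul; [lia|exact Y1|exact Y1|lia]. }
      eapply ok_weaken; [lia| |shelve|intros s' _ _ Hq; exact Hq].
      apply ok_if; [lia| |]; rewrite C1; intros Hc; destruct (Nat.ltb_spec (g ^ 4) m) as [Hdm|Hdm]; try lia.
      * apply ok_asg.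
        assert (X1 : ev W (Bin Add (Var 6) (Cst 1)) s5 = g + 1).
        { apply ev_add; [lia|exact J1|apply ev_cst; lia|lia]. }
        rewrite X1. split; [exact J0|]. exists (g + 1). split; [reflexivity|]. split; [lia|].
        split; [lia|]. now rewrite Nat.add_sub.
      * apply ok_skip. split; [exact J0|]. exists g. repeat split; auto.
    + intros s4 (J0 & g & J1 & J2 & J3 & J4) _ Hfr4.
      assert (J3' : m <= g ^ 4).
      { destruct J3 as [|J3]; auto. pose proof (pow_ge_self g 4 ltac:(lia)). lia. }
      apply ok_seq; [lia|].
      apply ok_for_n with (n := m) (T := 40) (I := fun k s5 => M s5 = M s /\
        exists l, V s5 8 = l /\ V s5 9 = 2 ^ l /\ (m <= 2 ^ l \/ k + 1 <= 2 ^ l) /\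
          (l = 0 \/ 2 ^ (l - 1) < m)).
      * lia.
      * cbn [ev]. rewrite Hfr4 by reflexivity. exact V1.
      * split; auto. exists 0. split; [rewrite Hfr4, Hfr3 by reflexivity; reflexivity|].
        split; [rewrite Hfr4, Hfr3 by reflexivity; reflexivity|]. simpl; lia.
      * intros k s5 Hk (K0 & l & K1 & K2 & K3 & K4) Hwf5 Hfr5.
        assert (W1 : V s5 1 = m) by (rewrite Hfr5, Hfr4 by reflexivity; exact V1).
        set (s6 := setV s5 16 k).
        assert (C1 : ev W (Bin Lt (Var 9) (Var 1)) s6 = if 2 ^ l <? m then 1 else 0).
        { apply ev_lt_op; [lia|exact K2|exact W1]. }
        eapply ok_weaken; [lia| |shelve|intros s' _ _ Hq; exact Hq].
        apply ok_if; [lia| |]; rewrite C1; intros Hc; destruct (Nat.ltb_spec (2 ^ l) m) as [Hdm|Hdm]; try lia.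
        -- assert (HdW : l < 2 ^ l) by (apply Nat.pow_gt_lin_r; lia).
           apply ok_seq_asg; [lia|]; intros _.
           assert (X1 : ev W (Bin Add (Var 8) (Cst 1)) s6 = l + 1).
           { apply ev_add; [lia|exact K1|apply ev_cst; lia|lia]. }
           rewrite X1. set (s7 := setV s6 8 _). apply ok_asg.
           assert (X2 : ev W (Bin Mul (Cst 2) (Var 9)) s7 = 2 * 2 ^ l).
           { apply ev_mul; [lia|apply ev_cst; lia|exact K2|lia]. }
           rewrite X2. split; [exact K0|]. exists (S l). rewrite Nat.pow_succ_r'.
           split; [change (l + 1 = S l); lia|]. split; [reflexivity|].
           split; [lia|]. right. now replace (S l - 1) with l by lia.
        -- apply ok_skip. split; [exact K0|]. exists l. repeat split; auto.
      * intros s5 (K0 & l & K1 & K2 & K3 & K4) _ Hfr5.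
        assert (V51 : V s5 1 = m) by (rewrite Hfr5, Hfr4 by reflexivity; exact V1).
        assert (V50 : V s5 0 = n) by (rewrite Hfr5, Hfr4 by reflexivity; exact V0).
        assert (V53 : V s5 3 = d) by (rewrite Hfr5, Hfr4 by reflexivity; exact I1).
        assert (V54 : V s5 4 = 16 ^ d) by (rewrite Hfr5, Hfr4 by reflexivity; exact I2).
        assert (V55 : V s5 5 = 31 ^ d) by (rewrite Hfr5, Hfr4 by reflexivity; exact I3).
        assert (V56 : V s5 6 = g) by (rewrite Hfr5 by reflexivity; exact J1).
        assert (HUW := U_W d (minimal_pow_le 16 d m ltac:(lia) Hm0 Hmin)).
        apply ok_seq_asg; [lia|]; intros _.
        assert (Hdiv : m / g <= m) by (apply Nat.Div0.div_le_upper_bound; nia).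
        assert (X7 : ev W (Bin Add (Bin Div (Var 1) (Var 6)) (Cst 1)) s5 = m / g + 1).
        { apply ev_add; [lia| |apply ev_cst; lia|lia].
          apply ev_div; [lia|exact V51|exact V56|lia]. }
        rewrite X7. set (s6 := setV s5 7 _). apply ok_asg.
        assert (X8 : ev W (Bin Add (Bin Add (Bin Mul (Cst 2) (Var 5)) (Bin Mul (Cst 4) (Var 1))) (Cst 8)) s6
           = 2 * 31 ^ d + 4 * m + 8).
        { apply ev_add; [lia| |apply ev_cst; lia|lia]. apply ev_add; [lia| | |lia].
          - apply ev_mul; [lia|apply ev_cst; lia|exact V55|lia].
          - apply ev_mul; [lia|apply ev_cst; lia|exact V51|lia]. }
        rewrite X8. split; [exact K0|]. exists d, g, l.
        unfold s6; stsimp. repeat (split; [first [assumption|reflexivity]|]).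
        split; [split; lia|]. auto.
  Unshelve. all: cbn [ecost]; lia.
Qed.

End Init.

Lemma wf_init W n A B : (forall i, i <= n -> A i < W) -> (forall j, j <= n -> B j < W) -> n < W ->
  wf W (St (fun _ => 0) (input_mem n A B)).
Proof.
  intros HA HB Hn. split; simpl; [lia|]. intros a. unfold input_mem.
  destruct (Nat.eqb_spec a 0); auto.
  destruct (Nat.leb_spec a (S n)); [apply HA; lia|].
  destruct (Nat.leb_spec a (2 * n + 2)); [apply HB; lia|lia].
Qed.

Lemma input_zero n A B a : 2 * n + 2 < a -> input_mem n A B a = 0.
Proof.
  intros H. unfold input_mem. destruct (Nat.eqb_spec a 0); [lia|].
  destruct (Nat.leb_spec a (S n)); [lia|]. destruct (Nat.leb_spec a (2 * n + 2)); lia.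
Qed.

Lemma input_A n A B i : i < n + 1 -> input_mem n A B (1 + i) = A i.
Proof.
  intros H. unfold input_mem. destruct (Nat.eqb_spec (1 + i) 0); [lia|].
  destruct (Nat.leb_spec (1 + i) (S n)); [f_equal; lia|lia].
Qed.

Lemma input_B n A B j : j < n + 1 -> input_mem n A B (n + 2 + j) = B j.
Proof.
  intros H. unfold input_mem. destruct (Nat.eqb_spec (n + 2 + j) 0); [lia|].
  destruct (Nat.leb_spec (n + 2 + j) (S n)); [lia|].
  destruct (Nat.leb_spec (n + 2 + j) (2 * n + 2)); [f_equal; lia|lia].
Qed.

(** The summands are the parameter search, two sorts with [ecost off + 1 = 2] each, the block pairs
    and the final scans. *)
Definition total_time n d g l :=
  let m := n + 1 in let sz := m / g + 1 in
  400 * m + 400 + 4 * (1000 * (m * (l + 1)) + 100) +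
  (g * (g * (block_time * ((d + 1) * 31 ^ d) + 60) + 20) + 20) +
  ((2 * n + 1) * ((g + sz) * 400 + 200) + 20).

(** A factor [30! <= 16 ^ 27] for each of [d] levels and [(16 ^ d) ^ 2] for the count give
    [(16 ^ d) ^ 29]. With [16 ^ d <= (n + 2) ^ 5] this is at most [(n + 2) ^ 145]; one more factor
    makes the bound strict. *)
Lemma toom_word_bound W n d : (n + 2) ^ 146 <= W -> 16 ^ d <= 16 * (n + 1) ->
  (toom_den ^ Z.of_nat d * (Z.of_nat (16 ^ d) * Z.of_nat (16 ^ d)) < Z.of_nat W)%Z.
Proof.
  intros HW Hd.
  assert (H5 : 16 * (n + 1) <= (n + 2) ^ 5) by (apply (m16_N _ n (le_n _))).
  assert (H : (16 ^ d) ^ 29 < W).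
  { apply Nat.lt_le_trans with ((n + 2) ^ 146); auto.
    apply Nat.le_lt_trans with ((n + 2) ^ 145); [|apply Nat.pow_lt_mono_r; lia].
    change 145 with (5 * 29). rewrite Nat.pow_mul_r. apply Nat.pow_le_mono_l. lia. }
  apply Nat2Z.inj_lt in H. eapply Z.le_lt_trans; [|exact H].
  rewrite (Nat2Z.inj_pow (16 ^ d) 29). set (x := Z.of_nat (16 ^ d)).
  replace (x ^ Z.of_nat 29)%Z with (x ^ 27 * (x * x))%Z by (change (Z.of_nat 29) with (27 + 2)%Z; rewrite Z.pow_add_r by lia; ring).
  apply Z.mul_le_mono_nonneg_r; [unfold x; lia|].
  replace (x ^ 27)%Z with ((16 ^ 27) ^ Z.of_nat d)%Z.
  - apply Z.pow_le_mono_l. pose proof toom_den_bounds. lia.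
  - unfold x. rewrite Nat2Z.inj_pow. change (Z.of_nat 16) with 16%Z.
    rewrite <- !Z.pow_mul_r by lia. f_equal. lia.
Qed.

Lemma main_cmd_ok W n A B :
  (n + 2) ^ 146 <= W -> n < W -> wf W (St (fun _ => 0) (input_mem n A B)) ->
  exists d g l, minimal_pow 16 d (n + 1) /\ minimal_pow 2 l (n + 1) /\ 1 <= g /\
    n + 1 <= g ^ 4 /\ (g - 1) ^ 4 < n + 1 /\
    ok W main_cmd (St (fun _ => 0) (input_mem n A B)) (total_time n d g l)
      (fun s' => forall k, k <= 2 * n -> M s' (2 * n + 3 + k) = skew_conv n A B k).
Proof.
  intros HW146 HnW Hwf0.
  assert (HW40 : (n + 2) ^ 40 <= W).
  { eapply Nat.le_trans; [|exact HW146]. apply Nat.pow_le_mono_r; lia. }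
  assert (HW : 100 < W) by (pose proof (W_large W n HW40); lia).
  set (s0 := St (fun _ => 0) (input_mem n A B)) in *.
  destruct (init_ok W n HW40 s0 eq_refl Hwf0) as
    [(HM & d & g & l & V0 & V1 & V2 & V3 & V4 & V5 & V6 & V7 & V8 & V9 & Hd & Hl & Hg1 & Hg4 & Hg) Hcost].
  exists d, g, l. do 5 (split; [assumption|]).
  eapply ok_weaken; [lia| |shelve|intros s' _ _ Hq; exact Hq]. unfold main_cmd.
  assert (Hd16 : 16 ^ d <= 16 * (n + 1)) by (apply minimal_pow_le; auto; lia).
  assert (Hl2 : 2 ^ l <= 2 * (n + 1)) by (apply minimal_pow_le; auto; lia).
  assert (HU := U_W W n HW40 d Hd16).
  set (U := 2 * 31 ^ d + 4 * (n + 1) + 8) in *.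
  set (sz := (n + 1) / g + 1) in *.
  assert (Hgm : g <= n + 1) by (pose proof (pow_ge_self (g - 1) 4 ltac:(lia)); lia).
  assert (Hsz : n + 1 <= g * sz /\ g * sz + sz <= U).
  { pose proof (Nat.div_mod (n + 1) g ltac:(lia)). pose proof (Nat.mod_upper_bound (n + 1) g ltac:(lia)).
    assert ((n + 1) / g <= n + 1) by (apply Nat.Div0.div_le_upper_bound; nia).
    unfold sz. rewrite Nat.mul_add_distr_l. unfold U. lia. }
  destruct Hsz as [Hgsz HgszU].
  (* The parameters occur in the time bound and must be named outside the triple, so the state after
     [init] is fixed as a concrete term. *)
  apply ok_seq with (T1 := 400 * (n + 1) + 400); [lia|].
  apply ok_weaken with (T := 400 * (n + 1) + 400) (Q := fun s1 => s1 = exec W init s0); [lia| |lia|].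
  { intros _; split; auto. }
  intros s1 Hwf1 _ Es1. rewrite <- Es1 in *. clear Hcost.
  (* Memory beyond the input is 0, so both trees start empty. *)
  assert (HZ : forall k v, 1 <= k -> M s1 (k * U + v) = 0).
  { intros k v Hk. rewrite HM. apply input_zero. unfold U in *. nia. }
  apply ok_seq; [lia|].
  eapply ok_weaken; [lia|apply (sort_ok W U (n + 1) l 3 1 0 (Cst 0) (fun y => A (y - 1)) HW)|apply le_n|];
    auto; try lia; try apply Hl.
  { intros; apply ev_cst; lia. }
  { intros y Hy. rewrite HM. change (input_mem n A B y = A (y - 1)).
    rewrite <- (input_A n A B (y - 1)) by lia. f_equal; lia. }
  intros s2 Hwf2 Hfr2 (PA & S2). set (sA := fun r => M s2 (1 * U + r)) in *.
  assert (L2 : forall y, y < 16 -> V s2 y = V s1 y) by (eapply low_regs; [|exact Hfr2]; reflexivity).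
  apply ok_seq; [lia|].
  eapply ok_weaken; [lia|apply (sort_ok W U (n + 1) l 4 2 (n + 1) (Var 1) (fun y => B (y - 1)) HW)|apply le_n|];
    auto; try lia; try apply Hl; try (rewrite L2 by lia; assumption).
  { intros v Hv. rewrite S2; [apply HZ; lia|]. intros k [<-|[<-|[]]]; lia. }
  { intros y Hy. rewrite S2, HM; [|intros k [<-|[<-|[]]]; lia].
    change (input_mem n A B (n + 1 + y) = B (y - 1)).
    rewrite <- (input_B n A B (y - 1)) by lia. f_equal; lia. }
  intros s3 Hwf3 Hfr3 (PB & S3). set (sB := fun r => M s3 (2 * U + r)) in *.
  assert (L3 : forall y, y < 16 -> V s3 y = V s1 y).
  { intros y Hy. rewrite <- L2 by auto. revert y Hy. eapply low_regs; [|exact Hfr3]; reflexivity. }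
  assert (HE3 : Env n U d g sz s3) by (split; rewrite L3 by lia; assumption).
  assert (Hin : forall a, a < U -> M s3 a = input_mem n A B a).
  { intros a Ha. rewrite S3, S2, HM; auto; intros k [<-|[<-|[]]]; lia. }
  assert (HD3 : Data n U A B sA sB s3).
  { split.
    - intros i Hi. rewrite Hin by lia. now apply input_A.
    - intros j Hj. rewrite Hin by lia. now apply input_B.
    - intros r Hr. rewrite S3; auto. intros k [<-|[<-|[]]]; lia.
    - reflexivity. }
  assert (HT := toom_word_bound W n d HW146 Hd16).
  assert (HUn : 4 * n + 8 < U) by lia.
  assert (HdU : 2 * 31 ^ d <= U) by lia.
  assert (Hsz0 : 0 < sz) by (unfold sz; lia).
  apply ok_seq; [lia|].
  eapply ok_weaken; [lia|eapply (all_pairs_ok W n U d g sz A B sA sB HW HU HUn HdU (proj1 Hd) Hsz0 Hgsz HgszU HT PA PB s3)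
    |apply le_n|]; auto.
  (* The output cells start at 0, the trivial lower bound. *)
  { intros k Hk. unfold out. rewrite Hin by lia. rewrite input_zero by lia. lia. }
  intros s4 Hwf4 Hfr4 (D4 & Bl4 & C4).
  assert (L4 : forall y, y < 16 -> V s4 y = V s3 y) by (eapply low_regs; [|exact Hfr4]; reflexivity).
  eapply ok_weaken; [lia|apply (finish_ok W n U d g sz A B sA sB)|apply le_n|]; auto.
  { apply Hd. }
  { eapply Env_frame; eauto. }
  { intros s5 _ _ H5 k Hk. rewrite <- H5 by auto. unfold out. f_equal; lia. }
  Unshelve. unfold total_time. cbn [ecost]. generalize ((n + 1) / g). intros q. lia.
Qed.

(** * Asymptotics of the running time *)

Lemma log_bound b e n : 2 <= b -> minimal_pow b e (n + 1) -> e <= Nat.log2 (n + 2) + 1.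
Proof.
  intros Hb [_ [->|H]]; [lia|].
  assert (e - 1 <= Nat.log2 (n + 2)); [|lia].
  apply Nat.log2_le_pow2; [lia|].
  assert (2 ^ (e - 1) <= b ^ (e - 1)) by (apply Nat.pow_le_mono_l; lia). lia.
Qed.

Lemma pow4_add x y : (x + y) ^ 4 <= 16 * (x ^ 4 + y ^ 4).
Proof.
  destruct (Nat.le_ge_cases x y) as [H|H].
  - apply Nat.le_trans with ((2 * y) ^ 4); [apply Nat.pow_le_mono_l; lia|].
    rewrite Nat.pow_mul_l. change (2 ^ 4) with 16. lia.
  - apply Nat.le_trans with ((2 * x) ^ 4); [apply Nat.pow_le_mono_l; lia|].
    rewrite Nat.pow_mul_l. change (2 ^ 4) with 16. lia.
Qed.

(** Smaller terms such as [n * g] and [g * g] are absorbed in [g * g * 31 ^ d], because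
    [n + 1 <= 16 ^ d <= 31 ^ d]. *)
Lemma time_shape n d g l : 1 <= g -> n + 1 <= 16 ^ d ->
  total_time n d g l <=
  (block_time + 100 * 100) * ((d + l + 2) * (g * g * 31 ^ d + (n + 1) * ((n + 1) / g + 1))).
Proof.
  intros Hg Hd. unfold total_time.
  assert (H16 : 16 ^ d <= 31 ^ d) by (apply Nat.pow_le_mono_l; lia).
  generalize dependent (31 ^ d); intros e He. generalize block_time; intros K.
  set (sz := (n + 1) / g + 1). set (m := n + 1) in *.
  set (Q := g * g * e). set (R := m * sz).
  assert (Hme : m <= e) by (unfold m in *; lia).
  assert (H2 : g * m <= Q).
  { unfold Q. rewrite <- Nat.mul_assoc. apply Nat.mul_le_mono_l. nia. }
  assert (H1 : m <= Q) by nia.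
  assert (H3 : g * g <= Q).
  { unfold Q. rewrite <- (Nat.mul_1_r (g * g)) at 1. apply Nat.mul_le_mono_l. unfold m in *; lia. }
  assert (H4 : 1 <= Q) by (unfold m in *; lia).
  assert (H5 : g <= g * g) by nia.
  assert (H6 : g * (g * (K * ((d + 1) * e) + 60) + 20) = K * ((d + 1) * Q) + 60 * (g * g) + 20 * g)
    by (unfold Q; ring).
  rewrite H6.
  assert (H7 : (2 * n + 1) * ((g + sz) * 400 + 200) <= 800 * (g * m) + 800 * R + 400 * m).
  { unfold R. apply Nat.le_trans with (2 * m * ((g + sz) * 400 + 200)); [apply Nat.mul_le_mono_r; unfold m; lia|].
    apply Nat.eq_le_incl; ring. }
  assert (H8 : K * ((d + 1) * Q) <= K * ((d + l + 2) * (Q + R))).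
  { apply Nat.mul_le_mono_l, Nat.mul_le_mono; lia. }
  assert (H9 : m * (l + 1) <= (d + l + 2) * (Q + R)).
  { rewrite (Nat.mul_comm m). apply Nat.mul_le_mono; lia. }
  assert (H10 : Q + R <= (d + l + 2) * (Q + R)).
  { rewrite <- (Nat.mul_1_l (Q + R)) at 1. apply Nat.mul_le_mono_r; lia. }
  rewrite Nat.mul_add_distr_r. lia.
Qed.

(** With [m = n + 1], minimality of [g] gives [g ^ 4 <= 16 * m], and [m <= g ^ 4] gives
    [(m / g) ^ 4 <= m ^ 3]. So the fourth power of the convolution term is of order [m ^ 2 * m ^ 5],
    that of the scan term of order [m ^ 4 * m ^ 3]. *)
Lemma total_time_bound : exists C, forall n d g l,
  minimal_pow 16 d (n + 1) -> minimal_pow 2 l (n + 1) -> 1 <= g ->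
  n + 1 <= g ^ 4 -> (g - 1) ^ 4 < n + 1 ->
  (total_time n d g l) ^ 4 <= C * (n + 1) ^ 7 * Nat.log2 (n + 2) ^ 4.
Proof.
  exists ((block_time + 100 * 100) ^ 4 * (6 ^ 4 * (16 * (16 ^ 7 + 16 * 2)))).
  intros n d g l Hd Hl Hg Hg4 Hgm.
  (* Both [d] and [l] are at most one more than the logarithm, which itself is at least 1. *)
  assert (HL : d + l + 2 <= 6 * Nat.log2 (n + 2)).
  { pose proof (log_bound 16 d n ltac:(lia) Hd). pose proof (log_bound 2 l n ltac:(lia) Hl).
    pose proof (Nat.log2_pos (n + 2) ltac:(lia)). lia. }
  pose proof (time_shape n d g l Hg (proj1 Hd)) as HT.
  assert (Hd16 : 16 ^ d <= 16 * (n + 1)) by (apply minimal_pow_le; auto; lia).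
  apply pow31_bound in Hd16.
  set (m := n + 1) in *. set (e := 31 ^ d) in *. set (sz := m / g + 1) in *.
  set (L := Nat.log2 (n + 2)) in *. set (KK := block_time + 100 * 100) in *.
  assert (Hm : 1 <= m) by (unfold m; lia).
  assert (HQ : (g * g * e) ^ 4 <= 16 ^ 7 * m ^ 7).
  { rewrite !Nat.pow_mul_l, <- (Nat.pow_mul_l 16 m).
    replace ((16 * m) ^ 7) with (16 * m * (16 * m) * (16 * m) ^ 5) by (rewrite !Nat.pow_succ_r'; ring).
    assert (Hg16 : g ^ 4 <= 16 * m).
    { destruct (Nat.eq_dec g 1) as [->|]; [simpl (1 ^ 4); lia|].
      apply Nat.le_trans with ((2 * (g - 1)) ^ 4); [apply Nat.pow_le_mono_l; lia|].
      rewrite Nat.pow_mul_l. change (2 ^ 4) with 16. lia. }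
    apply Nat.mul_le_mono; [apply Nat.mul_le_mono|]; auto. }
  assert (HR : (m * sz) ^ 4 <= 16 * 2 * m ^ 7).
  { rewrite Nat.pow_mul_l. replace (m ^ 7) with (m ^ 4 * m ^ 3) by (rewrite <- Nat.pow_add_r; reflexivity).
    assert (Hq : (m / g) ^ 4 <= m ^ 3).
    { apply (Nat.mul_le_mono_pos_r _ _ m); [lia|].
      apply Nat.le_trans with ((m / g) ^ 4 * g ^ 4); [apply Nat.mul_le_mono_l; auto|].
      rewrite <- Nat.pow_mul_l. replace (m ^ 3 * m) with (m ^ 4) by (rewrite !Nat.pow_succ_r'; ring).
      apply Nat.pow_le_mono_l. rewrite Nat.mul_comm. apply Nat.Div0.mul_div_le. }
    assert (Hm3 : 1 <= m ^ 3) by (apply pow_pos; lia).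
    assert (Hs : sz ^ 4 <= 16 * 2 * m ^ 3).
    { unfold sz. eapply Nat.le_trans; [apply pow4_add|]. simpl (1 ^ 4). lia. }
    apply (Nat.mul_le_mono_l _ _ (m ^ 4)) in Hs. lia. }
  remember (16 ^ 7) as K7 eqn:EK. clear EK.
  eapply Nat.le_trans; [apply Nat.pow_le_mono_l, HT|].
  rewrite !Nat.pow_mul_l.
  pose proof (pow4_add (g * g * e) (m * sz)) as HS.
  apply (Nat.pow_le_mono_l _ _ 4) in HL. rewrite Nat.pow_mul_l in HL.
  assert (HS' : (g * g * e + m * sz) ^ 4 <= 16 * (K7 + 16 * 2) * m ^ 7).
  { eapply Nat.le_trans; [exact HS|]. rewrite <- (Nat.mul_assoc 16 (K7 + 16 * 2)). apply Nat.mul_le_mono_l.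
    rewrite Nat.mul_add_distr_r. apply Nat.add_le_mono; auto. }
  apply Nat.le_trans with (KK ^ 4 * (6 ^ 4 * L ^ 4 * (16 * (K7 + 16 * 2) * m ^ 7))).
  { apply Nat.mul_le_mono_l, Nat.mul_le_mono; auto. }
  generalize (KK ^ 4), (6 ^ 4), (16 * (K7 + 16 * 2)), (m ^ 7), (L ^ 4). intros; nia.
Qed.

(* There is a word-RAM program P and a constant c such that, for every n
   and every word size w >= c*log2(n+2) (i.e. 2^w >= (n+2)^c), and all
   input vectors A, B of non-negative integers fitting in a word, P
   computes the (max,min)-skewed convolution C[0..2n] within T steps,
   where T <= c * n^{7/4} * log^c(n+2), stated without real exponents as
   T^4 <= c * (n+1)^7 * (log2(n+2))^c. *)
Theorem mainTheorem3 :
  exists (P : program) (c : nat),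
    forall (n w : nat) (A B : nat -> nat),
      (n + 2) ^ c <= 2 ^ w ->
      (forall i, i <= n -> A i < 2 ^ w) ->
      (forall j, j <= n -> B j < 2 ^ w) ->
      exists T : nat,
        T ^ 4 <= c * (n + 1) ^ 7 * (Nat.log2 (n + 2)) ^ c /\
        computes_within w P n A B T.
Proof.
  destruct total_time_bound as [C HC].
  (* The constant has to be at least 146 for the word size, 4 for the power of the logarithm and [C]
     for the factor; the sum serves all three. *)
  exists (ccmd 0 0 main_cmd ++ [IHalt]), (C + 200).
  intros n w A B Hw HA HB.
  set (W := 2 ^ w) in *.
  assert (HW146 : (n + 2) ^ 146 <= W).
  { eapply Nat.le_trans; [|exact Hw]. apply Nat.pow_le_mono_r; lia. }
  assert (HnW : n + 2 <= W) by (pose proof (pow_ge_self (n + 2) 146 ltac:(lia)); lia).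
  assert (Hwf := wf_init W n A B HA HB ltac:(lia)).
  destruct (main_cmd_ok W n A B HW146 ltac:(lia) Hwf) as (d & g & l & Hd & Hl & Hg1 & Hg4 & Hg & Hok).
  destruct (Hok Hwf) as [Hout Hcost].
  exists (total_time n d g l). split.
  - eapply Nat.le_trans; [apply HC; auto|].
    apply Nat.mul_le_mono; [apply Nat.mul_le_mono_r; lia|].
    apply Nat.pow_le_mono_r; [|lia]. pose proof (Nat.log2_pos (n + 2) ltac:(lia)). lia.
  - set (s0 := St (fun _ => 0) (input_mem n A B)) in *.
    set (P := ccmd 0 0 main_cmd ++ [IHalt]).
    destruct (ccmd_correct w P ltac:(fold W; lia) main_cmd 0 (init_config n A B) s0)
      as (k & Hk & H1 & H2 & _).
    + exact Hwf.
    + split; reflexivity.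
    + intros i x Hi. change (nth_error (ccmd 0 0 main_cmd) i = Some x) in Hi. unfold P. cbn [pc init_config Nat.add].
      rewrite nth_error_app1; [exact Hi|]. apply nth_error_Some. congruence.
    + exists k. split; [fold W in Hk; lia|]. cbv zeta. split.
      * unfold halted. rewrite H1. cbn [pc init_config Nat.add]. unfold P.
        rewrite nth_error_app2 by apply le_n. now rewrite Nat.sub_diag.
      * intros k' Hk'. rewrite (sim_M _ _ H2). now apply Hout.
Qed.
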